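(* Let $n\ge 3$ and $k\ge 1$ be integers with $n\geq 2k$, and let $\theta,\rho\in\mathbb{R}$. For every $\alpha>0$, the elliptic equation $$\sigma_k^{1/k}\left(D^{2}\big(u^{-\frac{2k}{n+2k}}\big)-\frac{u^{\frac{2k}{n+2k}}}{2}\big|D\big(u^{-\frac{2k}{n+2k}}\big)\big|^{2}I\right)=u^{\frac{2k}{n+2k}-1}\left[(2\theta+\rho)u+\frac{4k\theta}{n+2k}\,x\cdot Du\right]\quad\text{on }\mathbb{R}^n$$ admits a non-trivial admissible radially symmetric smooth solution $u_\alpha>0$ with $u_\alpha(0)=\alpha$ if and only if $$\theta>0\quad\text{and}\quad 2\theta+\rho>0.$$
   Context: All derivatives and norms are Euclidean. For a symmetric matrix with eigenvalues $\lambda_1,\dots,\lambda_n$, $\sigma_k=\sum_{i_1<\dots<i_k}\lambda_{i_1}\cdots\lambda_{i_k}$. For $u>0$ put $g_u=u^{\frac{4k}{n+2k}}|dx|^2$; $A_g=\frac{1}{n-2}\left(\mathrm{Ric}_g-\frac{R_g}{2(n-1)}g\right)$ is the Schouten tensor of $g$ and $\sigma_j(g):=\sigma_j(g^{-1}A_g)$. A solution $u$ is admissible if $g_u\in\Gamma_k^+$, i.e. $\sigma_1(g_u),\dots,\sigma_k(g_u)>0$ everywhere. Radial solutions of the equation correspond to rotationally symmetric $k$-Yamabe gradient solitons $(\sigma_k^{1/k}(g_u)-\rho)g_u=\nabla^2\varphi$ with radial potential $\varphi$ satisfying $r\varphi_r=2\theta r^2u^{\frac{4k}{n+2k}}$,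 $r=|x|$; non-trivial means that $\varphi$ is not constant. *)

(* Defs.v *)
From HB Require Import structures.
From mathcomp Require Import all_boot all_order all_algebra.
From mathcomp Require Import all_classical all_reals all_analysis.
Set Implicit Arguments.
Unset Strict Implicit.
Unset Printing Implicit Defensive.
Import Order.TTheory GRing.Theory Num.Theory.
Import numFieldNormedType.Exports.
Local Open Scope classical_set_scope.
Local Open Scope ring_scope.

(* R^n is 'rV[R]_n, whose library norm `|x| is the sup norm;
   the Euclidean norm is [enorm]. Both norms induce the same derivatives. *)

Section Euclidean.
Context (R : realType) (n : nat).
Implicit Types (f : 'rV[R]_n -> R) (x : 'rV[R]_n).

Definition dot (x y : 'rV[R]_n) : R := \sum_(i < n) x 0 i * y 0 i.

Definition enorm x : R := Num.sqrt (dot x x).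

Definition partial (i : 'I_n) f : 'rV[R]_n -> R :=
  fun x => 'D_(delta_mx 0 i) (f : 'rV[R]_n -> R^o) x.

Definition grad f x : 'rV[R]_n := \row_i partial i f x.

Definition hess f x : 'M[R]_n := \matrix_(i, j) partial i (partial j f) x.

Fixpoint Cdiff (m : nat) f : Prop :=
  match m with
  | 0 => continuous (f : 'rV[R]_n -> R^o)
  | p.+1 => (forall x, differentiable (f : 'rV[R]_n -> R^o) x) /\
            (forall i, Cdiff p (partial i f))
  end.

Definition smooth f : Prop := forall m, Cdiff m f.

Definition radial f : Prop := forall x y, enorm x = enorm y -> f x = f y.

(* f_r; only meaningful for x != 0. *)
Definition radial_derivative f x : R :=
  'D_((enorm x)^-1 *: x) (f : 'rV[R]_n -> R^o) x.

End Euclidean.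

Section SigmaK.
Context (R : realType) (n : nat).

(* Eigenvalues with multiplicity. The default value 0 is used only when the
   characteristic polynomial does not split over R; this does not happen for
   symmetric matrices, nor for g^-1 *m S with g positive definite and S
   symmetric. The order of the eigenvalues is irrelevant for [sigma]. *)
Definition eigenvals (A : 'M[R]_n) : 'rV[R]_n :=
  xget 0 [set l : 'rV[R]_n | char_poly A = \prod_(i < n) ('X - (l 0 i)%:P)].

(* Subsets I of cardinality k stand for i_1 < ... < i_k. *)
Definition sigma (k : nat) (A : 'M[R]_n) : R :=
  \sum_(I : {set 'I_n} | #|I| == k) \prod_(i in I) eigenvals A 0 i.

(* Faithful as a k-th root when 0 < sigma k A, since powR takes junk values on
   negative numbers. *)
Definition sigma_root (k : nat) (A : 'M[R]_n) : R :=
  sigma k A `^ (k%:R^-1).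

End SigmaK.

(* Riemannian geometry in the global coordinates of R^n: a metric is given by
   its matrix of components. *)
Section Metric.
Context (R : realType) (n : nat).
Implicit Types (g : 'rV[R]_n -> 'M[R]_n) (x : 'rV[R]_n) (i j l m : 'I_n).

Definition metric_comp g i j : 'rV[R]_n -> R := fun x => g x i j.

(* christoffel g l i j is Gamma^l_{ij}. *)
Definition christoffel g l i j : 'rV[R]_n -> R := fun x =>
  2^-1 * \sum_(m < n) invmx (g x) l m *
    (partial i (metric_comp g j m) x + partial j (metric_comp g i m) x
     - partial m (metric_comp g i j) x).

(* The component R^l_{mij} along d_l of R(d_i, d_j) d_m, with
   R(X, Y) = [D_X, D_Y] - D_[X, Y]. *)
Definition riemann g l m i j : 'rV[R]_n -> R := fun x =>
  partial i (christoffel g l j m) x - partial j (christoffel g l i m) x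
  + \sum_(p < n) (christoffel g l i p x * christoffel g p j m x
                  - christoffel g l j p x * christoffel g p i m x).

(* With this contraction round spheres have positive Ricci curvature. *)
Definition ricci g x : 'M[R]_n :=
  \matrix_(m, j) \sum_(i < n) riemann g i m i j x.

Definition scalar_curvature g x : R := \tr (invmx (g x) *m ricci g x).

Definition schouten g x : 'M[R]_n :=
  (n%:R - 2)^-1 *:
    (ricci g x - (scalar_curvature g x / (2 * (n%:R - 1))) *: g x).

Definition gschouten g x : 'M[R]_n := invmx (g x) *m schouten g x.

Definition gamma_cone (k : nat) g : Prop :=
  forall x (j : nat), (1 <= j <= k)%N -> 0 < sigma j (gschouten g x).

Definition cov_hess g (phi : 'rV[R]_n -> R) x : 'M[R]_n :=
  \matrix_(i, j) (partial i (partial j phi) x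
                  - \sum_(l < n) christoffel g l i j x * partial l phi x).

End Metric.

Section KYamabe.
Context (R : realType) (n k : nat).
Implicit Types (u phi : 'rV[R]_n -> R) (theta rho : R).

Definition yamabe_metric u : 'rV[R]_n -> 'M[R]_n :=
  fun x => (u x `^ ((4 * k)%:R / (n + 2 * k)%:R))%:M.

Definition admissible u : Prop := gamma_cone k (yamabe_metric u).

Definition kyamabe_equation theta rho u : Prop :=
  let a : R := (2 * k)%:R / (n + 2 * k)%:R in
  let v : 'rV[R]_n -> R := fun y => u y `^ (- a) in
  forall x : 'rV[R]_n,
    sigma_root k (hess v x - (u x `^ a / 2 * enorm (grad v x) ^+ 2)%:M)
    = u x `^ (a - 1) *
      ((2 * theta + rho) * u x
       + (4 * k)%:R * theta / (n + 2 * k)%:R * dot x (grad u x)).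

Definition gradient_soliton rho (g : 'rV[R]_n -> 'M[R]_n) phi : Prop :=
  forall x : 'rV[R]_n,
    (sigma_root k (gschouten g x) - rho) *: g x = cov_hess g phi x.

Definition soliton_potential theta rho u phi : Prop :=
  [/\ smooth phi,
      radial phi,
      gradient_soliton rho (yamabe_metric u) phi
    & forall x : 'rV[R]_n,
        enorm x * radial_derivative phi x
        = 2 * theta * enorm x ^+ 2 * u x `^ ((4 * k)%:R / (n + 2 * k)%:R)].

(* [soliton_potential] determines phi up to an additive constant. *)
Definition nontrivial theta rho u : Prop :=
  exists2 phi, soliton_potential theta rho u phi
             & ~ exists c : R, forall x, phi x = c.

End KYamabe.

(* Main.v *)
Require Import Defs.
From HB Require Import structures.
From mathcomp Require Import all_boot all_order all_algebra.
From mathcomp Require Import all_classical all_reals all_analysis.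
From mathcomp Require Import ring lra.
Import Order.TTheory GRing.Theory Num.Theory.
Import numFieldNormedType.Exports.
Local Open Scope classical_set_scope.
Local Open Scope ring_scope.
Set Implicit Arguments.
Unset Strict Implicit.
Unset Printing Implicit Defensive.

(** In the variable t = |x|^2 write u^(-2k/(n+2k)) = V(t), so that the metric is
V^(-2) |dx|^2, and put P = t V'/V, F = 2 theta + rho - 4 theta P and
lam = 2 V' (V - t V').  The Schouten tensor then has the eigenvalue lam with
multiplicity n - 1 and the radial eigenvalue lam + 4 t V V'', and the equation reads
lam^(k-1) (lam + (k/n) 4 t V V'') = (mu F)^k with mu^(-k) = binom(n, k).
Everything rests on the sign of D = lam^k - (mu F)^k, which is opposite to that of
V'' and satisfies
((t/V^2)^(n/2) D)' = (t/V^2)^(n/2) k mu^k F^(k-1) (2 theta/V^2) (lam + 2 t V V'').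

If theta > 0 then D >= 0, so V is concave.  This gives explicit a priori bounds for
V, V', lam and P, and makes F decay at most exponentially.  The unknown
Y = ((V^2)')^k solves a singular equation t Y' = - (n/2) (Y - Y(0)) + t K(Y), whose
nonlinearity K can be truncated outside the a priori region; Picard iteration of the
resulting Volterra equation converges on the whole half-line and the bounds remove the
truncation.  Smoothness at the origin holds because the averages
t^(-b) * (integral of s^(b-1) f over [0, t]) are as smooth as f.

If theta < 0 then D < 0, so V is convex, and either V - t V' decreases logarithmically
to -oo while positivity of lam forces it to be positive, or k = 1 and P blows up.
The value at the origin gives 2 theta + rho > 0, and theta = 0 makes the potential
constant. *)

(** * Calculus on the half-line *)

(** The choice of Y comes from two identities for y = (V^2)' = 2 V V', namely lam = y (1 - P) and 4
    t V V'' = 2 t y' - 2 P y. Divided by (1 - P)^(k-1), the equation contains second derivatives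
    only through t (y^k)', so in Y = y^k it is linear in its highest derivative, with a regular
    singular point at 0; the solution bounded there is a weighted average of the remaining terms.
    The price is that Y has to stay away from 0 and P away from 1, which the truncation enforces
    until the a priori bounds take over. The condition n >= 2 k acts through H = lam + 2 t V V'' = 2
    V^2 P', for which the equation gives H lam^(k-1) = (mu F)^k - (n/(2k) - 1) D. As the factor of D
    is nonnegative, D >= 0 bounds P' from above, which protects F when theta > 0, while D <= 0 makes
    P' positive, which drives the contradiction when theta < 0. *)

Section HalfLine.
Context {R : realType}.
Implicit Types (f g df dg : R -> R) (t a b : R).

(* Continuity on [0, +oo[, phrased through the even extension so that it is
   stable under composition without any subspace topology. *)
Definition cont0 f := continuous (fun t => f `|t|).

Lemma cont0_within f a b : cont0 f -> 0 <= a -> {within `[a, b], continuous f}.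
Proof.
move=> cf a0; apply: (@subspace_eq_continuous _ _ _ (fun t => f `|t|)).
  move=> x; rewrite inE/= in_itv/= => /andP[ax _].
  by rewrite ger0_norm // (le_trans a0 ax).
exact: continuous_subspaceT.
Qed.

Lemma continuous_cont0 f : continuous f -> cont0 f.
Proof.
move=> cf t; apply: (@continuous_comp _ _ _ (fun x : R => `|x|) f).
  exact: norm_continuous.
exact: cf.
Qed.

Lemma cont0_cst a : cont0 (fun=> a).
Proof. by move=> t; exact: cvg_cst. Qed.

Lemma cont0_id : cont0 id.
Proof. exact: norm_continuous. Qed.

Lemma cont0D f g : cont0 f -> cont0 g -> cont0 (fun t => f t + g t).
Proof. by move=> cf cg t; exact: (continuousD (cf t) (cg t)). Qed.

Lemma cont0N f : cont0 f -> cont0 (fun t => - f t).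
Proof. by move=> cf t; exact: (continuousN (cf t)). Qed.

Lemma cont0M f g : cont0 f -> cont0 g -> cont0 (fun t => f t * g t).
Proof. by move=> cf cg t; exact: (continuousM (cf t) (cg t)). Qed.

Lemma cont0X f n : cont0 f -> cont0 (fun t => f t ^+ n).
Proof.
move=> cf; elim: n => [|n ih]; first exact: cont0_cst.
rewrite (_ : (fun t => _) = fun t => f t * f t ^+ n).
  exact: cont0M.
by apply/funext => t; rewrite exprS.
Qed.

Lemma cont0V f : cont0 f -> (forall t, 0 <= t -> f t != 0) ->
  cont0 (fun t => (f t)^-1).
Proof. by move=> cf f0 t; apply: continuousV; [exact: f0|exact: cf]. Qed.

Lemma cont0_comp (h : R -> R) f : continuous h -> cont0 f ->
  cont0 (fun t => h (f t)).
Proof. by move=> ch cf t; apply: continuous_comp; [exact: cf|exact: ch]. Qed.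

Lemma eq_cont0 f g : (forall t, 0 <= t -> f t = g t) -> cont0 f -> cont0 g.
Proof.
move=> fg; rewrite /cont0; rewrite (_ : (fun t => f `|t|) = fun t => g `|t|) //.
by apply/funext => t; rewrite fg.
Qed.

Lemma cont0_near f t e : cont0 f -> 0 <= t -> 0 < e ->
  exists2 d, 0 < d & forall s, 0 <= s -> `|s - t| < d -> `|f s - f t| < e.
Proof.
move=> cf t0 e0; have /cvgrPdist_lt/(_ _ e0) := cf t.
move=> /nbhs_ballP[d /= d0 dP]; exists d => // s s0 st.
have : ball t d s by rewrite -ball_normE /= distrC.
by move=> /dP /=; rewrite (ger0_norm s0) (ger0_norm t0) distrC.
Qed.

Lemma cont0_pos_near f t : cont0 f -> 0 <= t -> 0 < f t ->
  exists2 d, 0 < d & forall s, 0 <= s -> `|s - t| < d -> 0 < f s.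
Proof.
move=> cf t0 ft; have [d d0 dP] := cont0_near cf t0 ft; exists d => // s s0 /(dP _ s0).
by rewrite ltr_norml => /andP[+ _]; lra.
Qed.

Lemma cont0_bounded f b : cont0 f ->
  exists2 M, 0 <= M & forall t, 0 <= t <= b -> `|f t| <= M.
Proof.
move=> cf; have [b0|b0] := ltP b 0.
  by exists 0 => // t /andP[t0 tb]; have := le_trans t0 tb; rewrite leNgt b0.
have cn : {within `[0, b], continuous (fun t => `|f t|)}.
  apply: cont0_within => //; apply: (cont0_comp _ cf); exact: norm_continuous.
have [c _ cP] := EVT_max b0 cn.
by exists `|f c| => // t t0b; apply: cP; rewrite in_itv.
Qed.

(** Continuation along [0, +oo[: at the infimum of the points where [f] fails to be positive, [step]
    makes [f] positive, and continuity then keeps such points away. It serves to remove the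
    truncation and to propagate the sign of lam. *)
Lemma cont0_open_induction f : cont0 f ->
  0 < f 0 -> (forall T, 0 < T -> (forall t, 0 <= t < T -> 0 < f t) -> 0 < f T) ->
  forall t, 0 <= t -> 0 < f t.
Proof.
move=> cf f00 step t t0; rewrite ltNge; apply/negP => ft.
pose A := [set s : R | 0 <= s /\ f s <= 0].
have hA : has_inf A.
  by split; [exists t|exists 0 => s []].
have infA0 : 0 <= inf A by apply: lb_le_inf; [exists t|move=> s []].
have below s : 0 <= s < inf A -> 0 < f s.
  move=> /andP[s0 sA]; rewrite ltNge; apply/negP => fs.
  by have := @ge_inf _ A hA.2 s (conj s0 fs); rewrite leNgt sA.
have fA : 0 < f (inf A).
  have [<-//|A0] := eqVneq 0 (inf A).
  by apply: step => //; rewrite lt_neqAle A0.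
have [d d0 dP] := cont0_pos_near cf infA0 fA.
have [s [s0 fs] sA] := inf_adherent d0 hA.
have : 0 < f s.
  apply: dP => //; rewrite ger0_norm ?ltrBlDl // subr_ge0.
  exact: (@ge_inf _ A hA.2 s).
by rewrite ltNge fs.
Qed.

Lemma der_eq f t a b : is_derive t (1 : R) f a -> a = b -> is_derive t (1 : R) f b.
Proof. by move=> + <-. Qed.

Lemma derD f g t a b : is_derive t (1 : R) f a -> is_derive t (1 : R) g b ->
  is_derive t (1 : R) (fun s => f s + g s) (a + b).
Proof. by move=> ? ?; exact: is_deriveD. Qed.

Lemma derN f t a : is_derive t (1 : R) f a ->
  is_derive t (1 : R) (fun s => - f s) (- a).
Proof. by move=> ?; exact: is_deriveN. Qed.

Lemma derM f g t a b : is_derive t (1 : R) f a -> is_derive t (1 : R) g b ->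
  is_derive t (1 : R) (fun s => f s * g s) (a * g t + f t * b).
Proof.
move=> ? ?; apply: is_derive_eq; rewrite /GRing.scale/=; ring.
Qed.

Lemma derX f n t a : is_derive t (1 : R) f a ->
  is_derive t (1 : R) (fun s => f s ^+ n) (n%:R * f t ^+ n.-1 * a).
Proof.
move=> fa; elim: n => [|n ih] /=.
  rewrite !mul0r (_ : (fun s => _) = cst 1); first exact: is_derive_cst.
  by apply/funext => s.
rewrite (_ : (fun s => _) = fun s => f s * f s ^+ n); last first.
  by apply/funext => s; rewrite exprS.
apply: (der_eq (derM fa ih)).
case: n {ih} => [|n]; rewrite ?expr0 ?exprS /= -?[in RHS]natr1; ring.
Qed.

Lemma derV f t a : f t != 0 -> is_derive t (1 : R) f a ->
  is_derive t (1 : R) (fun s => (f s)^-1) (- a / f t ^+ 2).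
Proof.
move=> f0 fa; apply: (der_eq (is_deriveV f0 fa)).
by rewrite /GRing.scale/= mulrC mulrN mulNr.
Qed.

Lemma der_cst t a : is_derive t (1 : R) (fun=> a) 0.
Proof. exact: is_derive_cst. Qed.

Lemma der_id t : is_derive t (1 : R) (fun s => s) 1.
Proof. exact: is_derive_id. Qed.

Lemma der_comp f g t a b : is_derive t (1 : R) g b -> is_derive (g t) (1 : R) f a ->
  is_derive t (1 : R) (fun s => f (g s)) (a * b).
Proof.
move=> gb fa; exact: (der_eq (is_derive1_comp fa gb)).
Qed.

Lemma der_unique f t a b : is_derive t (1 : R) f a -> is_derive t (1 : R) f b ->
  a = b.
Proof. by move=> fa fb; rewrite -(@derive_val _ _ _ _ _ _ _ fa) (@derive_val _ _ _ _ _ _ _ fb). Qed.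

Lemma der_near f g t a : (\forall s \near t, f s = g s) ->
  is_derive t (1 : R) f a -> is_derive t (1 : R) g a.
Proof. by move=> fg; exact: near_eq_is_derive. Qed.

Lemma der_eq_pos f g t a : 0 < t -> (forall s, 0 < s -> f s = g s) ->
  is_derive t (1 : R) f a -> is_derive t (1 : R) g a.
Proof.
move=> t0 fg; apply: der_near; near=> s; apply: fg; near: s.
exact: lt_nbhsr.
Unshelve. all: by end_near. Qed.

(** Differentiability is asked for in the open interval only: [a] is usually 0, where the functions
    are merely continuous from the right. *)
Lemma le_der f g df dg a b : cont0 f -> cont0 g -> 0 <= a -> a <= b ->
  (forall t, a < t < b -> is_derive t (1 : R) f (df t)) ->
  (forall t, a < t < b -> is_derive t (1 : R) g (dg t)) ->
  (forall t, a < t < b -> df t <= dg t) ->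
  f a <= g a -> f b <= g b.
Proof.
move=> cf cg a0 ab Df Dg le_d fga.
have [<-//|anb] := eqVneq a b.
have {}ab : a < b by rewrite lt_neqAle anb.
pose h t := g t + - f t.
have ch : {within `[a, b], continuous h}.
  by apply: cont0_within => //; apply: cont0D => //; exact: cont0N.
have Dh t : t \in `]a, b[ -> is_derive t (1 : R) h (dg t + - df t).
  by rewrite in_itv => tab; apply: derD; [exact: Dg|apply: derN; exact: Df].
have [c cab e] := MVT ab Dh ch.
have : 0 <= h b - h a.
  rewrite e mulr_ge0 ?(ltW ab) ?subr_ge0 ?(ltW ab) //.
  by apply: le_d; rewrite in_itv in cab.
by rewrite /h; lra.
Qed.

(** A variant for functions such as V(t)/t, which are differentiable on the closed interval but need
    not be continuous at 0. *)
Lemma le_derc f g df dg a b : a <= b ->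
  (forall t, a <= t <= b -> is_derive t (1 : R) f (df t)) ->
  (forall t, a <= t <= b -> is_derive t (1 : R) g (dg t)) ->
  (forall t, a <= t <= b -> df t <= dg t) ->
  f a <= g a -> f b <= g b.
Proof.
move=> ab Df Dg le_d fga; pose h t := g t + - f t.
have Dh (t : R) : a <= t <= b -> is_derive t (1 : R) h (dg t + - df t).
  by move=> tab; apply: derD; [exact: Dg|apply: derN; exact: Df].
have ch : {within `[a, b], continuous h}.
  apply: derivable_within_continuous => t; rewrite in_itv => tab.
  by have [] := Dh t tab.
have Dh' t : t \in `]a, b[ -> is_derive t (1 : R) h (dg t + - df t).
  by rewrite in_itv => /andP[ta tb]; apply: Dh; rewrite !ltW.
have [c cab e] := MVT_segment ab Dh' ch.
have : 0 <= h b - h a.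
  rewrite e mulr_ge0 ?subr_ge0 //.
  by apply: le_d; rewrite in_itv in cab.
by rewrite /h; lra.
Qed.

Lemma eq_der f g df a b : cont0 f -> cont0 g -> 0 <= a -> a <= b ->
  (forall t, a < t < b -> is_derive t (1 : R) f (df t)) ->
  (forall t, a < t < b -> is_derive t (1 : R) g (df t)) ->
  f a = g a -> f b = g b.
Proof.
move=> cf cg a0 ab Df Dg e; apply/eqP; rewrite eq_le; apply/andP.
by split; [apply: (le_der cf cg a0 ab Df Dg)|apply: (le_der cg cf a0 ab Dg Df)];
  rewrite ?e.
Qed.

Lemma der_continuous f t a : is_derive t (1 : R) f a -> {for t, continuous f}.
Proof.
move=> [fa _]; apply: differentiable_continuous; exact/derivable1_diffP.
Qed.

End HalfLine.

(** * Antiderivatives and weighted averages *)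

Section Antiderivative.
Context {R : realType}.
Implicit Types (f g : R -> R) (t : R) (n : nat).

(* The integral starts at -1 so that 0 is interior to its domain. *)
Definition prim f t : R :=
  parameterized_integral lebesgue_measure (-1) t (fun s => f `|s|)
  - parameterized_integral lebesgue_measure (-1) 0 (fun s => f `|s|).

Lemma prim0 f : prim f 0 = 0.
Proof. exact: subrr. Qed.

Lemma prim_der f t : cont0 f -> -1 < t -> is_derive t (1 : R) (prim f) (f `|t|).
Proof.
move=> cf t1; have tt1 : t < t + 1 by rewrite ltrDl.
have int : lebesgue_measure.-integrable `[-1, t + 1] (EFin \o (fun s => f `|s|)).
  apply: continuous_compact_integrable; first exact: segment_compact.
  exact: continuous_subspaceT.
have [d e] := continuous_FTC1_closed tt1 int t1 (cf t).
apply: (der_eq (derD (DeriveDef d _) (der_cst t _))); last exact: addr0.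
by rewrite -derive1E.
Qed.

Lemma prim_cont0 f : cont0 f -> cont0 (prim f).
Proof.
move=> cf t; apply: (@continuous_comp _ _ _ (fun x : R => `|x|) (prim f)).
  exact: norm_continuous.
apply: der_continuous; apply: prim_der => //.
by rewrite (lt_le_trans _ (normr_ge0 _)) // ltrN10.
Qed.

Lemma prim_derp f t : cont0 f -> 0 < t -> is_derive t (1 : R) (prim f) (f t).
Proof.
move=> cf t0; rewrite -[in X in is_derive _ _ _ X](gtr0_norm t0).
by apply: prim_der => //; rewrite (lt_trans _ t0) // ltrN10.
Qed.

(** This is t^(n/2); [n] will be a dimension, possibly odd, hence the square root. *)
Definition hpow n t : R := Num.sqrt t ^+ n.

Lemma hpow_cont0 n : cont0 (hpow n).
Proof. by apply: cont0X; apply: continuous_cont0; exact: sqrt_continuous. Qed.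

Lemma hpow_gt0 n t : 0 < t -> 0 < hpow n t.
Proof. by move=> t0; rewrite exprn_gt0 // sqrtr_gt0. Qed.

Lemma hpow_ge0 n t : 0 <= hpow n t.
Proof. by rewrite exprn_ge0 // sqrtr_ge0. Qed.

Lemma hpow0 n : (0 < n)%N -> hpow n 0 = 0.
Proof. by move=> n0; rewrite /hpow sqrtr0 expr0n eqn0Ngt n0. Qed.

Lemma hpow_der n t : 0 < t ->
  is_derive t (1 : R) (hpow n) (n%:R / 2 * hpow n t / t).
Proof.
move=> t0; apply: (der_eq (derX n (is_derive1_sqrt t0))).
have s0 : Num.sqrt t != 0 by rewrite gt_eqF // sqrtr_gt0.
rewrite /hpow; case: n => [|n]; first by rewrite !mul0r.
have -> : t^-1 = (Num.sqrt t ^+ 2)^-1 by rewrite sqr_sqrtr // ltW.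
by rewrite exprS /=; field.
Qed.

(* t^(-n/2-1) times the integral of s^(n/2) f(s) over [0, t]; the value at 0 is the limit. *)
Definition wavg n f t : R :=
  if t == 0 then f 0 / (n%:R / 2 + 1)
  else prim (fun s => hpow n s * f s) t / (t * hpow n t).

Variable n : nat.

Let cw f : cont0 f -> cont0 (fun s => hpow n s * f s).
Proof. by move=> cf; apply: cont0M => //; exact: hpow_cont0. Qed.

Lemma wavgE f t : 0 < t ->
  hpow n t * (t * wavg n f t) = prim (fun s => hpow n s * f s) t.
Proof.
move=> t0; rewrite /wavg gt_eqF //.
have h0 : hpow n t != 0 by rewrite gt_eqF // hpow_gt0.
by field; rewrite h0 gt_eqF.
Qed.

(** The link with the singular equation: x = t [wavg n f t] is the solution of t x' + (n/2) x = t f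
    that stays bounded at 0. *)
Lemma wavg_der f t : cont0 f -> 0 < t ->
  is_derive t (1 : R) (fun s => s * wavg n f s) (f t - n%:R / 2 * wavg n f t).
Proof.
move=> cf t0; have h0 : hpow n t != 0 by rewrite gt_eqF // hpow_gt0.
have t0' : t != 0 by rewrite gt_eqF.
apply: (@der_eq_pos _ (fun s => prim (fun s => hpow n s * f s) s * (hpow n s)^-1)).
- exact: t0.
- move=> s s0; rewrite -wavgE //.
  have hs : hpow n s != 0 by rewrite gt_eqF // hpow_gt0.
  by field.
apply: (der_eq (derM (prim_derp (cw cf) t0) (derV h0 (hpow_der n t0)))).
rewrite -wavgE //; field.
by rewrite t0' h0.
Qed.

(** The gain of t / (j + 1) over the weight M t^j is that of ordinary integration, since the kernel
    (s/t)^(n/2) is at most 1. It produces the factorials of the Picard iteration. *)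
Lemma wavg_close f g T M j t : cont0 f -> cont0 g ->
  (forall s, 0 < s < T -> `|f s - g s| <= M * s ^+ j) -> 0 <= t <= T ->
  `|t * wavg n f t - t * wavg n g t| <= M * t ^+ j.+1 / j.+1%:R.
Proof.
wlog suff : f g / cont0 f -> cont0 g ->
  (forall s, 0 < s < T -> `|f s - g s| <= M * s ^+ j) -> 0 <= t <= T ->
  t * wavg n f t <= t * wavg n g t + M * t ^+ j.+1 / j.+1%:R.
  move=> H cf cg fg tT; rewrite ler_norml.
  have gf : forall s, 0 < s < T -> `|g s - f s| <= M * s ^+ j.
    by move=> s /fg; rewrite distrC.
  have := H _ _ cf cg fg tT; have := H _ _ cg cf gf tT.
  move: (t * wavg n f t) (t * wavg n g t) (M * _ / _) => p q r.
  by move=> h1 h2; apply/andP; split; lra.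
move=> cf cg fg /andP[t0 tT]; have [<-|t0'] := eqVneq 0 t.
  by rewrite !mul0r expr0n mulr0 mul0r addr0.
have {t0'}t0 : 0 < t by rewrite lt_neqAle t0'.
rewrite -(ler_pM2l (hpow_gt0 n t0)) mulrDr !wavgE //.
(* The comparison function carries the factor [hpow n t], whose derivative only adds a nonnegative
   term. *)
apply: (@le_der _ (prim (fun s => hpow n s * f s))
  (fun t => prim (fun s => hpow n s * g s) t + hpow n t * (M * t ^+ j.+1 / j.+1%:R))
  (fun t => hpow n t * f t)
  (fun t => hpow n t * g t + (n%:R / 2 * hpow n t / t * (M * t ^+ j.+1 / j.+1%:R)
    + hpow n t * (M * t ^+ j))) 0 t).
- exact/prim_cont0/cw.
- apply: cont0D; first exact/prim_cont0/cw.
  apply: cont0M; first exact: hpow_cont0.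
  apply: cont0M; last exact: cont0_cst.
  by apply: cont0M; [exact: cont0_cst|apply: cont0X; exact: cont0_id].
- by [].
- exact: ltW.
- by move=> s /andP[s0 _]; exact/prim_derp/s0/cw.
- move=> s /andP[s0 _]; apply: derD; first exact/prim_derp/s0/cw.
  apply: (der_eq (derM (hpow_der n s0) (derM (derM (der_cst s M)
    (derX j.+1 (der_id s))) (der_cst s (j.+1%:R^-1))))).
  rewrite /=; field.
  by rewrite (gt_eqF s0) andbT /= addrC natr1 pnatr_eq0.
- move=> s /andP[s0 st].
  have sT : 0 < s < T by rewrite s0 (lt_le_trans st).
  have M0 : 0 <= M * s ^+ j by apply: le_trans (fg _ sT).
  have : hpow n s * f s <= hpow n s * (g s + M * s ^+ j).
    rewrite ler_wpM2l ?hpow_ge0 //.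
    by have := fg _ sT; rewrite ler_norml; lra.
  have : 0 <= n%:R / 2 * hpow n s / s * (M * s ^+ j.+1 / j.+1%:R).
    apply: mulr_ge0; first by rewrite divr_ge0 ?mulr_ge0 ?divr_ge0 ?hpow_ge0 ?(ltW s0).
    by apply: divr_ge0 => //; rewrite exprS mulrCA mulr_ge0 // ltW.
  by move=> hA; rewrite mulrDr => hB; apply: le_trans hB _; rewrite lerD2l lerDr.
- by rewrite !prim0 exprS mul0r mulr0 mul0r mulr0 addr0.
Qed.

Lemma wavg_cst c t : 0 < t -> wavg n (fun=> c) t = c / (n%:R / 2 + 1).
Proof.
move=> t0; have n0 : n%:R / 2 + 1 != 0 :> R.
  by rewrite gt_eqF // ltr_wpDl // divr_ge0.
have h0 : hpow n t != 0 by rewrite gt_eqF // hpow_gt0.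
have t0' : t != 0 by rewrite gt_eqF.
suff : prim (fun s => hpow n s * c) t = hpow n t * (t * (c / (n%:R / 2 + 1))).
  by rewrite -wavgE // => /(mulfI h0)/(mulfI t0').
pose G s := hpow n s * (s * (c / (n%:R / 2 + 1))).
have cc : cont0 (fun s => hpow n s * c) by apply: cw; exact: cont0_cst.
have cG : cont0 G.
  apply: cont0M; first exact: hpow_cont0.
  by apply: cont0M; [exact: cont0_id|exact: cont0_cst].
have DG (s : R) : 0 < s -> is_derive s (1 : R) G (hpow n s * c).
  move=> s0; apply: (der_eq (derM (hpow_der n s0)
    (derM (der_id s) (der_cst s (c / (n%:R / 2 + 1)))))).
  field; rewrite (gt_eqF s0) andbT.
  by have := n0; rewrite gt_eqF //; apply: ltr_wpDl.
have e0 : prim (fun s => hpow n s * c) 0 = G 0 by rewrite prim0 /G mul0r mulr0.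
apply: (eq_der (prim_cont0 cc) cG (lexx 0) (ltW t0) _ _ e0) => s /andP[s0 _].
  exact: prim_derp.
exact: DG.
Qed.

Lemma wavg_cont0 f : cont0 f -> cont0 (wavg n f).
Proof.
move=> cf; suff H (x : R) : {for x, continuous (fun t => wavg n f `|t|)} by exact: H.
have [->|x0] := eqVneq x 0; last first.
  have nx0 : 0 < `|x| by rewrite normr_gt0.
  apply: (@continuous_comp _ _ _ (fun x : R => `|x|) (wavg n f)).
    exact: norm_continuous.
  apply: (@der_continuous _ _ _ (((f `|x| - n%:R / 2 * wavg n f `|x|) * `|x|^-1 +
     (`|x| * wavg n f `|x|) * (- 1 / `|x| ^+ 2)))).
  apply: (@der_eq_pos _ (fun s => (s * wavg n f s) * s^-1)) => //.
    by move=> s s0; rewrite mulrC mulKf // gt_eqF.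
  apply: (derM (wavg_der cf nx0)); apply: derV (der_id _).
  by rewrite gt_eqF.
apply/cvgrPdist_le => e e0.
have [d d0 dP] := cont0_near cf (lexx 0) e0.
apply/nbhs_ballP; exists d => // y /=; rewrite sub0r normrN normr0 => yd.
have [->|y0] := eqVneq y 0; first by rewrite normr0 subrr normr0 ltW.
have ny0 : 0 < `|y| by rewrite normr_gt0.
rewrite -(ler_pM2l ny0) -[X in X * `| _ |](gtr0_norm ny0) -normrM mulrBr.
(* The value of [wavg] at 0 is the average of the constant [f 0], so continuity there is
   [wavg_close] with j = 0 and the oscillation bound [e] of [f] as M. *)
have -> : wavg n f 0 = wavg n (fun=> f 0) `|y| by rewrite wavg_cst // /wavg eqxx.
have cc := @cont0_cst R (f 0).
have := @wavg_close _ _ `|y| e 0 `|y| cc cf.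
rewrite expr1 divr1 [e * _]mulrC; apply.
  move=> s /andP[s0 sy]; rewrite expr0 mulr1 distrC ltW //; apply: dP; first exact: ltW.
  by rewrite subr0 gtr0_norm // (lt_trans sy).
by rewrite lexx ltW.
Qed.

End Antiderivative.

(** * Differentiability classes on the half-line *)

Section Chalf.
Context {R : realType}.
Implicit Types (f g : R -> R) (t a : R) (n m : nat).

(** Derivatives are taken at t > 0 only, and [cont0] of each of them requires continuity up to 0. No
    one-sided derivative is involved, yet this is enough for f(|x|^2) to be C^m at the origin. *)
Fixpoint Chalf m f : Prop :=
  cont0 f /\
  if m is p.+1 then
    exists2 g : R -> R, (forall t : R, 0 < t -> is_derive t (1 : R) f (g t)) & Chalf p g
  else True.

Lemma Chalf_cont0 m f : Chalf m f -> cont0 f.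
Proof. by case: m => [|m] []. Qed.

Lemma ChalfW m f : Chalf m.+1 f -> Chalf m f.
Proof.
elim: m f => [|m ih] f [cf [g fg gm]]; split=> //.
by exists g => //; exact: ih.
Qed.

Lemma ChalfS m f g : cont0 f -> (forall t, 0 < t -> is_derive t (1 : R) f (g t)) ->
  Chalf m g -> Chalf m.+1 f.
Proof. by move=> cf fg gm; split=> //; exists g. Qed.

Lemma eq_Chalf m f g : (forall t, 0 <= t -> f t = g t) -> Chalf m f -> Chalf m g.
Proof.
case: m => [|m] fg [cf fm]; first by split=> //; exact: eq_cont0 fg cf.
split; first exact: eq_cont0 fg cf.
case: fm => h fh hm; exists h => // t t0.
by apply: (der_eq_pos t0 _ (fh _ t0)) => s s0; apply: fg; exact: ltW.
Qed.

Lemma Chalf_cst m a : Chalf m (fun=> a).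
Proof.
elim: m a => [|m ih] a; first by split=> //; exact: cont0_cst.
by apply: (@ChalfS _ _ (fun=> 0)) => //; exact: cont0_cst.
Qed.

Lemma Chalf_id m : Chalf m id.
Proof.
case: m => [|m]; first by split=> //; exact: cont0_id.
apply: (@ChalfS _ _ (fun=> 1)) => //; [exact: cont0_id|exact: Chalf_cst].
Qed.

Lemma ChalfD m f g : Chalf m f -> Chalf m g -> Chalf m (fun t => f t + g t).
Proof.
elim: m f g => [|m ih] f g [cf fm] [cg gm]; first by split=> //; exact: cont0D.
case: fm => f' ff' f'm; case: gm => g' gg' g'm.
apply: (ChalfS _ _ (ih _ _ f'm g'm)); first exact: cont0D.
by move=> t t0; apply: derD; [exact: ff'|exact: gg'].
Qed.

Lemma ChalfM m f g : Chalf m f -> Chalf m g -> Chalf m (fun t => f t * g t).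
Proof.
elim: m f g => [|m ih] f g fm gm.
  by case: fm gm => cf _ [cg _]; split=> //; exact: cont0M.
have [fm' gm'] := (ChalfW fm, ChalfW gm).
case: fm => cf [f' ff' f'm]; case: gm => cg [g' gg' g'm].
apply: (ChalfS _ _ (ChalfD (ih _ _ f'm gm') (ih _ _ fm' g'm))); first exact: cont0M.
by move=> t t0; apply: derM; [exact: ff'|exact: gg'].
Qed.

Lemma ChalfN m f : Chalf m f -> Chalf m (fun t => - f t).
Proof.
move=> fm; apply: (eq_Chalf _ (ChalfM (Chalf_cst m (-1)) fm)) => t _.
by rewrite mulN1r.
Qed.

Lemma ChalfX m f n : Chalf m f -> Chalf m (fun t => f t ^+ n).
Proof.
move=> fm; elim: n => [|n ih]; first exact: (Chalf_cst m 1).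
by apply: (eq_Chalf _ (ChalfM fm ih)) => t _; rewrite exprS.
Qed.

Lemma Chalf_sum m (I : Type) (r : seq I) (F : I -> R -> R) :
  (forall i, Chalf m (F i)) -> Chalf m (fun t => \sum_(i <- r) F i t).
Proof.
move=> Fm; elim: r => [|i r ih].
  by apply: (eq_Chalf _ (Chalf_cst m 0)) => t _; rewrite big_nil.
by apply: (eq_Chalf _ (ChalfD (Fm i) ih)) => t _; rewrite big_cons.
Qed.

Lemma cont0_powR f a : cont0 f -> (forall t, 0 <= t -> 0 < f t) ->
  cont0 (fun t => f t `^ a).
Proof.
move=> cf f0 t; apply: (@continuous_comp _ _ _ (fun t => f `|t|) (fun x => x `^ a)).
  exact: cf.
by have /(is_derive1_powR a)/der_continuous := f0 _ (normr_ge0 t).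
Qed.

Lemma der_powR f t a d : 0 < f t -> is_derive t (1 : R) f d ->
  is_derive t (1 : R) (fun s => f s `^ a) (a * f t `^ (a - 1) * d).
Proof. by move=> f0 fd; exact: (der_comp fd (is_derive1_powR a f0)). Qed.

Lemma Chalf_powR m f a : (forall t, 0 <= t -> 0 < f t) -> Chalf m f ->
  Chalf m (fun t => f t `^ a).
Proof.
move=> f0; elim: m a => [|m ih] a fm.
  by case: fm => cf _; split=> //; exact: cont0_powR.
have fm' := ChalfW fm; case: fm => cf [g fg gm].
apply: (ChalfS _ _ (ChalfM (ChalfM (Chalf_cst m a) (ih (a - 1) fm')) gm)).
  exact: cont0_powR.
by move=> t t0; apply: der_powR; [apply: f0; exact: ltW|exact: fg].
Qed.

Lemma ChalfV m f : (forall t, 0 <= t -> 0 < f t) -> Chalf m f ->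
  Chalf m (fun t => (f t)^-1).
Proof.
move=> f0 /(Chalf_powR (-1) f0); apply: eq_Chalf => t t0.
by rewrite powR_inv1 // ltW // f0.
Qed.

Lemma Chalf_prim m f : Chalf m f -> Chalf m.+1 (prim f).
Proof.
move=> fm; have cf := Chalf_cont0 fm.
by apply: (ChalfS _ _ fm); [exact: prim_cont0|move=> t; exact: prim_derp].
Qed.

(** Substituting s = r t shows that [wavg n f t] is the integral of r^(n/2) f(r t) over r in [0, 1];
    differentiation brings out one more factor r, whence [n.+2]. Instead of differentiating under
    the integral, the proof multiplies both sides by t^(n/2+2): the products vanish at 0 and have
    the same derivative. *)
Lemma wavg_der1 n f f' t : cont0 f -> cont0 f' ->
  (forall t, 0 < t -> is_derive t (1 : R) f (f' t)) -> 0 < t ->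
  is_derive t (1 : R) (wavg n f) (wavg n.+2 f' t).
Proof.
move=> cf cf' ff'.
have D (s : R) : 0 < s -> is_derive s (1 : R) (wavg n f)
    ((f s - (n%:R / 2 + 1) * wavg n f s) / s).
  move=> s0; have s0' : s != 0 by rewrite gt_eqF.
  apply: (@der_eq_pos _ (fun s => (s * wavg n f s) * s^-1)) => //.
    by move=> r r0; rewrite mulrC mulKf // gt_eqF.
  apply: (der_eq (derM (wavg_der n cf s0) (derV s0' (der_id s)))).
  by field.
move=> t0; apply: (der_eq (D t t0)).
pose G s := hpow n.+2 s * (f s + - ((n%:R / 2 + 1) * wavg n f s)).
have t0' : t != 0 by rewrite gt_eqF.
have h0 : hpow n.+2 t != 0 by rewrite gt_eqF // hpow_gt0.
suff : G t = prim (fun s => hpow n.+2 s * f' s) t.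
  by rewrite -wavgE // /G => /(mulfI h0) ->; rewrite mulrC mulKf.
have cc : cont0 (fun s => hpow n.+2 s * f' s).
  by apply: cont0M => //; exact: hpow_cont0.
apply: (@eq_der _ _ _ (fun s => hpow n.+2 s * f' s) 0 t) => //.
- apply: cont0M; first exact: hpow_cont0.
  apply: cont0D => //; apply: cont0N; apply: cont0M; first exact: cont0_cst.
  exact: wavg_cont0.
- exact: prim_cont0.
- exact: ltW.
- move=> s /andP[s0 _].
  apply: (der_eq (derM (hpow_der n.+2 s0) (derD (ff' s s0)
    (derN (derM (der_cst s (n%:R / 2 + 1)) (D s s0)))))).
  have e : n.+2%:R = n%:R + 2 :> R by rewrite -addn2 natrD.
  by rewrite e; field; rewrite gt_eqF.
- by move=> s /andP[s0 _]; exact: prim_derp.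
- by rewrite prim0 /G hpow0 // mul0r.
Qed.

Lemma Chalf_wavg m n f : Chalf m f -> Chalf m (wavg n f).
Proof.
elim: m n f => [|m ih] n f [cf fm]; first by split=> //; exact: wavg_cont0.
case: fm => f' ff' f'm; apply: (ChalfS _ _ (ih n.+2 _ f'm)).
  exact: wavg_cont0.
by move=> t t0; apply: wavg_der1 => //; exact: Chalf_cont0 f'm.
Qed.

End Chalf.

(** * Volterra operators *)

Section Volterra.
Context {R : realType}.
Implicit Types (f g : R -> R) (N : (R -> R) -> R -> R) (t T : R).

(* Bounded, causal and Lipschitz on every [0, T], the Lipschitz condition being
   tested against the weights M t^j of the Picard iteration. *)
Definition volterra N : Prop :=
  (forall f, cont0 f -> cont0 (N f)) /\
  forall T, 0 < T -> exists BL : R * R,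
    [/\ 0 <= BL.1, 0 <= BL.2,
        forall f t, cont0 f -> 0 <= t <= T -> `|N f t| <= BL.1
      & forall f g M j, cont0 f -> cont0 g -> 0 <= M ->
        (forall t, 0 <= t <= T -> `|f t - g t| <= M * t ^+ j) ->
        forall t, 0 <= t <= T -> `|N f t - N g t| <= BL.2 * (M * t ^+ j)].

Lemma volterra_fun h : cont0 h -> volterra (fun=> h).
Proof.
move=> ch; split=> // T _; have [B B0 BP] := cont0_bounded T ch.
exists (B, 0); split=> //= [f t _|f g M j _ _ _ _ t _]; first exact: BP.
by rewrite subrr normr0 mul0r.
Qed.

Lemma volterraD N1 N2 : volterra N1 -> volterra N2 ->
  volterra (fun f t => N1 f t + N2 f t).
Proof.
move=> [c1 H1] [c2 H2]; split=> [f cf|T T0].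
  by apply: cont0D; [exact: c1|exact: c2].
have [[B1 L1] /= [B10 L10 b1 l1]] := H1 T T0.
have [[B2 L2] /= [B20 L20 b2 l2]] := H2 T T0.
exists (B1 + B2, L1 + L2); split=> /= [||f t cf tT|f g M j cf cg M0 fg t tT]; do ?exact: addr_ge0.
  by rewrite (le_trans (ler_normD _ _)) // lerD ?b1 ?b2.
rewrite opprD addrACA (le_trans (ler_normD _ _)) // mulrDl.
by rewrite lerD ?(l1 _ _ _ _ cf cg M0 fg) ?(l2 _ _ _ _ cf cg M0 fg).
Qed.

Lemma volterraM N1 N2 : volterra N1 -> volterra N2 ->
  volterra (fun f t => N1 f t * N2 f t).
Proof.
move=> [c1 H1] [c2 H2]; split=> [f cf|T T0].
  by apply: cont0M; [exact: c1|exact: c2].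
have [[B1 L1] /= [B10 L10 b1 l1]] := H1 T T0.
have [[B2 L2] /= [B20 L20 b2 l2]] := H2 T T0.
exists (B1 * B2, B1 * L2 + L1 * B2); split=> /= [||f t cf tT|f g M j cf cg M0 fg t tT]; do ?by rewrite ?addr_ge0 ?mulr_ge0.
  by rewrite normrM ler_pM ?b1 ?b2.
have -> : N1 f t * N2 f t - N1 g t * N2 g t =
  N1 f t * (N2 f t - N2 g t) + (N1 f t - N1 g t) * N2 g t by ring.
rewrite (le_trans (ler_normD _ _)) // !normrM mulrDl lerD //.
  by rewrite -mulrA ler_pM ?b1 ?(l2 _ _ _ _ cf cg M0 fg).
by rewrite mulrAC ler_pM ?b2 ?(l1 _ _ _ _ cf cg M0 fg).
Qed.

Lemma volterraX N n : volterra N -> volterra (fun f t => N f t ^+ n).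
Proof.
move=> HN; elim: n => [|n ih].
  rewrite (_ : (fun f t => _) = fun=> fun=> 1); last by apply/funext=> f; apply/funext.
  by apply: volterra_fun; exact: cont0_cst.
rewrite (_ : (fun f t => _) = fun f t => N f t * N f t ^+ n); first exact: volterraM.
by apply/funext=> f; apply/funext=> t; rewrite exprS.
Qed.

Lemma volterra_sum (I : Type) (r : seq I) (N : I -> (R -> R) -> R -> R) :
  (forall i, volterra (N i)) -> volterra (fun f t => \sum_(i <- r) N i f t).
Proof.
move=> HN; elim: r => [|i r ih].
  rewrite (_ : (fun f t => _) = fun=> fun=> 0).
    by apply: volterra_fun; exact: cont0_cst.
  by apply/funext=> f; apply/funext => t; rewrite big_nil.
rewrite (_ : (fun f t => _) = fun f t => N i f t + \sum_(j <- r) N j f t).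
  exact: volterraD.
by apply/funext=> f; apply/funext=> t; rewrite big_cons.
Qed.

(** Minima, inverses and roots act pointwise on the values of [N], so for them it is enough to be
    bounded and Lipschitz in these values; causality and the weights are inherited. *)
Lemma volterra_lip N N' : volterra N ->
  (forall f, cont0 f -> cont0 (N' f)) ->
  (forall T, 0 < T -> exists2 B, 0 <= B & forall f t, cont0 f -> 0 <= t <= T -> `|N' f t| <= B) ->
  (forall T, 0 < T -> exists2 L, 0 <= L & forall f g t, cont0 f -> cont0 g ->
     0 <= t <= T -> `|N' f t - N' g t| <= L * `|N f t - N g t|) ->
  volterra N'.
Proof.
move=> [c H] c' B' lip; split=> // T T0.
have [[B1 L1] /= [B10 L10 b1 l1]] := H T T0.
have [B B0 BP] := B' T T0; have [L L0 LP] := lip T T0.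
exists (B, L * L1); split=> //=; first by rewrite mulr_ge0.
move=> f g M j cf cg M0 fg t tT; apply: (le_trans (LP f g t cf cg tT)).
by rewrite -mulrA ler_wpM2l // (l1 _ _ _ _ cf cg M0 fg).
Qed.

Lemma volterra_prim N : volterra N -> volterra (fun f => prim (N f)).
Proof.
move=> [c H]; split=> [f cf|T T0]; first exact/prim_cont0/c.
have [[B1 L1] /= [B10 L10 b1 l1]] := H T T0.
have der f (t : R) : cont0 f -> 0 < t -> is_derive t (1 : R) (prim (N f)) (N f t).
  by move=> cf; apply: prim_derp; exact: c.
have key f g (h dh : R -> R) (t : R) : cont0 f -> cont0 g -> cont0 h -> 0 <= h 0 ->
    (forall t : R, 0 < t -> is_derive t (1 : R) h (dh t)) ->
    (forall t, 0 < t < T -> N f t <= N g t + dh t) -> 0 <= t <= T ->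
    prim (N f) t <= prim (N g) t + h t.
  move=> cf cg ch h0 Dh le /andP[t0 tT].
  apply: (@le_der _ _ (fun t => prim (N g) t + h t) (N f) (fun t => N g t + dh t) 0 t) => //.
  - exact/prim_cont0/c.
  - by apply: cont0D => //; exact/prim_cont0/c.
  - by move=> s /andP[s0 _]; exact: der.
  - by move=> s /andP[s0 _]; apply: derD; [exact: der|exact: Dh].
  - by move=> s /andP[s0 st]; apply: le; rewrite s0 (lt_le_trans st).
  - by rewrite !prim0 add0r.
exists (B1 * T, L1 * T); split=> /=; do ?by rewrite mulr_ge0 // ltW.
  move=> f t cf tT.
  have cn : cont0 (fun t => B1 * t) by apply: cont0M; [exact: cont0_cst|exact: cont0_id].
  have cB : cont0 (fun t => prim (N f) t) by exact/prim_cont0/c.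
  have Dn (s : R) : 0 < s -> is_derive s (1 : R) (fun t => B1 * t) B1.
    by move=> _; apply: (der_eq (derM (der_cst s B1) (der_id s))); ring.
  have /andP[t0 tT'] := tT.
  apply: (@le_trans _ _ (B1 * t)); last by rewrite ler_wpM2l.
  rewrite ler_norml; apply/andP; split.
    apply: (@le_der _ (fun t => - (B1 * t)) _ (fun=> - B1) (N f) 0 t) => //.
    - exact: cont0N.
    - by move=> s /andP[s0 _]; apply: derN; exact: Dn.
    - by move=> s /andP[s0 _]; exact: der.
    - move=> s /andP[s0 st]; have := b1 f s cf; rewrite (ltW s0) (ltW (lt_le_trans st tT')).
      by move=> /(_ isT); rewrite ler_norml => /andP[].
    - by rewrite prim0 mulr0 oppr0.
  apply: (@le_der _ _ (fun t => (B1 * t)) (N f) (fun=> B1) 0 t) => //.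
  - by move=> s /andP[s0 _]; exact: der.
  - by move=> s /andP[s0 _]; exact: Dn.
  - move=> s /andP[s0 st]; have := b1 f s cf; rewrite (ltW s0) (ltW (lt_le_trans st tT')).
    by move=> /(_ isT); rewrite ler_norml => /andP[].
  - by rewrite prim0 mulr0.
move=> f g M j cf cg M0 fg t tT.
pose h (t : R) := L1 * M * t ^+ j.+1 / j.+1%:R.
have ch : cont0 h.
  apply: cont0M; last exact: cont0_cst.
  by apply: cont0M; [exact: cont0_cst|apply: cont0X; exact: cont0_id].
have Dh (s : R) : 0 < s -> is_derive s (1 : R) h (L1 * (M * s ^+ j)).
  move=> s0; apply: (der_eq (derM (derM (der_cst s (L1 * M)) (derX j.+1 (der_id s)))
    (der_cst s (j.+1%:R^-1)))).
  by rewrite /=; field; rewrite addrC natr1 pnatr_eq0.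
have h0 : 0 <= h 0 by rewrite /h expr0n mulr0 mul0r.
(* Of the gain t / (j + 1) only the bound t / (j + 1) <= T is kept: integration just has to stay in
   the class. *)
apply: (@le_trans _ _ (h t)); last first.
  have /andP[t0 tT'] := tT.
  have -> : h t = L1 * (M * t ^+ j) * (t / j.+1%:R) by rewrite /h exprS; ring.
  have -> : L1 * T * (M * t ^+ j) = L1 * (M * t ^+ j) * T by ring.
  rewrite ler_wpM2l ?mulr_ge0 ?exprn_ge0 //.
  by rewrite ler_pdivrMr ?ltr0n // (le_trans tT') // ler_peMr ?(ltW T0) // ler1n.
have fgN s : 0 < s < T -> `|N f s - N g s| <= L1 * (M * s ^+ j).
  by move=> /andP[s0 sT]; apply: l1 => //; rewrite (ltW s0) (ltW sT).
rewrite ler_norml; apply/andP; split.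
  suff : prim (N g) t <= prim (N f) t + h t by lra.
  by apply: (key _ _ _ _ _ cg cf ch h0 Dh _ tT) => s /fgN; rewrite ler_norml; lra.
suff : prim (N f) t <= prim (N g) t + h t by lra.
by apply: (key _ _ _ _ _ cf cg ch h0 Dh _ tT) => s /fgN; rewrite ler_norml; lra.
Qed.

Lemma cont0_min f g : cont0 f -> cont0 g -> cont0 (fun t => Num.min (f t) (g t)).
Proof.
move=> cf cg; rewrite (_ : (fun t => _) = fun t => 2^-1 * (f t + g t + - `|f t + - g t|)).
  apply: cont0M; first exact: cont0_cst.
  apply: cont0D; first exact: cont0D.
  apply: cont0N; apply: (@cont0_comp _ Num.norm (fun t => f t + - g t)).
    exact: norm_continuous.
  by apply: cont0D => //; exact: cont0N.
by apply/funext => t; rewrite minr_absE mulrC.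
Qed.

Lemma cont0_max f g : cont0 f -> cont0 g -> cont0 (fun t => Num.max (f t) (g t)).
Proof.
move=> cf cg; rewrite (_ : (fun t => _) = fun t => - Num.min (- f t) (- g t)).
  by apply: cont0N; apply: cont0_min; exact: cont0N.
by apply/funext => t; rewrite oppr_min !opprK.
Qed.

Lemma dist_min (a b h : R) : `|Num.min a h - Num.min b h| <= `|a - b|.
Proof.
rewrite !minr_absE -mulrBl normrM [X in _ * X]ger0_norm ?invr_ge0 //.
rewrite ler_pdivrMr //.
rewrite (_ : _ - _ = (a - b) - (`|a - h| - `|b - h|)); last by ring.
apply: (le_trans (ler_normB _ _)).
have := ler_dist_dist (a - h) (b - h); rewrite opprB addrA subrK => H.
by rewrite mulrDr mulr1 lerD2l.
Qed.

Lemma dist_max (a b h : R) : `|Num.max a h - Num.max b h| <= `|a - b|.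
Proof.
have -> : Num.max a h = - Num.min (- a) (- h) by rewrite oppr_min !opprK.
have -> : Num.max b h = - Num.min (- b) (- h) by rewrite oppr_min !opprK.
rewrite -opprD normrN; apply: le_trans (dist_min _ _ _) _.
by rewrite -opprD normrN.
Qed.

Lemma volterra_min N h : volterra N -> cont0 h ->
  volterra (fun f t => Num.min (N f t) (h t)).
Proof.
move=> HN ch; apply: (volterra_lip HN) => [f cf|T T0|T T0].
- by apply: cont0_min => //; exact: HN.1.
- have [[B L] /= [B0 L0 b l]] := HN.2 T T0.
  have [C C0 CP] := cont0_bounded T ch.
  exists (B + C); first exact: addr_ge0.
  move=> f t cf tT; have := b f t cf tT; have := CP t tT.
  by rewrite minEle; case: ifP => _ h1 h2; lra.
- by exists 1 => // f g t _ _ _; rewrite mul1r; exact: dist_min.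
Qed.

(** The identity operator is not bounded, but its truncation is; the nonlinearity of the profile
    equation is built on this operator. *)
Lemma volterra_clamp lo hi : cont0 lo -> cont0 hi ->
  (forall t, 0 <= t -> 0 <= lo t <= hi t) ->
  volterra (fun f t => Num.min (Num.max (f t) (lo t)) (hi t)).
Proof.
move=> clo chi lohi; split=> [f cf|T T0].
  by apply: cont0_min => //; exact: cont0_max.
have [B B0 BP] := cont0_bounded T chi.
exists (B, 1); split=> //= [f t cf tT|f g M j _ _ _ fg t tT].
  have /andP[t0 _] := tT; have /andP[l0 lh] := lohi t t0.
  have m0 : 0 <= Num.min (Num.max (f t) (lo t)) (hi t).
    by rewrite le_min le_max l0 orbT (le_trans l0).
  rewrite ger0_norm //; apply: le_trans (BP t tT); apply: le_trans (ler_norm _).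
  by rewrite ge_min lexx orbT.
rewrite mul1r; apply: le_trans (dist_min _ _ _) _.
exact: le_trans (dist_max _ _ _) (fg t tT).
Qed.

Lemma cont0_low f T : cont0 f -> 0 <= T -> (forall t, 0 <= t -> 0 < f t) ->
  exists2 e, 0 < e & forall t, 0 <= t <= T -> e <= f t.
Proof.
move=> cf T0 f0; have [x x0T xP] := EVT_min T0 (cont0_within cf (lexx 0) (b := T)).
exists (f x); first by apply: f0; move: x0T; rewrite in_itv => /andP[].
by move=> t tT; apply: xP; rewrite in_itv.
Qed.

Lemma volterraV N lo : volterra N -> cont0 lo -> (forall t, 0 <= t -> 0 < lo t) ->
  (forall f t, cont0 f -> 0 <= t -> lo t <= N f t) ->
  volterra (fun f t => (N f t)^-1).
Proof.
move=> HN clo lo0 loN.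
have N0 f t : cont0 f -> 0 <= t -> 0 < N f t.
  by move=> cf t0; exact: lt_le_trans (lo0 t t0) (loN f t cf t0).
apply: (volterra_lip HN) => [f cf|T T0|T T0].
- apply: cont0V; first exact: HN.1.
  by move=> t t0; rewrite gt_eqF // N0.
- have [e e0 eP] := cont0_low clo (ltW T0) lo0.
  exists e^-1; first by rewrite invr_ge0 ltW.
  move=> f t cf tT; have /andP[t0 _] := tT; have n0 := N0 f t cf t0.
  rewrite gtr0_norm ?invr_gt0 // lef_pV2 ?posrE //.
  exact: le_trans (eP t tT) (loN f t cf t0).
- have [e e0 eP] := cont0_low clo (ltW T0) lo0.
  exists (e^-1 * e^-1); first by rewrite mulr_ge0 // invr_ge0 ltW.
  move=> f g t cf cg tT; have /andP[t0 _] := tT.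
  have nf := N0 f t cf t0; have ng := N0 g t cg t0.
  have -> : (N f t)^-1 - (N g t)^-1 = ((N f t)^-1 * (N g t)^-1) * (N g t - N f t).
    by field; rewrite !gt_eqF.
  rewrite normrM distrC ler_wpM2r // gtr0_norm ?mulr_gt0 ?invr_gt0 //.
  by rewrite ler_pM ?invr_ge0 ?(ltW nf) ?(ltW ng) // lef_pV2 ?posrE //; exact: le_trans (eP t tT) (loN _ t _ t0).
Qed.

(** The root is Lipschitz away from 0: in x^(p+1) - z^(p+1) = (x - z) * sum, the sum is at least
    x^p, hence at least e^p when e > 0 bounds [lo] from below. *)
Lemma volterra_root N lo p : volterra N -> cont0 lo -> (forall t, 0 <= t -> 0 < lo t) ->
  (forall f t, cont0 f -> 0 <= t -> lo t ^+ p.+1 <= N f t) ->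
  volterra (fun f t => N f t `^ (p.+1%:R^-1)).
Proof.
move=> HN clo lo0 loN.
have N0 f t : cont0 f -> 0 <= t -> 0 < N f t.
  by move=> cf t0; apply: lt_le_trans (loN f t cf t0); rewrite exprn_gt0 // lo0.
have r0 : 0 <= p.+1%:R^-1 :> R by rewrite invr_ge0.
have rK f t : cont0 f -> 0 <= t -> (N f t `^ (p.+1%:R^-1)) ^+ p.+1 = N f t.
  move=> cf t0; rewrite -powR_mulrn ?powR_ge0 // -powRrM mulVf ?pnatr_eq0 //.
  by rewrite powRr1 // ltW // N0.
have rlo f t : cont0 f -> 0 <= t -> lo t <= N f t `^ (p.+1%:R^-1).
  move=> cf t0; rewrite -(ler_pXn2r (ltn0Sn p)) ?nnegrE ?powR_ge0 ?(ltW (lo0 t t0)) //.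
  by rewrite rK // loN.
apply: (volterra_lip HN) => [f cf|T T0|T T0].
- by apply: cont0_powR; [exact: HN.1|move=> t; exact: N0].
- have [[B L] /= [B0 L0 b l]] := HN.2 T T0.
  exists (B `^ (p.+1%:R^-1)); first exact: powR_ge0.
  move=> f t cf tT; have /andP[t0 _] := tT; have n0 := N0 f t cf t0.
  rewrite ger0_norm ?powR_ge0 // ge0_ler_powR ?nnegrE ?(ltW n0) //.
  exact: le_trans (ler_norm _) (b f t cf tT).
- have [e e0 eP] := cont0_low clo (ltW T0) lo0.
  exists (e ^+ p)^-1; first by rewrite invr_ge0 exprn_ge0 // ltW.
  move=> f g t cf cg tT; have /andP[t0 _] := tT.
  rewrite -[in leRHS](rK f) // -[in leRHS](rK g) // subrXX normrM mulrCA.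
  have ex : e <= N f t `^ (p.+1%:R^-1) := le_trans (eP t tT) (rlo f t cf t0).
  have x0 := powR_ge0 (N f t) (p.+1%:R^-1).
  have z0 := powR_ge0 (N g t) (p.+1%:R^-1).
  move: (N f t `^ _) (N g t `^ _) ex x0 z0 => x z ex x0 z0.
  rewrite ler_peMr // mulrC ler_pdivlMr ?exprn_gt0 // mul1r.
  rewrite ger0_norm; last by apply: sumr_ge0 => i _; rewrite mulr_ge0 // exprn_ge0.
  rewrite big_ord_recl /= subn0 expr0 mulr1.
  apply: (@le_trans _ _ (x ^+ p)); first by rewrite lerXn2r ?nnegrE // ltW.
  by rewrite lerDl sumr_ge0 // => i _; rewrite mulr_ge0 // exprn_ge0.
Qed.

End Volterra.

(** * Picard iteration for the singular equation *)

Section Picard.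
Context {R : realType} (n : nat) (N : (R -> R) -> R -> R) (y0 : R).
Hypothesis HN : volterra N.

Let Phi (f : R -> R) (t : R) : R := y0 + t * wavg n (N f) t.

Let iter i : R -> R := iteri i (fun=> Phi) (fun=> y0).

Let cPhi f : cont0 f -> cont0 (Phi f).
Proof.
move=> cf; apply: cont0D; first exact: cont0_cst.
by apply: cont0M; [exact: cont0_id|apply: wavg_cont0; exact: HN.1].
Qed.

Let citer i : cont0 (iter i).
Proof. by elim: i => [|i ih]; [exact: cont0_cst|exact: cPhi]. Qed.

Let step T : 0 < T -> exists BL : R * R, [/\ 0 <= BL.1, 0 <= BL.2,
   (forall t, 0 <= t <= T -> `|iter 1 t - iter 0 t| <= BL.1)
   & forall f g M j, cont0 f -> cont0 g -> 0 <= M ->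
     (forall t, 0 <= t <= T -> `|f t - g t| <= M * t ^+ j) ->
     forall t, 0 <= t <= T -> `|Phi f t - Phi g t| <= BL.2 * M * t ^+ j.+1 / j.+1%:R].
Proof.
move=> T0; have [[B L] /= [B0 L0 b l]] := HN.2 T T0.
exists (B * T, L); split=> //=; first by rewrite mulr_ge0 // ltW.
- move=> t /andP[t0 tT]; have -> : iter 1 t - iter 0 t = t * wavg n (N (fun=> y0)) t.
    by rewrite /iter /= /Phi addrC addKr.
  have := @wavg_close _ n (N (fun=> y0)) (fun=> 0) T B 0 t.
  have cy : cont0 (N (fun=> y0)) by apply: HN.1; exact: cont0_cst.
  move=> /(_ cy (@cont0_cst R 0)).
  have -> : t * wavg n (fun=> 0) t = 0.
    have [->|t0'] := eqVneq t 0; first by rewrite mul0r.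
    by rewrite wavg_cst ?mul0r ?mulr0 // lt_neqAle eq_sym t0'.
  rewrite subr0 expr1 divr1 => H; apply: (@le_trans _ _ (B * t)); last by rewrite ler_wpM2l.
  apply: H; last by rewrite t0.
  move=> s /andP[s0 sT]; rewrite expr0 mulr1 subr0; apply: b; first exact: cont0_cst.
  by rewrite !ltW.
move=> f g M j cf cg M0 fg t tT.
rewrite /Phi opprD addrACA subrr add0r.
apply: (@wavg_close _ n (N f) (N g) T (L * M) j t _ _ _ tT); [exact: HN.1|exact: HN.1|].
by move=> s /andP[s0 sT]; rewrite -mulrA; apply: l => //; rewrite !ltW.
Qed.

(** The i-th increment is at most B (L t)^i / i!, so the error after i steps is B times a tail of
    the exponential series of L T. This holds for every T: no short interval and no gluing of
    solutions. *)
Let rate T : 0 < T -> exists2 e : nat -> R, e @ \oo --> 0 &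
  forall i m t, (i <= m)%N -> 0 <= t <= T -> `|iter m t - iter i t| <= e i.
Proof.
move=> T0; have [[B L] /= [B0 L0 b l]] := step T0.
have d i t : 0 <= t <= T -> `|iter i.+1 t - iter i t| <= B * L ^+ i / i`!%:R * t ^+ i.
  elim: i t => [|i ih] t tT; first by rewrite !expr0 fact0 divr1 !mulr1 b.
  have M0 : 0 <= B * L ^+ i / i`!%:R by rewrite divr_ge0 ?mulr_ge0 ?exprn_ge0.
  have H := l _ _ _ i (@citer i.+1) (@citer i) M0 ih t tT.
  apply: (le_trans (H : `|iter i.+2 t - iter i.+1 t| <= _)).
  rewrite le_eqVlt; apply/orP; left; apply/eqP.
  rewrite factS natrM [L ^+ i.+1]exprS invfM.
  ring.
pose S := series (exp_coeff (L * T)).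
have S_nd : nondecreasing_seq S.
  apply: nondecreasing_series => i _ _.
  by rewrite /exp_coeff /= divr_ge0 ?exprn_ge0 ?mulr_ge0 // ltW.
have cS : cvgn S by exact: is_cvg_series_exp_coeff.
exists (fun i => B * (limn S - S i)).
  rewrite -[X in _ --> X](mulr0 B); apply: cvgM; first exact: cvg_cst.
  by rewrite -[X in _ --> X](subrr (limn S)); apply: cvgB => //; exact: cvg_cst.
move=> i m t im tT.
have SmS : S m <= limn S by exact: nondecreasing_cvgn_le.
apply: (@le_trans _ _ (B * (S m - S i))); last by rewrite ler_wpM2l // lerB.
elim: m im {SmS} => [|m ih].
  by rewrite leqn0 => /eqP ->; rewrite !subrr normr0 mulr0.
rewrite leq_eqVlt => /orP[/eqP <-|]; first by rewrite !subrr normr0 mulr0.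
rewrite ltnS => /ih {}ih.
have -> : iter m.+1 t - iter i t = (iter m.+1 t - iter m t) + (iter m t - iter i t) by ring.
apply: (le_trans (ler_normD _ _)).
have -> : B * (S m.+1 - S i) = B * exp_coeff (L * T) m + B * (S m - S i).
  by rewrite {1}/S seriesSr -/S; ring.
apply: lerD ih; apply: (le_trans (d m t tT)).
rewrite /exp_coeff /= exprMn -!mulrA ler_wpM2l // ler_wpM2l ?exprn_ge0 //.
rewrite mulrC ler_wpM2r ?invr_ge0 //.
by case/andP: tT => t0 tT; rewrite lerXn2r // nnegrE // ltW.
Qed.

Theorem singular_picard : exists2 f, cont0 f &
  forall t, 0 <= t -> f t = y0 + t * wavg n (N f) t.
Proof.
have cvg t : 0 <= t -> cvgn (fun i => iter i t).
  move=> t0; have T0 : 0 < t + 1 by rewrite ltr_wpDl.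
  have [e e0 eP] := rate T0; apply/cauchy_cvgP/cauchyP => eps eps0.
  have : \forall i \near \oo, e i < eps.
    by move/cvgrPdist_lt : e0 => /(_ _ eps0); apply: filterS => i; rewrite sub0r normrN; exact/le_lt_trans/ler_norm.
  move=> [i _ iP]; exists (iter i t).
  exists i => // m /= im; rewrite -ball_normE /= distrC.
  apply: (le_lt_trans (eP i m t im _)); first by rewrite t0 lerDl ler01.
  exact: (iP i (leqnn i)).
pose f t : R := limn (fun i => iter i t).
have flim T : 0 < T -> exists2 e : nat -> R, e @ \oo --> 0 &
    forall i t, 0 <= t <= T -> `|f t - iter i t| <= e i.
  move=> T0; have [e e0 eP] := rate T0; exists e => // i t tT.
  have /andP[t0 _] := tT.
  have H : (fun m => `|iter m t - iter i t|) @ \oo --> `|f t - iter i t|.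
    by apply: cvg_norm; apply: cvgB; [exact: cvg|exact: cvg_cst].
  apply: (cvgr_to_le H).
  by exists i => // m /= im; exact: eP.
have cf : cont0 f.
  suff H (x : R) : {for x, continuous (fun t => f `|t|)} by exact: H.
  have T0 : 0 < `|x| + 1 by rewrite ltr_wpDl.
  have [e e0 eP] := flim _ T0; apply/cvgrPdist_lt => eps eps0.
  have e30 : 0 < eps / 3 by rewrite divr_gt0.
  have : \forall i \near \oo, e i < eps / 3.
    by move/cvgrPdist_lt : e0 => /(_ _ e30); apply: filterS => i; rewrite sub0r normrN; exact/le_lt_trans/ler_norm.
  move=> [i _ /(_ i (leqnn i)) iP].
  have /cvgrPdist_lt/(_ _ e30) := @citer i x.
  have /cvgrPdist_lt/(_ _ ltr01) X := @cvg_id _ (nbhs x).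
  move=> C; near=> y.
  have h1 : `|f `|x| - iter i `|x| | <= e i by apply: eP; rewrite normr_ge0 lerDl ler01.
  have h2 : `|f `|y| - iter i `|y| | <= e i.
    apply: eP; rewrite normr_ge0 /=.
    have xy : `|x - y| < 1 by near: y; exact: X.
    have := ler_normD x (y - x).
    by rewrite addrCA subrr addr0 [X in _ + X]distrC => /le_trans; apply; rewrite lerD2l ltW.
  have h3 : `|iter i `|x| - iter i `|y| | < eps / 3 by near: y; exact: C.
  move: h1 h2 h3; rewrite !ler_norml !ltr_norml => /andP[a1 a2] /andP[b1 b2] /andP[c1 c2].
  by apply/andP; split; lra.
exists f => // t t0.
have T0 : 0 < t + 1 by rewrite ltr_wpDl.
have tT : 0 <= t <= t + 1 by rewrite t0 lerDl ler01.
have [e e0 eP] := flim _ T0.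
have [[B L] /= [B0 L0 _ l]] := step T0.
suff : `|f t - Phi f t| <= 0 by rewrite normr_le0 subr_eq0 => /eqP.
(* Passing through [iter i.+1] bounds the residual of the fixed point equation by this null
   sequence. *)
have H : (fun i => e i.+1 + L * e i * (t + 1)) @ \oo --> 0.
  rewrite -[X in _ --> X](addr0 0); apply: cvgD.
    by rewrite (cvg_shiftS e).
  have -> : 0 = L * 0 * (t + 1) by rewrite mulr0 mul0r.
  by apply: cvgM; [apply: cvgM => //; exact: cvg_cst|exact: cvg_cst].
apply: (cvgr_to_ge H); exists 0%N => // i _ /=.
have ei0 : 0 <= e i by exact: le_trans (normr_ge0 _) (eP i t tT).
have -> : f t - Phi f t = (f t - iter i.+1 t) + (Phi (iter i) t - Phi f t).
  by rewrite {2}/iter /= -/(iter i); ring.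
apply: (le_trans (ler_normD _ _)); apply: lerD; first exact: eP.
rewrite distrC; have := l f (iter i) (e i) 0 cf (@citer i) ei0.
move=> /(_ _ t tT); rewrite expr1 divr1 => H'; apply: le_trans (H' _) _.
  by move=> s sT; rewrite expr0 mulr1; exact: eP.
by rewrite ler_wpM2l ?mulr_ge0 // lerDl.
Unshelve. all: by end_near. Qed.

End Picard.

(** * The profile equation *)

Section SignLemmas.
Context {R : realType}.

(* If f is negative somewhere, it has been nondecreasing since the last point where
   it was nonnegative, which is absurd. *)
Lemma ge0_of_der (f df : R -> R) (T : R) : cont0 f -> 0 <= f 0 ->
  (forall t, 0 < t < T -> is_derive t (1 : R) f (df t)) ->
  (forall t, 0 < t < T -> f t < 0 -> 0 <= df t) ->
  forall t : R, 0 <= t <= T -> 0 <= f t.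
Proof.
move=> cf f00 Df df0 t /andP[t0 tT]; rewrite leNgt; apply/negP => ft.
pose A := [set s : R | 0 <= s <= t /\ 0 <= f s].
have A0 : A 0 by split=> //; rewrite lexx.
have hA : has_sup A by split; [exists 0|exists t => s [/andP[]]].
have sA0 : 0 <= sup A by apply: sup_upper_bound.
have sAt : sup A <= t by apply: ge_sup; [exists 0|move=> s [/andP[]]].
have fA : 0 <= f (sup A).
  rewrite leNgt; apply/negP => fA.
  have nf : 0 < - f (sup A) by rewrite oppr_gt0.
  have [d d0 dP] := cont0_pos_near (cont0N cf) sA0 nf.
  have [s [/andP[s0 st] fs] sA] := sup_adherent d0 hA.
  have : s <= sup A by apply: sup_upper_bound => //; split=> //; rewrite s0.
  move=> sA'; have : 0 < - f s by apply: dP => //; rewrite distrC ger0_norm ?subr_ge0 //; lra.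
  by rewrite oppr_gt0 ltNge fs.
have above s : sup A < s -> s <= t -> f s < 0.
  move=> As st; rewrite ltNge; apply/negP => fs.
  suff : s <= sup A by rewrite leNgt As.
  by apply: sup_upper_bound => //; split=> //; rewrite st andbT (le_trans sA0) // ltW.
suff : f (sup A) <= f t by move=> /(le_trans fA); rewrite leNgt ft.
apply: (@le_der _ (fun=> f (sup A)) f (fun=> 0) df (sup A) t) => //.
- exact: cont0_cst.
- move=> s /andP[As st]; apply: Df.
  by rewrite (le_lt_trans sA0 As) (lt_le_trans st).
- move=> s /andP[As st]; apply: df0; last by apply: above => //; exact: ltW.
  by rewrite (le_lt_trans sA0 As) (lt_le_trans st).
Qed.

Lemma der_expM (L t : R) : is_derive t (1 : R) (fun s => expR (L * s)) (expR (L * t) * L).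
Proof.
apply: (der_eq (@der_comp _ expR (fun s => L * s) t _ _
  (derM (der_cst t L) (der_id t)) (is_derive_expR (L * t)))).
by rewrite mul0r add0r mulr1.
Qed.

Lemma cont0_expM (L : R) : cont0 (fun t : R => expR (L * t)).
Proof.
by apply: continuous_cont0 => t; exact: (@der_continuous _ _ _ _ (der_expM L t)).
Qed.

(** The factor exp(L t) turns the differential inequality into monotonicity. *)
Lemma gronwall_ge (f df : R -> R) (L a T : R) : cont0 f -> 0 <= a -> a <= T ->
  (forall t, a < t < T -> is_derive t (1 : R) f (df t)) ->
  (forall t, a < t < T -> - L * f t <= df t) ->
  f a * expR (- L * (T - a)) <= f T.
Proof.
move=> cf a0 aT Df dfL.
have : f a * expR (L * a) <= f T * expR (L * T).
  apply: (@le_der _ (fun=> f a * expR (L * a)) (fun t => f t * expR (L * t)) (fun=> 0)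
    (fun t => df t * expR (L * t) + f t * (expR (L * t) * L)) a T) => //.
  - exact: cont0_cst.
  - by apply: cont0M => //; exact: cont0_expM.
  - by move=> t tI; apply: derM; [exact: Df|exact: der_expM].
  - move=> t tI; have := dfL t tI; have := expR_gt0 (L * t).
    move: (expR _) => e e0 h.
    have -> : df t * e + f t * (e * L) = (df t - (- L * f t)) * e by ring.
    by rewrite mulr_ge0 ?subr_ge0 // ltW.
move=> h; rewrite (_ : - L * (T - a) = L * a - L * T); last by ring.
by rewrite expRB mulrA ler_pdivrMr ?expR_gt0.
Qed.

End SignLemmas.

Section Profile.
Context {R : realType}.
Variables (n p : nat) (theta c mu : R) (V W Z : R -> R).
Implicit Types t s T : R.

(* V is the profile of u^(-2k/(n+2k)) in the variable t = |x|^2, W and Z its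
   first two derivatives, and k = p.+1. *)
Definition prof_P t := t * W t / V t.
Definition prof_S t := V t - t * W t.
Definition prof_lam t := 2 * W t * prof_S t.
Definition prof_F t := c - 4 * theta * prof_P t.
Definition prof_D t := prof_lam t ^+ p.+1 - (mu * prof_F t) ^+ p.+1.
Definition prof_G t := hpow n t * (prof_D t * (V t)^-1 ^+ n).
Definition prof_H t := prof_lam t + 2 * t * V t * Z t.

Definition profile_ode t :=
  prof_lam t ^+ p * (prof_lam t + p.+1%:R / n%:R * (4 * t * V t * Z t)) = (mu * prof_F t) ^+ p.+1.

Hypothesis n_gt0 : (0 < n)%N.
Hypotheses (cV : cont0 V) (cW : cont0 W).
Hypothesis V_gt0 : forall t, 0 <= t -> 0 < V t.

Let nr0 : n%:R != 0 :> R. Proof. by rewrite pnatr_eq0 -lt0n. Qed.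
Let pr0 : p.+1%:R != 0 :> R. Proof. by rewrite pnatr_eq0. Qed.
Let Vn0 t : 0 <= t -> V t != 0. Proof. by move=> /V_gt0; rewrite lt0r => /andP[]. Qed.

Lemma cont0_prof_P : cont0 prof_P.
Proof. by apply: cont0M; [apply: cont0M => //; exact: cont0_id|exact: cont0V]. Qed.

Lemma cont0_prof_S : cont0 prof_S.
Proof. by apply: cont0D => //; apply: cont0N; apply: cont0M => //; exact: cont0_id. Qed.

Lemma cont0_prof_lam : cont0 prof_lam.
Proof.
apply: cont0M; last exact: cont0_prof_S.
by apply: cont0M => //; exact: cont0_cst.
Qed.

Lemma cont0_prof_F : cont0 prof_F.
Proof.
apply: cont0D; first exact: cont0_cst.
by apply: cont0N; apply: cont0M; [exact: cont0_cst|exact: cont0_prof_P].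
Qed.

Lemma cont0_prof_D : cont0 prof_D.
Proof.
apply: cont0D; first by apply: cont0X; exact: cont0_prof_lam.
apply/cont0N/cont0X; apply: cont0M; [exact: cont0_cst|exact: cont0_prof_F].
Qed.

Lemma cont0_prof_G : cont0 prof_G.
Proof.
apply: cont0M; first exact: hpow_cont0.
by apply: cont0M; [exact: cont0_prof_D|apply: cont0X; exact: cont0V].
Qed.

Lemma prof_G0 : prof_G 0 = 0.
Proof. by rewrite /prof_G hpow0 // mul0r. Qed.

Lemma prof_S_P t : 0 <= t -> prof_S t = V t * (1 - prof_P t).
Proof. by move=> /Vn0 v0; rewrite /prof_S /prof_P; field. Qed.

Section At.
Variable t : R.
Hypotheses (t0 : 0 < t) (DV : is_derive t (1 : R) V (W t)) (DW : is_derive t (1 : R) W (Z t)).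

Let v0 : V t != 0. Proof. exact/Vn0/ltW. Qed.
Let tn0 : t != 0. Proof. by rewrite gt_eqF. Qed.

Lemma der_prof_P : is_derive t (1 : R) prof_P (prof_H t / 2 / V t ^+ 2).
Proof.
apply: (der_eq (derM (derM (der_id t) DW) (derV v0 DV))).
by rewrite /prof_H /prof_lam /prof_S; field.
Qed.

Lemma der_prof_S : is_derive t (1 : R) prof_S (- (t * Z t)).
Proof. by apply: (der_eq (derD DV (derN (derM (der_id t) DW)))); ring. Qed.

Lemma der_prof_lam : is_derive t (1 : R) prof_lam (2 * Z t * (V t - 2 * t * W t)).
Proof.
apply: (der_eq (derM (derM (der_cst t 2) DW) der_prof_S)).
by rewrite /prof_S; ring.
Qed.

Lemma der_prof_F : is_derive t (1 : R) prof_F (- (2 * theta / V t ^+ 2 * prof_H t)).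
Proof.
apply: (der_eq (derD (der_cst t c) (derN (derM (der_cst t (4 * theta)) der_prof_P)))).
by field.
Qed.

Hypothesis ode : profile_ode t.

Lemma prof_Z_D : 4 * t * V t * Z t * prof_lam t ^+ p = - (n%:R / p.+1%:R * prof_D t).
Proof.
have e := ode; rewrite /profile_ode in e; rewrite /prof_D -e [prof_lam t ^+ p.+1]exprS.
by field; rewrite nr0 addrC natr1 pr0.
Qed.

Lemma prof_H_D : prof_H t * prof_lam t ^+ p =
  (mu * prof_F t) ^+ p.+1 - (n%:R / (2 * p.+1%:R) - 1) * prof_D t.
Proof.
have e : prof_D t = prof_lam t ^+ p.+1 - (mu * prof_F t) ^+ p.+1 by [].
have -> : prof_H t * prof_lam t ^+ p = prof_lam t ^+ p.+1 + 4 * t * V t * Z t * prof_lam t ^+ p / 2.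
  by rewrite exprS /prof_H; field.
rewrite prof_Z_D; have -> : prof_lam t ^+ p.+1 = prof_D t + (mu * prof_F t) ^+ p.+1 by rewrite e; ring.
by field; rewrite addrC natr1 pr0.
Qed.

Lemma der_prof_G : is_derive t (1 : R) prof_G
  (hpow n t * (V t)^-1 ^+ n * (p.+1%:R * mu * (mu * prof_F t) ^+ p * (2 * theta / V t ^+ 2) * prof_H t)).
Proof.
have DD := derD (derX p.+1 der_prof_lam) (derN (derX p.+1 (derM (der_cst t mu) der_prof_F))).
apply: (der_eq (derM (hpow_der n t0) (derM DD (derX n (derV v0 DV))))).
rewrite /= -/(prof_D t).
(* By the equation, the derivative of lam^k is - n (V - 2 t W) / (2 t V) times D, while n (V - 2 t
   W) / (2 t V) is the logarithmic derivative of the weight (t/V^2)^(n/2). The two contributions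
   cancel and only the derivative of F is left. *)
have -> : p.+1%:R * prof_lam t ^+ p * (2 * Z t * (V t - 2 * t * W t)) =
   - (n%:R * prof_D t) * (V t - 2 * t * W t) / (2 * t * V t).
  have -> : - (n%:R * prof_D t) = p.+1%:R * (4 * t * V t * Z t * prof_lam t ^+ p).
    by rewrite prof_Z_D; field; rewrite addrC natr1 pr0.
  by field; rewrite v0 tn0.
have -> : n%:R * (V t)^-1 ^+ n.-1 = n%:R * (V t)^-1 ^+ n * V t.
  by case: n n_gt0 => // m _; rewrite [X in _ = _ * X * _]exprS /=; field.
by field; rewrite v0 tn0.
Qed.
End At.
End Profile.

(** * A priori bounds for positive theta *)

Section APriori.
Context {R : realType}.
Variables (n p : nat) (theta c mu b w0 t1 T : R) (V W Z : R -> R).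
Hypotheses (n2p : (2 * p.+1 <= n)%N) (theta0 : 0 < theta) (c0 : 0 < c)
  (mu0 : 0 < mu) (b0 : 0 < b) (T0 : 0 < T).
(* w0 is V'(0), and t1 is chosen so that 4 theta P <= c / 2 on [0, t1]. *)
Hypotheses (w00 : 0 < w0) (w0E : b * w0 = mu * (c / 2))
  (t1_gt0 : 0 < t1) (t1E : 4 * theta * (t1 * w0 / b) = c / 2).
Hypotheses (cV : cont0 V) (cW : cont0 W) (V_gt0 : forall t, 0 <= t -> 0 < V t).
Hypotheses (V0 : V 0 = b) (W0 : W 0 = w0).
Local Notation S := (prof_S V W).
Local Notation P := (prof_P V W).
Local Notation lam := (prof_lam V W).
Local Notation F := (prof_F theta c V W).
Local Notation D := (prof_D p theta c mu V W).
Local Notation G := (prof_G n p theta c mu V W).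
Local Notation H := (prof_H V W Z).
Hypotheses (DV : forall t : R, 0 < t < T -> is_derive t (1 : R) V (W t))
  (DW : forall t : R, 0 < t < T -> is_derive t (1 : R) W (Z t))
  (ode : forall t, 0 < t < T -> profile_ode n p theta c mu V W Z t)
  (W_gt0 : forall t, 0 < t < T -> 0 < W t)
  (S_gt0 : forall t, 0 < t < T -> 0 < S t)
  (F_gt0 : forall t, 0 < t < T -> 0 < F t).

Let n0 : (0 < n)%N. Proof. exact: leq_trans n2p. Qed.
Let pos t : 0 < t < T -> 0 < t. Proof. by case/andP. Qed.
Let lam_gt0 t : 0 < t < T -> 0 < lam t.
Proof. by move=> h; rewrite !mulr_gt0 ?W_gt0 ?S_gt0. Qed.
Let nk : 0 <= n%:R / (2 * p.+1%:R) - 1 :> R.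
Proof. by rewrite subr_ge0 ler_pdivlMr ?mulr_gt0 ?ltr0n // mul1r -natrM ler_nat. Qed.

Let Z_D t : 0 < t < T -> (Z t <= 0) = (0 <= D t).
Proof.
move=> h; have l0 := lam_gt0 h; have t0 := pos h; have v0 := V_gt0 (ltW t0).
have e := prof_Z_D n0 (ode h).
have k0 : 0 < 4 * t * V t * lam t ^+ p by rewrite !mulr_gt0 ?exprn_gt0.
rewrite -(pmulr_rle0 _ k0).
have -> : 4 * t * V t * lam t ^+ p * Z t = - (n%:R / p.+1%:R * D t) by rewrite -e; ring.
by rewrite oppr_le0 pmulr_rge0 // divr_gt0 ?ltr0n.
Qed.

(** Where G < 0 the second derivative Z is positive, so H > 0 and, as theta > 0, G' >= 0. Starting
    from G(0) = 0, G can never become negative. *)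
Let D_ge0 t : 0 < t < T -> 0 <= D t.
Proof.
move=> h; have t0 := pos h; have /andP[_ tT] := h; have v0 := V_gt0 (ltW t0).
have : 0 <= G t.
  apply: (@ge0_of_der _ G _ T); first exact: cont0_prof_G.
  - by rewrite prof_G0.
  - by move=> s hs; apply: (der_prof_G n0 V_gt0 (pos hs) (DV hs) (DW hs) (ode hs)).
  - move=> s hs Gs; have s0 := pos hs; have vs := V_gt0 (ltW s0).
    have Zs : 0 < Z s.
      rewrite ltNge Z_D // -ltNge; move: Gs; rewrite /prof_G pmulr_rlt0 ?hpow_gt0 //.
      by rewrite pmulr_llt0 // exprn_gt0 // invr_gt0.
    have Hs : 0 <= H s by rewrite addr_ge0 ?(ltW (lam_gt0 hs)) // !mulr_ge0 // ltW.
    have Fs := ltW (F_gt0 hs).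
    by rewrite !mulr_ge0 ?hpow_ge0 ?exprn_ge0 ?invr_ge0 ?mulr_ge0 ?(ltW vs) ?(ltW mu0) ?(ltW theta0) // ?exprn_ge0 // ltW.
  - by rewrite (ltW t0) ltW.
rewrite /prof_G pmulr_rge0 ?hpow_gt0 // pmulr_lge0 // exprn_gt0 // invr_gt0 //.
Qed.

Let Z_le0 t : 0 < t < T -> Z t <= 0.
Proof. by move=> h; rewrite Z_D // D_ge0. Qed.

Let restr t s : 0 <= t <= T -> 0 < s < t -> 0 < s < T.
Proof. by move=> /andP[_ tT] /andP[-> st]; rewrite (lt_le_trans st tT). Qed.

Lemma apriori_W t : 0 <= t <= T -> W t <= w0.
Proof.
move=> h; have /andP[t0 tT] := h.
apply: (@le_der _ W (fun=> w0) Z (fun=> 0) 0 t) => //.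
- exact: cont0_cst.
- by move=> s /(restr h) hs; exact: DW.
- by move=> s /(restr h) hs; exact: Z_le0.
- by rewrite W0.
Qed.

Lemma apriori_V t : 0 <= t <= T -> b <= V t <= b + w0 * t.
Proof.
move=> h; have /andP[t0 tT] := h; apply/andP; split.
  apply: (@le_der _ (fun=> b) V (fun=> 0) W 0 t) => //.
  - exact: cont0_cst.
  - by move=> s /(restr h) hs; exact: DV.
  - by move=> s /(restr h) hs; exact/ltW/W_gt0.
  - by rewrite V0.
apply: (@le_der _ V (fun t => b + w0 * t) W (fun=> w0) 0 t) => //.
- apply: cont0D; first exact: cont0_cst.
  by apply: cont0M; [exact: cont0_cst|exact: cont0_id].
- by move=> s /(restr h) hs; exact: DV.
- move=> s _; apply: (der_eq (derD (der_cst s b) (derM (der_cst s w0) (der_id s)))).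
  by rewrite mul0r !add0r mulr1.
- move=> s /(restr h) hs; apply: apriori_W.
  by case/andP: hs => s0 sT; rewrite !ltW.
- by rewrite V0 mulr0 addr0.
Qed.

Lemma apriori_S t : 0 <= t <= T -> b <= S t.
Proof.
move=> h; have /andP[t0 tT] := h.
apply: (@le_der _ (fun=> b) S (fun=> 0) (fun s => - (s * Z s)) 0 t) => //.
- exact: cont0_cst.
- exact: cont0_prof_S.
- by move=> s /(restr h) hs; apply: der_prof_S; [exact: DV|exact: DW].
- by move=> s /(restr h) hs; rewrite oppr_ge0 mulr_ge0_le0 ?Z_le0 // (ltW (pos hs)).
- by rewrite /prof_S V0 mul0r subr0.
Qed.

Lemma apriori_lam t : 0 < t < T -> mu * F t <= lam t.
Proof.
move=> h; have := D_ge0 h; rewrite subr_ge0 => hD.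
have h1 := ltW (lam_gt0 h); have h2 := mulr_ge0 (ltW mu0) (ltW (F_gt0 h)).
by rewrite -(ler_pXn2r (ltn0Sn p)) // nnegrE.
Qed.

(** D >= 0 gives both mu F <= lam and H lam^p <= (mu F)^k, hence H <= mu F; since V >= b, it follows
    that F' >= - (2 theta mu / b^2) F. The hypotheses concern ]0, T[ and the conclusion the endpoint
    [T], as the continuation argument requires. *)
Lemma apriori_F : 0 < F T.
Proof.
have g := @gronwall_ge R F (fun t => - (2 * theta / V t ^+ 2 * H t))
  (2 * theta / b ^+ 2 * mu) 0 T (@cont0_prof_F _ theta c _ _ cV cW V_gt0) (lexx 0) (ltW T0).
apply: (lt_le_trans _ (g _ _)).
- by rewrite mulr_gt0 ?expR_gt0 // /prof_F /prof_P !mul0r mulr0 subr0.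
- by move=> t h; exact: (der_prof_F theta c V_gt0 (pos h) (DV h) (DW h)).
move=> t h; have t0 := pos h; have v0 := V_gt0 (ltW t0); have l0 := lam_gt0 h.
have tT : 0 <= t <= T by case/andP: h => *; rewrite !ltW.
have /andP[bV _] := apriori_V tT.
have HF : H t <= mu * F t.
  rewrite -(ler_pM2r (exprn_gt0 p l0)) (prof_H_D n0 (ode h)).
  apply: (@le_trans _ _ ((mu * F t) ^+ p.+1)).
    by rewrite gerBl mulr_ge0 // D_ge0.
  rewrite exprS ler_wpM2l ?mulr_ge0 ?(ltW mu0) ?(ltW (F_gt0 h)) //.
  have h1 := ltW l0; have h2 := mulr_ge0 (ltW mu0) (ltW (F_gt0 h)).
  by rewrite lerXn2r ?nnegrE // apriori_lam.
rewrite mulNr lerN2; apply: (@le_trans _ _ (2 * theta / V t ^+ 2 * (mu * F t))).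
  by rewrite ler_wpM2l // divr_ge0 ?mulr_ge0 ?exprn_ge0 // ltW.
rewrite -[leRHS]mulrA ler_wpM2r ?mulr_ge0 ?(ltW mu0) ?(ltW (F_gt0 h)) //.
rewrite ler_wpM2l ?mulr_ge0 ?(ltW theta0) // lef_pV2 ?posrE ?exprn_gt0 //.
by rewrite lerXn2r ?nnegrE // ltW.
Qed.

(* From t1 on, a lower bound survives because t^n P is nondecreasing. *)
Definition ylow t := b * w0 * (b / (b + w0 * t1)) ^+ 2 * (t1 / (t1 + t)) ^+ n.+1.

(** Up to [t1] the bound P <= t w0 / b keeps F above c / 2, so that 2 V V' >= lam >= mu F >= mu c /
    2 = b w0. *)
Let small t : 0 < t < T -> t <= t1 -> b * w0 <= 2 * V t * W t.
Proof.
move=> h tt1; have t0 := pos h; have v0 := V_gt0 (ltW t0).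
have tT : 0 <= t <= T by case/andP: h => *; rewrite !ltW.
have /andP[bV _] := apriori_V tT; have Ww := apriori_W tT.
have Pt : P t <= t * w0 / b.
  rewrite /prof_P -!mulrA ler_wpM2l ?(ltW t0) // ler_pM ?invr_ge0 ?(ltW v0) ?(ltW (W_gt0 h)) //.
  by rewrite lef_pV2 ?posrE.
have Ft : c / 2 <= F t.
  have : 4 * theta * P t <= 4 * theta * (t1 * w0 / b).
    rewrite ler_wpM2l ?mulr_ge0 ?(ltW theta0) //; apply: (le_trans Pt).
    by rewrite -!mulrA ler_wpM2r ?mulr_ge0 ?invr_ge0 ?(ltW b0) ?(ltW w00).
  by rewrite t1E /prof_F; lra.
apply: (@le_trans _ _ (lam t)).
  apply: le_trans (apriori_lam h).
  by rewrite w0E ler_wpM2l ?(ltW mu0).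
rewrite /prof_lam /prof_S (_ : 2 * V t * W t = 2 * W t * V t); last by ring.
by rewrite ler_wpM2l ?mulr_ge0 ?(ltW (W_gt0 h)) // gerBl mulr_ge0 ?(ltW t0) ?(ltW (W_gt0 h)).
Qed.

Lemma apriori_low : ylow T <= 2 * V T * W T.
Proof.
have bw : 0 < b + w0 * t1 by rewrite addr_gt0 ?mulr_gt0.
have q1 : 0 <= b / (b + w0 * t1) <= 1.
  by rewrite divr_ge0 ?(ltW b0) ?(ltW bw) // ler_pdivrMr // mul1r lerDl mulr_ge0 // ltW.
have q2 : 0 <= t1 / (t1 + T) <= 1.
  rewrite divr_ge0 ?(ltW t1_gt0) ?addr_ge0 ?(ltW t1_gt0) ?(ltW T0) //.
  by rewrite ler_pdivrMr ?addr_gt0 // mul1r lerDl ltW.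
have [Tt1|t1T] := leP T t1.
  apply: (@le_trans _ _ (b * w0)).
    rewrite /ylow -mulrA ger_pMr ?mulr_gt0 //.
    have /andP[a1 a2] := q1; have /andP[a3 a4] := q2.
    by rewrite mulr_ile1 ?exprn_ge0 ?exprn_ile1.
  (* [small] speaks of points before [T]; its bound reaches [T] by continuity, tested at a point [s]
     close to [T]. *)
  pose f t := 2 * V t * W t.
  have cf : cont0 f by apply: cont0M => //; apply: cont0M => //; exact: cont0_cst.
  rewrite leNgt; apply/negP => fT.
  have fT' : 0 < b * w0 + - f T by rewrite subr_gt0.
  have [d d0 dP] := cont0_pos_near (cont0D (@cont0_cst R (b * w0)) (cont0N cf)) (ltW T0) fT'.
  pose s := Num.max (T / 2) (T - d / 2).
  have sT : 0 < s < T.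
    rewrite lt_max divr_gt0 //= gt_max gtrBl divr_gt0 // andbT.
    by rewrite ltr_pdivrMr // ltr_pMr ?ltr1n.
  have := dP s; rewrite distrC ger0_norm; last by case/andP: sT => _ ?; rewrite subr_ge0 ltW.
  have sd : T - s < d.
    have sd : T - d / 2 <= s by rewrite le_max lexx orbT.
    rewrite ltrBlDl -ltrBlDr (lt_le_trans _ sd) // ltrD2l ltrN2.
    by rewrite ltr_pdivrMr // ltr_pMr ?ltr1n.
  move=> /(_ (ltW (pos sT)) sd); rewrite subr_gt0 ltNge small //.
  by case/andP: sT => _ sT; rewrite (le_trans (ltW sT)).
have t1T' : 0 < t1 < T by rewrite t1_gt0.
have t1T'' : 0 <= t1 <= T by rewrite !ltW.
have TT : 0 <= T <= T by rewrite ltW /=.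
have /andP[bV1 V1] := apriori_V t1T''; have /andP[bV2 V2] := apriori_V TT.
have v1 := V_gt0 (ltW t1_gt0); have v2 := V_gt0 (ltW T0).
have mono : t1 ^+ n * P t1 <= T ^+ n * P T.
  apply: (@le_der _ (fun=> t1 ^+ n * P t1) (fun t => t ^+ n * P t) (fun=> 0)
    (fun t => n%:R * t ^+ n.-1 * 1 * P t + t ^+ n * (H t / 2 / V t ^+ 2)) t1 T) => //.
  - exact: cont0_cst.
  - by apply: cont0M; [apply: cont0X; exact: cont0_id|exact: cont0_prof_P].
  - exact: ltW.
  - exact: ltW.
  - move=> s /andP[s1 sT]; have s0 : 0 < s by exact: lt_trans s1.
    have h : 0 < s < T by rewrite s0.
    apply: derM; first by apply: derX; exact: der_id.
    exact: (der_prof_P V_gt0 s0 (DV h) (DW h)).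
  - move=> s /andP[s1 sT]; have s0 : 0 < s by exact: lt_trans s1.
    have h : 0 < s < T by rewrite s0.
    have vs := V_gt0 (ltW s0); have l0 := lam_gt0 h.
    (* The crude bounds D <= lam^k and n/(2k) - 1 <= n suffice: they give t P' >= - n P S / V >= - n
       P. *)
    have Hn : - (n%:R * lam s) <= H s.
      rewrite -(ler_pM2r (exprn_gt0 p l0)) (prof_H_D n0 (ode h)) mulNr -mulrA -exprS.
      have F0 : 0 <= (mu * F s) ^+ p.+1.
        by rewrite exprn_ge0 // mulr_ge0 // ltW // F_gt0.
      have Dl : D s <= lam s ^+ p.+1 by rewrite gerBl.
      have L0 : 0 <= lam s ^+ p.+1 by rewrite exprn_ge0 // ltW.
      have kn : n%:R / (2 * p.+1%:R) - 1 <= n%:R :> R.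
        have : n%:R / (2 * p.+1%:R) <= n%:R :> R; last by move=> hn; rewrite lerBlDr (le_trans hn) // lerDl.
        rewrite ler_pdivrMr ?mulr_gt0 ?ltr0n // ler_peMr //.
        by rewrite -natrM ler1n.
      apply: (@le_trans _ _ (- ((n%:R / (2 * p.+1%:R) - 1) * D s))); last by rewrite lerDr.
      by rewrite lerN2; exact: ler_pM nk (D_ge0 h) kn Dl.
    have Ps : P s = lam s * s / (2 * V s * S s).
      rewrite /prof_P /prof_lam; field; rewrite (gt_eqF vs) /=.
      by rewrite gt_eqF // S_gt0.
    have P0 : 0 <= P s.
      by rewrite /prof_P divr_ge0 ?mulr_ge0 ?(ltW s0) ?(ltW vs) ?(ltW (W_gt0 h)).
    have sH : - (n%:R * P s) <= s * H s / 2 / V s ^+ 2.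
      apply: (@le_trans _ _ (s * (- (n%:R * lam s)) / 2 / V s ^+ 2)); last first.
        rewrite ler_wpM2r ?invr_ge0 ?exprn_ge0 ?(ltW vs) // ler_wpM2r ?invr_ge0 //.
        by rewrite ler_wpM2l ?(ltW s0).
      have -> : s * (- (n%:R * lam s)) / 2 / V s ^+ 2 = - (n%:R * (P s * (S s / V s))).
        by rewrite /prof_lam /prof_P; field; rewrite gt_eqF.
      rewrite lerN2 ler_wpM2l // ler_piMr //.
      rewrite ler_pdivrMr // mul1r gerBl mulr_ge0 ?(ltW s0) ?(ltW (W_gt0 h)) //.
    have -> : n%:R * s ^+ n.-1 * 1 * P s + s ^+ n * (H s / 2 / V s ^+ 2) =
       s ^+ n.-1 * (n%:R * P s + s * H s / 2 / V s ^+ 2).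
      by rewrite -(prednK n0) [s ^+ _.+1]exprS /= ; field; rewrite gt_eqF.
    by rewrite mulr_ge0 ?exprn_ge0 ?(ltW s0) //; lra.
have s1 := small t1T' (lexx _).
have : t1 ^+ n.+1 * (b * w0) / V t1 ^+ 2 <= T ^+ n.+1 * (2 * V T * W T) / V T ^+ 2.
  apply: (@le_trans _ _ (2 * (t1 ^+ n * P t1))).
    have -> : 2 * (t1 ^+ n * P t1) = t1 ^+ n.+1 * (2 * V t1 * W t1) / V t1 ^+ 2.
      by rewrite /prof_P exprS; field; rewrite gt_eqF.
    rewrite ler_wpM2r ?invr_ge0 ?exprn_ge0 ?(ltW v1) //.
    by rewrite ler_wpM2l ?exprn_ge0 ?(ltW t1_gt0).
  have -> : T ^+ n.+1 * (2 * V T * W T) / V T ^+ 2 = 2 * (T ^+ n * P T).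
    by rewrite /prof_P exprS; field; rewrite gt_eqF.
  by rewrite ler_wpM2l.
move=> key.
(* Solved for 2 V V' at [T], the monotonicity yields [ylow] through V(T) >= b and V(t1) <= b + w0
   t1. Replacing T by t1 + T in the denominator keeps [ylow] finite at 0. *)
apply: (@le_trans _ _ (V T ^+ 2 * (t1 ^+ n.+1 * (b * w0) / V t1 ^+ 2) / T ^+ n.+1)); last first.
  rewrite ler_pdivrMr ?exprn_gt0 //.
  rewrite -ler_pdivlMl ?exprn_gt0 //; apply: (le_trans key).
  by rewrite le_eqVlt; apply/orP; left; apply/eqP; field; rewrite gt_eqF.
have -> : V T ^+ 2 * (t1 ^+ n.+1 * (b * w0) / V t1 ^+ 2) / T ^+ n.+1 =
  b * w0 * (V T / V t1) ^+ 2 * (t1 / T) ^+ n.+1 by rewrite !exprMn !exprVn; ring.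
have /andP[a1 a2] := q1; have /andP[a3 a4] := q2.
have bw0 : 0 <= b * w0 by rewrite mulr_ge0 // ltW.
apply: ler_pM; [exact: mulr_ge0 bw0 (exprn_ge0 _ a1)|exact: exprn_ge0| |]; last first.
  rewrite lerXn2r ?nnegrE ?divr_ge0 ?(addr_ge0 (ltW t1_gt0) (ltW T0)) ?(ltW t1_gt0) ?(ltW T0) //.
  by rewrite ler_wpM2l ?(ltW t1_gt0) // lef_pV2 ?posrE ?addr_gt0 // lerDr ltW.
rewrite ler_wpM2l // lerXn2r ?nnegrE ?divr_ge0 ?(ltW v1) ?(ltW v2) ?(ltW b0) ?(ltW bw) //.
by rewrite ler_pM ?invr_ge0 ?(ltW b0) ?(ltW bw) // lef_pV2 ?posrE.
Qed.

End APriori.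

(** * Existence of the profile for positive theta *)

Section Existence.
Context {R : realType}.
Variables (n p : nat) (theta c mu b w0 t1 : R).
Hypotheses (n2p : (2 * p.+1 <= n)%N) (theta0 : 0 < theta) (c0 : 0 < c)
  (mu0 : 0 < mu) (b0 : 0 < b).
Hypotheses (w00 : 0 < w0) (w0E : b * w0 = mu * (c / 2))
  (t1_gt0 : 0 < t1) (t1E : 4 * theta * (t1 * w0 / b) = c / 2).
Implicit Types (f : R -> R) (t : R).

Let n0 : (0 < n)%N. Proof. exact: leq_trans n2p. Qed.
Local Notation k := (p.+1).
Local Notation kinv := (p.+1%:R^-1 : R).
Let a : R := n%:R / 2.
Let yl := ylow n b w0 t1.
(** The a priori bounds are yl <= 2 V V' <= 2 w0 (b + w0 t) and 1 - P = S / V >= b / (b + w0 t). The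
    thresholds [lo], [hi] and [dl] leave some slack, so that these bounds meet them strictly. *)
Let lo t := yl t / 2.
Let hi t := 2 * w0 * (b + w0 * t) + 1.
Let dl t := b / (b + w0 * t) / 2.

Let lin_gt0 t : 0 <= t -> 0 < b + w0 * t.
Proof. by move=> t0; rewrite ltr_wpDr // mulr_ge0 // ltW. Qed.

Let cont0_lin : cont0 (fun t => b + w0 * t).
Proof.
apply: cont0D; first exact: cont0_cst.
by apply: cont0M; [exact: cont0_cst|exact: cont0_id].
Qed.

Let cont0_t1 : cont0 (fun t => t1 + t).
Proof. by apply: cont0D; [exact: cont0_cst|exact: cont0_id]. Qed.

Let yl_gt0 t : 0 <= t -> 0 < yl t.
Proof.
move=> t0; have l1 := lin_gt0 (ltW t1_gt0); have l2 : 0 < t1 + t by rewrite ltr_wpDr.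
have b1 := divr_gt0 b0 l1; have b2 := divr_gt0 t1_gt0 l2.
by rewrite /yl /ylow mulr_gt0 ?exprn_gt0 // mulr_gt0 ?exprn_gt0 // mulr_gt0.
Qed.

Let cont0_yl : cont0 yl.
Proof.
apply: cont0M; first exact: cont0_cst.
apply: cont0X; apply: cont0M; first exact: cont0_cst.
by apply: cont0V => // t t0; rewrite gt_eqF // ltr_wpDr.
Qed.

Let lo_gt0 t : 0 <= t -> 0 < lo t.
Proof. by move=> /yl_gt0 h; rewrite divr_gt0. Qed.

Let cont0_lo : cont0 lo.
Proof. by apply: cont0M => //; exact: cont0_cst. Qed.

Let cont0_hi : cont0 hi.
Proof.
apply: cont0D; last exact: cont0_cst.
by apply: cont0M => //; exact: cont0_cst.
Qed.

Let yl_le t : 0 <= t -> yl t <= b * w0.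
Proof.
move=> t0; rewrite /yl /ylow -mulrA ger_pMr ?mulr_gt0 //.
have l0 := lin_gt0 (ltW t1_gt0); have l1 : 0 < t1 + t by rewrite ltr_wpDr.
rewrite mulr_ile1 ?exprn_ge0 ?exprn_ile1 ?divr_ge0 ?(ltW b0) ?(ltW t1_gt0) ?(ltW l0) ?(ltW l1) //.
  by rewrite ler_pdivrMr // mul1r lerDl mulr_ge0 // ltW.
by rewrite ler_pdivrMr // mul1r lerDl.
Qed.

Let lo_hi t : 0 <= t -> lo t <= hi t.
Proof.
move=> t0; have h1 := yl_le t0; have h2 := yl_gt0 t0.
have h3 : 0 <= w0 * (w0 * t) by rewrite !mulr_ge0 // ltW.
have h4 : 0 < b * w0 by rewrite mulr_gt0.
by rewrite /lo /hi; lra.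
Qed.

Let cont0_dl : cont0 dl.
Proof.
apply: cont0M; last exact: cont0_cst.
apply: cont0M; first exact: cont0_cst.
by apply: cont0V => // t t0; rewrite gt_eqF // lin_gt0.
Qed.

Let dl_gt0 t : 0 <= t -> 0 < dl t.
Proof. by move=> t0; rewrite !divr_gt0 // lin_gt0. Qed.

(* Y and P are truncated just outside the region allowed by the a priori bounds. *)
Let clampY f t := Num.min (Num.max (f t) (lo t ^+ k)) (hi t ^+ k).
Let yy f t := clampY f t `^ kinv.
(** [UU] is V^2 recovered from its derivative, and [QQ] is P / t in a form without singularity at
    0. *)
Let UU f t := b ^+ 2 + prim (yy f) t.
Let QQ f t := yy f t * (2 * UU f t)^-1.
Let PP f t := Num.min (t * QQ f t) (1 + - dl t).
Let EE f t := (1 + - PP f t)^-1.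
Let FF f t := c + - (4 * theta) * PP f t.
(* Without truncation, t KK = a mu^k (F^k (1 - P)^(-p) - c^k) + (a + k) P Y; the factor t
   comes from P = t QQ, by factoring (1 - P)^(-p) - 1 and F^k - c^k. *)
Let KK f t := a * mu ^+ k * QQ f t *
   (FF f t ^+ k * EE f t * (\sum_(i < p) EE f t ^+ i) +
    - (4 * theta) * (\sum_(i < k) FF f t ^+ (k.-1 - i) * c ^+ i)) +
   (a + k%:R) * QQ f t * clampY f t.

Let clamp_lo f t : 0 <= t -> lo t ^+ k <= clampY f t.
Proof.
move=> t0; rewrite /clampY le_min le_max lexx orbT /=.
have l0 := ltW (lo_gt0 t0).
by rewrite lerXn2r ?nnegrE ?(le_trans l0) ?lo_hi.
Qed.

Let clamp_gt0 f t : 0 <= t -> 0 < clampY f t.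
Proof. by move=> t0; apply: lt_le_trans (clamp_lo _ t0); rewrite exprn_gt0 // lo_gt0. Qed.

Let v_clamp : volterra clampY.
Proof.
apply: volterra_clamp; [exact: cont0X|exact: cont0X|].
move=> t t0; have l0 := ltW (lo_gt0 t0).
by rewrite exprn_ge0 //= lerXn2r ?nnegrE ?(le_trans l0) ?lo_hi.
Qed.

Let v_yy : volterra yy.
Proof. by apply: (volterra_root v_clamp cont0_lo lo_gt0) => f t _; exact: clamp_lo. Qed.

Let yy_gt0 f t : 0 <= t -> 0 < yy f t.
Proof. by move=> t0; rewrite powR_gt0 // clamp_gt0. Qed.

Let yyK f t : 0 <= t -> yy f t ^+ k = clampY f t.
Proof.
move=> t0; rewrite -powR_mulrn ?powR_ge0 // -powRrM mulVf ?pnatr_eq0 //.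
by rewrite powRr1 // ltW // clamp_gt0.
Qed.

Let cont0_yy f : cont0 f -> cont0 (yy f). Proof. exact: v_yy.1. Qed.

Let UU_der f t : cont0 f -> 0 < t -> is_derive t (1 : R) (UU f) (yy f t).
Proof.
move=> cf t0; have cy := cont0_yy cf.
by apply: (der_eq (derD (der_cst t (b ^+ 2)) (prim_derp cy t0))); rewrite add0r.
Qed.

Let cont0_UU f : cont0 f -> cont0 (UU f).
Proof. by move=> cf; apply: cont0D; [exact: cont0_cst|exact/prim_cont0/cont0_yy]. Qed.

Let UU_ge f t : cont0 f -> 0 <= t -> b ^+ 2 <= UU f t.
Proof.
move=> cf t0; have [cc cu] := (@cont0_cst R (b ^+ 2), cont0_UU cf).
apply: (@le_der _ _ _ (fun=> 0) (yy f) 0 t cc cu) => //.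
- by move=> s /andP[s0 _]; exact: UU_der.
- by move=> s /andP[s0 _]; apply/ltW/yy_gt0/ltW.
- by rewrite /UU prim0 addr0.
Qed.

Let UU_gt0 f t : cont0 f -> 0 <= t -> 0 < UU f t.
Proof. by move=> cf t0; apply: lt_le_trans (UU_ge cf t0); rewrite exprn_gt0. Qed.

Let v_cst (x : R) : volterra (fun (_ : R -> R) (_ : R) => x).
Proof. by apply: volterra_fun; exact: cont0_cst. Qed.

Let v_QQ : volterra QQ.
Proof.
apply: (volterraM v_yy); apply: (volterraV (lo := fun=> 2 * b ^+ 2)).
- apply: volterraM; first exact: v_cst.
  by apply: volterraD; [exact: v_cst|exact: volterra_prim].
- exact: cont0_cst.
- by move=> t _; rewrite mulr_gt0 // exprn_gt0.
- by move=> f t cf t0; rewrite ler_wpM2l // UU_ge.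
Qed.

Let cont0_1dl : cont0 (fun t => 1 + - dl t).
Proof. by apply: cont0D; [exact: cont0_cst|exact: cont0N]. Qed.

Let v_PP : volterra PP.
Proof.
apply: volterra_min; last exact: cont0_1dl.
by apply: volterraM => //; apply: volterra_fun; exact: cont0_id.
Qed.

Let v_NPP : volterra (fun f t => - PP f t).
Proof.
rewrite (_ : (fun f t => _) = fun f t => -1 * PP f t).
  by apply: volterraM => //; exact: v_cst.
by apply/funext => f; apply/funext => t; rewrite mulN1r.
Qed.

Let EE_low f t : 0 <= t -> dl t <= 1 + - PP f t.
Proof.
move=> t0; have : PP f t <= 1 + - dl t by rewrite /PP ge_min lexx orbT.
by lra.
Qed.

Let v_EE : volterra EE.
Proof.
apply: (volterraV (lo := dl)) => //.
  by apply: volterraD => //; exact: v_cst.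
by move=> f t _; exact: EE_low.
Qed.

Let v_FF : volterra FF.
Proof. by apply: volterraD; [exact: v_cst|apply: volterraM => //; exact: v_cst]. Qed.

Let v_KK : volterra KK.
Proof.
apply: volterraD.
  apply: volterraM; first by apply: volterraM => //; exact: v_cst.
  apply: volterraD.
    apply: volterraM; first by apply: volterraM => //; exact: volterraX.
    by apply: volterra_sum => i; exact: volterraX.
  apply: volterraM; first exact: v_cst.
  apply: volterra_sum => i; apply: volterraM; last exact: v_cst.
  exact: volterraX.
apply: volterraM => //; apply: volterraM => //; exact: v_cst.
Qed.

Lemma truncated_solution : exists2 f, cont0 f &
  forall t, 0 <= t -> f t = (mu * c) ^+ k + t * wavg n (KK f) t.
Proof. exact: (singular_picard n ((mu * c) ^+ k) v_KK). Qed.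

Section Solution.
Variable Y : R -> R.
Hypotheses (cY : cont0 Y)
  (YE : forall t, 0 <= t -> Y t = (mu * c) ^+ k + t * wavg n (KK Y) t).
Let y := yy Y.
Let U := UU Y.
Let cy : cont0 y. Proof. exact: cont0_yy. Qed.
Let cU : cont0 U. Proof. exact: cont0_UU. Qed.
Let y_gt0 t : 0 <= t -> 0 < y t. Proof. exact: yy_gt0. Qed.
Let U_gt0 t : 0 <= t -> 0 < U t. Proof. exact: UU_gt0. Qed.
Let cK : cont0 (KK Y). Proof. exact: v_KK.1. Qed.

Let dY t := KK Y t - a * wavg n (KK Y) t.
Let dy t := kinv * clampY Y t `^ (kinv - 1) * dY t.
Let V t := Num.sqrt (U t).
Let W t := y t * (2 * V t)^-1.
Let Z t := (dy t - 2 * W t ^+ 2) * (2 * V t)^-1.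

Let V_gt0 t : 0 <= t -> 0 < V t.
Proof. by move=> t0; rewrite sqrtr_gt0 U_gt0. Qed.

Let cV : cont0 V.
Proof. by apply: (cont0_comp _ cU); exact: sqrt_continuous. Qed.

Let c2V : cont0 (fun t => (2 * V t)^-1).
Proof.
apply: cont0V; first by apply: cont0M => //; exact: cont0_cst.
by move=> t t0; rewrite gt_eqF // mulr_gt0 // V_gt0.
Qed.

Let cW : cont0 W. Proof. exact: cont0M. Qed.

Let cdY : cont0 dY.
Proof.
apply: cont0D => //; apply: cont0N; apply: cont0M; first exact: cont0_cst.
exact: wavg_cont0.
Qed.

Let cZ : cont0 Z.
Proof.
apply: cont0M => //; apply: cont0D.
  apply: cont0M => //; apply: cont0M; first exact: cont0_cst.
  by apply: cont0_powR => [|t]; [exact: v_clamp.1|exact: clamp_gt0].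
apply: cont0N; apply: cont0M; first exact: cont0_cst.
exact: cont0X.
Qed.

Let DY t : 0 < t -> is_derive t (1 : R) Y (dY t).
Proof.
move=> t0.
apply: (@der_eq_pos _ (fun t => (mu * c) ^+ k + t * wavg n (KK Y) t)) => //.
  by move=> s s0; rewrite YE // ltW.
by apply: (der_eq (derD (der_cst t ((mu * c) ^+ k)) (wavg_der n cK t0))); rewrite add0r.
Qed.

Let V2 t : 0 <= t -> V t ^+ 2 = U t.
Proof. by move=> t0; rewrite sqr_sqrtr // ltW // U_gt0. Qed.

Let DV t : 0 < t -> is_derive t (1 : R) V (W t).
Proof.
move=> t0; have u0 := U_gt0 (ltW t0).
by apply: (der_eq (der_comp (UU_der cY t0) (is_derive1_sqrt u0))); rewrite mulrC.
Qed.

Let P t := t * QQ Y t.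

Let P_prof_P t : 0 <= t -> prof_P V W t = P t.
Proof.
move=> t0; rewrite /prof_P /W /P /QQ -/y -/U -V2 //.
by have v0 := V_gt0 t0; field; rewrite gt_eqF.
Qed.

(* Positive exactly where F > 0 and no truncation is active. *)
Definition good t := Num.min (Num.min (Y t - lo t ^+ k) (hi t ^+ k - Y t))
                             (Num.min (1 - dl t - P t) (c - 4 * theta * P t)).

Let goodE t : (0 < good t) = [&& lo t ^+ k < Y t, Y t < hi t ^+ k, P t < 1 - dl t
   & 0 < c - 4 * theta * P t].
Proof. by rewrite /good !lt_min !subr_gt0 -andbA. Qed.

Let cP : cont0 P.
Proof. by apply: cont0M; [exact: cont0_id|exact: v_QQ.1]. Qed.

Let cgood : cont0 good.
Proof.
apply: cont0_min; apply: cont0_min.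
- by apply: cont0D => //; apply: cont0N; exact: cont0X.
- by apply: cont0D; [exact: cont0X|exact: cont0N].
- by apply: cont0D => //; exact: cont0N.
- apply: cont0D; first exact: cont0_cst.
  by apply: cont0N; apply: cont0M => //; exact: cont0_cst.
Qed.

Let clampE t : 0 < good t -> clampY Y t = Y t.
Proof.
rewrite goodE => /and4P[h1 h2 _ _].
by rewrite /clampY max_l ?min_l // ltW.
Qed.

Let PE t : 0 < good t -> PP Y t = P t.
Proof. by rewrite goodE => /and4P[_ _ h _]; rewrite /PP min_l // ltW. Qed.

Let P_lt1 t : 0 <= t -> 0 < good t -> P t < 1.
Proof.
move=> t0; rewrite goodE => /and4P[_ _ h _]; have := dl_gt0 t0; lra.
Qed.

Let Dy t : 0 < t -> 0 < good t -> is_derive t (1 : R) y (dy t).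
Proof.
(* Positivity of [good] is an open condition, so the clamp is inactive in a whole neighbourhood of
   [t] and the root of [Y] can be differentiated there. *)
move=> t0 g; have [d d0 dP] := cont0_pos_near cgood (ltW t0) g.
apply: (@der_near _ (fun s => Y s `^ kinv)).
  near=> s.
  have s0 : 0 < s by near: s; exact: lt_nbhsr.
  rewrite /y /yy clampE //; apply: dP; first exact: ltW.
  near: s; have /cvgrPdist_lt/(_ _ d0) X := @cvg_id _ (nbhs t).
  by apply: filterS X => s; rewrite distrC.
rewrite /dy clampE //; apply: der_powR; last exact: DY.
by rewrite -clampE // clamp_gt0 // ltW.
Unshelve. all: by end_near. Qed.

Let DW t : 0 < t -> 0 < good t -> is_derive t (1 : R) W (Z t).
Proof.
move=> t0 g; have v0 := V_gt0 (ltW t0).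
have v20 : 2 * V t != 0 by rewrite gt_eqF // mulr_gt0.
have D2 : is_derive t (1 : R) (fun s => 2 * V s) (0 * V t + 2 * W t).
  by apply: (derM (der_cst t 2)); exact: DV.
have D3 := @derV _ (fun s => 2 * V s) t _ v20 D2.
apply: (@der_eq _ W t _ _ (derM (Dy t0 g) D3)).
by rewrite /Z /W; field; rewrite gt_eqF.
Qed.

Let dyE t : 0 <= t -> k%:R * y t ^+ p * dy t = dY t.
Proof.
move=> t0; have c1 := clamp_gt0 Y t0; have y0 := y_gt0 t0.
rewrite /dy; have -> : clampY Y t `^ (kinv - 1) = y t / clampY Y t.
  rewrite powRD; first by rewrite powR_inv1 // ltW.
  by rewrite (gt_eqF c1) implybT.
rewrite -(yyK Y t0) -/y exprS; field.
by rewrite expf_neq0 ?(gt_eqF y0) //= addrC natr1 pnatr_eq0.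
Qed.

Let tK t : 0 <= t -> 0 < good t -> t * KK Y t =
  a * (mu * (c - 4 * theta * P t)) ^+ k * (1 - P t)^-1 ^+ p - a * (mu * c) ^+ k
  + (a + k%:R) * P t * Y t.
Proof.
move=> t0 g; have P1 := P_lt1 t0 g.
have e1 : EE Y t = (1 - P t)^-1 by rewrite /EE PE.
have f1 : FF Y t = c - 4 * theta * P t by rewrite /FF PE // mulNr.
rewrite /KK clampE // e1 f1; set E := (1 - P t)^-1; set f := c - _.
have hE : E ^+ p - 1 = P t * E * (\sum_(i < p) E ^+ i).
  by rewrite subrX1; congr (_ * _); rewrite /E; field; rewrite subr_eq0 gt_eqF.
have hF : f ^+ k - c ^+ k = - (4 * theta) * P t * (\sum_(i < k) f ^+ (k.-1 - i) * c ^+ i).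
  by rewrite subrXX; congr (_ * _); rewrite /f; ring.
rewrite !exprMn.
transitivity (a * mu ^+ k * (f ^+ k * (P t * E * (\sum_(i < p) E ^+ i)) +
   (- (4 * theta) * P t * (\sum_(i < k) f ^+ (k.-1 - i) * c ^+ i))) +
   (a + k%:R) * P t * Y t); last by rewrite -hE -hF; ring.
have PQ : P t = t * QQ Y t by [].
by rewrite PQ; ring.
Qed.

Let ode t : 0 < t -> 0 < good t -> profile_ode n p theta c mu V W Z t.
Proof.
move=> t0 g; have t0' := ltW t0; have v0 := V_gt0 t0'; have P1 := P_lt1 t0' g.
have y0 := y_gt0 t0'.
have n0' : n%:R != 0 :> R by rewrite pnatr_eq0 -lt0n.
have k0' : k%:R != 0 :> R by rewrite pnatr_eq0.
have lamE : prof_lam V W t = y t * (1 - P t).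
  rewrite /prof_lam /prof_S -P_prof_P // /prof_P /W; field; by rewrite gt_eqF.
have ZE : 4 * t * V t * Z t = 2 * t * dy t - 2 * P t * y t.
  rewrite -P_prof_P // /prof_P /Z /W; field; by rewrite gt_eqF.
have FE : prof_F theta c V W t = c - 4 * theta * P t by rewrite /prof_F P_prof_P.
have eY : y t ^+ k = Y t by rewrite yyK // clampE.
have eK : t * dY t = a * (mu * (c - 4 * theta * P t)) ^+ k * (1 - P t)^-1 ^+ p
   - a * Y t + (a + k%:R) * P t * Y t.
  have : t * wavg n (KK Y) t = Y t - (mu * c) ^+ k by rewrite YE // addrC addKr.
  rewrite /dY mulrBr tK // => H.
  rewrite [X in _ - X](_ : _ = a * (t * wavg n (KK Y) t)); last by ring.
  by rewrite H; ring.
rewrite /profile_ode lamE ZE FE; move: eK; set M := (mu * _) ^+ k => eK.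
have E0 : (1 - P t) ^+ p != 0 by rewrite expf_neq0 // subr_eq0 gt_eqF.
transitivity ((1 - P t) ^+ p * (y t ^+ k * (1 - P t) +
   n%:R^-1 * 2 * (t * (k%:R * y t ^+ p * dy t)) - n%:R^-1 * 2 * k%:R * P t * y t ^+ k)).
  by rewrite exprMn exprS; field.
rewrite dyE // eK eY exprVn /a; field.
by rewrite n0' E0.
Qed.

Let U0 : U 0 = b ^+ 2. Proof. by rewrite /U /UU prim0 addr0. Qed.
Let V0 : V 0 = b. Proof. by rewrite /V U0 sqrtr_sqr gtr0_norm. Qed.
Let Y0 : Y 0 = (2 * b * w0) ^+ k.
Proof.
rewrite YE // mul0r addr0; congr (_ ^+ _).
by rewrite -mulrA w0E; field.
Qed.

Let good0 : 0 < good 0.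
Proof.
have l0 : lo 0 <= b * w0 / 2 by rewrite /lo ler_wpM2r // yl_le.
have bw : 0 < b * w0 by rewrite mulr_gt0.
have l1 := lo_gt0 (lexx 0).
rewrite goodE Y0; apply/and4P; split.
- by rewrite ltrXn2r //= ?nnegrE ?(ltW l1) //; lra.
- have -> : hi 0 = 2 * w0 * b + 1 by rewrite /hi mulr0 addr0.
  by rewrite ltrXn2r //= ?nnegrE; lra.
- by rewrite /P mul0r subr_gt0 /dl mulr0 addr0 divff ?gt_eqF //; lra.
- by rewrite /P mul0r mulr0 subr0.
Qed.

Let W0 : W 0 = w0.
Proof.
rewrite /W V0; have -> : y 0 = 2 * b * w0.
  have h : 0 <= 2 * b * w0 by rewrite !mulr_ge0 // ltW.
  apply: (@pexpIrn _ k) => //; rewrite ?nnegrE ?(ltW (y_gt0 (lexx 0))) //.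
  by rewrite yyK // clampE // Y0.
by field; rewrite gt_eqF.
Qed.

Let W_gt0 t : 0 <= t -> 0 < W t.
Proof. by move=> t0; rewrite mulr_gt0 ?invr_gt0 ?mulr_gt0 ?y_gt0 ?V_gt0. Qed.

(** If [good] is positive before [t], the hypotheses of the a priori bounds hold on ]0, t[, and the
    bounds, valid at [t] itself, are strictly better than the thresholds. So the truncation never
    becomes active. *)
Lemma good_gt0 t : 0 <= t -> 0 < good t.
Proof.
apply: cont0_open_induction => // {}t t0 gt.
have gt' s : 0 < s < t -> 0 < good s by case/andP => s0 st; rewrite gt // (ltW s0).
have pos s : 0 < s < t -> 0 < s by case/andP.
have aDV (s : R) : 0 < s < t -> is_derive s (1 : R) V (W s) by move=> /pos; exact: DV.
have aDW (s : R) : 0 < s < t -> is_derive s (1 : R) W (Z s) by move=> h; exact: DW (pos _ h) (gt' _ h).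
have aode s : 0 < s < t -> profile_ode n p theta c mu V W Z s by move=> h; exact: ode (pos _ h) (gt' _ h).
have aW s : 0 < s < t -> 0 < W s by move=> /pos/ltW; exact: W_gt0.
have aS s : 0 < s < t -> 0 < prof_S V W s.
  move=> h; have s0 := ltW (pos _ h); rewrite prof_S_P // P_prof_P // mulr_gt0 ?V_gt0 //.
  by rewrite subr_gt0 P_lt1 // gt'.
have aF s : 0 < s < t -> 0 < prof_F theta c V W s.
  move=> h; have s0 := ltW (pos _ h); rewrite /prof_F P_prof_P //.
  by have := gt' s h; rewrite goodE => /and4P[].
have tt : 0 <= t <= t by rewrite ltW /=.
have t0' := ltW t0.
have hF := apriori_F n2p theta0 c0 mu0 b0 t0 cV cW V_gt0 V0 W0 aDV aDW aode aW aS aF.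
have hW := apriori_W n2p theta0 mu0 cV cW V_gt0 W0 aDV aDW aode aW aS aF tt.
have hV := apriori_V n2p theta0 mu0 cV cW V_gt0 V0 W0 aDV aDW aode aW aS aF tt.
have hS := apriori_S n2p theta0 mu0 cV cW V_gt0 V0 aDV aDW aode aW aS aF tt.
have hL := apriori_low n2p theta0 mu0 b0 t0 w00 w0E t1_gt0 t1E cV cW V_gt0 V0 W0 aDV aDW aode aW aS aF.
have v0 := V_gt0 t0'; have y0 := y_gt0 t0'; have /andP[hV1 hV2] := hV.
have yE : 2 * V t * W t = y t by rewrite /W; field; rewrite gt_eqF.
have l0 := lo_gt0 t0'; have yl0 := yl_gt0 t0'; have h0 := lin_gt0 t0'.
have y1 : lo t < y t by rewrite -yE; apply: lt_le_trans hL; rewrite /lo -/yl; lra.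
have y2 : y t < hi t.
  rewrite -yE /hi; apply: (@le_lt_trans _ _ (2 * w0 * (b + w0 * t))); last by rewrite ltrDl.
  rewrite -!mulrA ler_wpM2l // [leRHS]mulrC.
  by rewrite ler_pM ?(ltW v0) ?(ltW (W_gt0 t0')).
(* The bounds control y, the root of the clamped [Y]. Were the clamp active at [t], y^k would equal
   one of the two thresholds, against [y1] or [y2]. *)
have YC : clampY Y t = Y t.
  have := yyK Y t0'; rewrite -/y => yC; rewrite -yC.
  move: yC; rewrite /clampY.
  have y1k : lo t ^+ k < y t ^+ k by rewrite ltrXn2r ?nnegrE ?(ltW l0) ?(ltW y0).
  have y2k : y t ^+ k < hi t ^+ k by rewrite ltrXn2r ?nnegrE ?(ltW y0) ?(ltW (lt_trans y0 y2)).
  rewrite minEle; case: ifP => _; last by move=> e; rewrite e ltxx in y2k.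
  rewrite maxEle; case: ifP => _ // e; first by rewrite e ltxx in y1k.
rewrite goodE -YC -(yyK Y t0') -/y; apply/and4P; split.
- by rewrite ltrXn2r ?nnegrE ?(ltW l0) ?(ltW y0).
- by rewrite ltrXn2r ?nnegrE ?(ltW y0) ?(ltW (lt_trans y0 y2)).
- have : b / (b + w0 * t) <= 1 - P t.
    have : b <= V t * (1 - P t) by rewrite -P_prof_P // -prof_S_P.
    rewrite mulrC -ler_pdivrMr // => h; apply: le_trans h.
    by rewrite ler_wpM2l ?(ltW b0) // lef_pV2 ?posrE.
  have : 0 < b / (b + w0 * t) by rewrite divr_gt0.
  by rewrite /dl; lra.
- by rewrite -P_prof_P.
Qed.

Let Y_gt0 t : 0 <= t -> 0 < Y t.
Proof. by move=> t0; rewrite -clampE ?good_gt0 // clamp_gt0. Qed.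

(** A bootstrap: if [Y] is C^m then so is [KK Y], and averages preserve C^m, so the derivative [dY],
    which is [KK Y] minus a multiple of its average, is C^m as well. *)
Lemma Chalf_Y m : Chalf m Y.
Proof.
elim: m => [|m ih]; first by split.
have cc x : Chalf m (fun=> x) by exact: Chalf_cst.
have yC : Chalf m y.
  apply: (eq_Chalf _ (Chalf_powR kinv Y_gt0 ih)) => t t0.
  by rewrite /y /yy clampE // good_gt0.
have UC : Chalf m U.
  by apply: ChalfD => //; apply: ChalfW; exact: Chalf_prim.
have QC : Chalf m (QQ Y).
  apply: ChalfM => //; apply: ChalfV; last exact: ChalfM.
  by move=> t t0; rewrite mulr_gt0 // U_gt0.
have PC : Chalf m (PP Y).
  apply: (eq_Chalf _ (ChalfM (Chalf_id m) QC)) => t t0.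
  by rewrite PE // good_gt0.
have EC : Chalf m (EE Y).
  apply: ChalfV; last by apply: ChalfD => //; exact: ChalfN.
  by move=> t t0; rewrite subr_gt0 PE ?good_gt0 // P_lt1 // good_gt0.
have FC : Chalf m (FF Y).
  by apply: ChalfD => //; exact: ChalfM.
have KC : Chalf m (KK Y).
  apply: ChalfD.
    apply: ChalfM; first exact: ChalfM.
    apply: ChalfD.
      apply: ChalfM; first by apply: ChalfM => //; exact: ChalfX.
      by apply: Chalf_sum => i; exact: ChalfX.
    apply: ChalfM => //; apply: Chalf_sum => i; apply: ChalfM => //; exact: ChalfX.
  apply: ChalfM; first exact: ChalfM.
  by apply: (eq_Chalf _ ih) => t t0; rewrite clampE // good_gt0.
apply: (@ChalfS _ m Y dY) => //.
by apply: ChalfD => //; apply: ChalfN; apply: ChalfM => //; exact: Chalf_wavg.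
Qed.

Lemma solution_profile : exists V W Z : R -> R,
  [/\ forall m, Chalf m V, cont0 W, cont0 Z, V 0 = b & W 0 = w0] /\
  [/\ forall t, 0 <= t -> 0 < V t /\ 0 < W t,
      forall t, 0 <= t -> 0 < prof_S V W t,
      forall t, 0 <= t -> 0 < prof_F theta c V W t,
      forall t : R, 0 < t -> is_derive t (1 : R) V (W t) /\ is_derive t (1 : R) W (Z t)
    & forall t, 0 < t -> profile_ode n p theta c mu V W Z t].
Proof.
exists V, W, Z; split; split=> //.
- move=> m.
  have UC : Chalf m U.
    apply: ChalfD; first exact: Chalf_cst.
    apply: ChalfW; apply: Chalf_prim.
    apply: (eq_Chalf _ (Chalf_powR kinv Y_gt0 (Chalf_Y m))) => t t0.
    by rewrite /yy clampE // good_gt0.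
  apply: (eq_Chalf _ (Chalf_powR (2^-1) U_gt0 UC)) => t t0.
  by rewrite powR12_sqrt // ltW // U_gt0.
- by move=> t t0; rewrite V_gt0 // W_gt0.
- by move=> t t0; rewrite prof_S_P // P_prof_P // mulr_gt0 ?V_gt0 // subr_gt0 P_lt1 // good_gt0.
- by move=> t t0; rewrite /prof_F P_prof_P //; have := good_gt0 t0; rewrite goodE => /and4P[].
- by move=> t t0; split; [exact: DV|apply: DW => //; apply: good_gt0; exact: ltW].
- by move=> t t0; apply: ode => //; apply: good_gt0; exact: ltW.
Qed.

End Solution.

Theorem profile_exists : exists V W Z : R -> R,
  [/\ forall m, Chalf m V, cont0 W, cont0 Z, V 0 = b & W 0 = w0] /\
  [/\ forall t, 0 <= t -> 0 < V t /\ 0 < W t,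
      forall t, 0 <= t -> 0 < prof_S V W t,
      forall t, 0 <= t -> 0 < prof_F theta c V W t,
      forall t : R, 0 < t -> is_derive t (1 : R) V (W t) /\ is_derive t (1 : R) W (Z t)
    & forall t, 0 < t -> profile_ode n p theta c mu V W Z t].
Proof. by have [Y cY YE] := truncated_solution; exact: solution_profile cY YE. Qed.

End Existence.

(** * Conformally flat metrics *)

Section Partial.
Context {R : realType} {n : nat}.
Implicit Types (f g : 'rV[R]_n -> R) (x y : 'rV[R]_n) (i j : 'I_n).

Definition pder i f x d := is_derive x (delta_mx 0 i : 'rV[R]_n) (f : 'rV[R]_n -> R^o) d.

Lemma pderE i f x d : pder i f x d -> partial i f x = d.
Proof. by move=> [_ <-]. Qed.

(** Restriction to a line transfers the one-variable product and chain rules to [pder]. *)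
Lemma is_derive_line f x (v : 'rV[R]_n) d : is_derive x v (f : 'rV[R]_n -> R^o) d <->
  is_derive (0 : R) (1 : R) (fun h : R => f (h *: v + x)) d.
Proof.
have e : (fun h : R => h^-1 *: (((f : 'rV[R]_n -> R^o) \o shift x) (h *: v) - f x)) =
  (fun h : R => h^-1 *: (((fun h : R => f (h *: v + x) : R^o) \o shift 0) (h *: (1 : R)) - (fun h : R => f (h *: v + x) : R^o) 0)).
  by apply/funext => h /=; rewrite addr0 scale0r add0r [_%:A]mulr1.
split=> -[fd <-].
  have fd' : derivable (fun h : R => f (h *: v + x) : R^o) 0 1.
    by move: fd; rewrite /derivable e.
  by apply: DeriveDef => //; rewrite /derive e.
have fd' : derivable (f : 'rV[R]_n -> R^o) x v by move: fd; rewrite /derivable e.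
by apply: DeriveDef => //; rewrite /derive e.
Qed.

Lemma pder_cst i x (a : R) : pder i (fun=> a) x 0.
Proof. exact: is_derive_cst. Qed.

Lemma pderD i f g x a b : pder i f x a -> pder i g x b ->
  pder i (fun y => f y + g y) x (a + b).
Proof. by move=> fa gb; exact: is_deriveD. Qed.

Lemma pderN i f x a : pder i f x a -> pder i (fun y => - f y) x (- a).
Proof. by move=> fa; exact: is_deriveN. Qed.

Lemma pderM i f g x a b : pder i f x a -> pder i g x b ->
  pder i (fun y => f y * g y) x (a * g x + f x * b).
Proof.
move=> /is_derive_line fa /is_derive_line gb; apply/is_derive_line.
by apply: (der_eq (derM fa gb)); rewrite scale0r add0r.
Qed.

Lemma pder_comp i (F : R -> R) f x a b : pder i f x a -> is_derive (f x) (1 : R) F b ->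
  pder i (fun y => F (f y)) x (b * a).
Proof.
move=> /is_derive_line fa Fb; apply/is_derive_line.
by apply: der_comp => //; rewrite scale0r add0r.
Qed.

Lemma pder_eq i f x a b : pder i f x a -> a = b -> pder i f x b.
Proof. by move=> + <-. Qed.

Lemma pder_coord i j x : pder i (fun y => y 0 j) x (i == j)%:R.
Proof.
apply/is_derive_line; rewrite (_ : (fun h => _) = fun h : R => h * (i == j)%:R + x 0 j).
  apply: (der_eq (derD (derM (der_id 0) (der_cst 0 (i == j)%:R)) (der_cst 0 (x 0 j)))).
  by rewrite mul1r mulr0 !addr0.
by apply/funext => h; rewrite !mxE eqxx /= eq_sym.
Qed.

Lemma pder_diff i f x : differentiable (f : 'rV[R]_n -> R^o) x -> pder i f x (partial i f x).
Proof. by move=> fx; apply/derivableP/diff_derivable. Qed.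

End Partial.

Section Conformal.
Context {R : realType} {n : nat}.
Hypothesis n3 : (3 <= n)%N.
Implicit Types (x y : 'rV[R]_n) (i j l m : 'I_n).
Variables (v : 'rV[R]_n -> R) (p : 'I_n -> 'rV[R]_n -> R).
Hypothesis v0 : forall y, 0 < v y.
Hypothesis Dv : forall i y, pder i v y (p i y).

Let g y : 'M[R]_n := (v y ^- 2)%:M.
Let d i j : R := (i == j)%:R.

Let vn0 y : v y != 0. Proof. by rewrite gt_eqF. Qed.

Lemma sum_delta j (F : 'I_n -> R) : \sum_i d i j * F i = F j.
Proof.
rewrite (bigD1 j) //= /d eqxx mul1r big1 ?addr0 // => i /negbTE ->.
by rewrite mul0r.
Qed.

Let dC i j : d i j = d j i. Proof. by rewrite /d eq_sym. Qed.

Let invg y : invmx (g y) = (v y ^+ 2)%:M.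
Proof. by rewrite /g invmx_scalar invrK. Qed.

Lemma christoffel_conformal l i j y : christoffel g l i j y =
  - ((v y)^-1 * (d l j * p i y + d l i * p j y - d i j * p l y)).
Proof.
have pg a b c : partial a (metric_comp g b c) y = d b c * (- 2 * v y ^- 3 * p a y).
  apply: pderE; rewrite (_ : metric_comp g b c = fun z => (v z ^- 2) * d b c); last first.
    by apply/funext => z; rewrite /metric_comp /g mxE mulr_natr.
  have v2 : v y ^+ 2 != 0 by rewrite expf_neq0.
  have D2 := @derV _ (fun s => s ^+ 2) _ _ v2 (derX 2 (der_id (v y))).
  apply: (pder_eq (pderM (pder_comp (Dv a y) D2) (pder_cst a y (d b c)))).
  by rewrite /=; field.
rewrite /christoffel invg.
rewrite (eq_bigr (fun m => d m l * (v y ^+ 2 * (d j m * (- 2 * v y ^- 3 * p i y) +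
    d i m * (- 2 * v y ^- 3 * p j y) - d i j * (- 2 * v y ^- 3 * p m y))))); last first.
  by move=> m _; rewrite !pg mxE -[_ *+ (l == m)]mulr_natr [d m l]dC /d; ring.
rewrite sum_delta (dC l j) (dC l i); field.
exact: vn0.
Qed.

Variables (x : 'rV[R]_n) (h : 'M[R]_n).
Hypothesis Dp : forall i j, pder i (p j) x (h i j).
Hypothesis hC : forall i j, h i j = h j i.

Let w i := p i x / v x.
Let W2 := \sum_i w i ^+ 2.
Let lap := \sum_i h i i.
Let G l i j : R := - (d l j * w i + d l i * w j - d i j * w l).

Let chrE l i j : christoffel g l i j x = G l i j.
Proof. by rewrite christoffel_conformal /G /w; field. Qed.

Let dG a l i j : R := - (d l j * (h a i / v x) + d l i * (h a j / v x) - d i j * (h a l / v x))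
   + w a * (d l j * w i + d l i * w j - d i j * w l).

Let pchr a l i j : partial a (christoffel g l i j) x = dG a l i j.
Proof.
apply: pderE; rewrite (_ : christoffel g l i j =
  fun y => - ((v y)^-1 * (d l j * p i y + d l i * p j y - d i j * p l y))); last first.
  by apply/funext => y; exact: christoffel_conformal.
have D1 := @derV _ (fun s => s) _ _ (vn0 x) (der_id (v x)).
apply: (pder_eq (pderN (pderM (pder_comp (Dv a x) D1)
  (pderD (pderD (pderM (pder_cst a x (d l j)) (Dp a i)) (pderM (pder_cst a x (d l i)) (Dp a j)))
     (pderN (pderM (pder_cst a x (d i j)) (Dp a l))))))).
by rewrite /dG /w; field.
Qed.

Let sum_cst (c : R) : \sum_(i < n) c = n%:R * c.
Proof. by rewrite sumr_const card_ord mulr_natl. Qed.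

Let Gtr q : \sum_i G i i q = - (n%:R * w q).
Proof.
rewrite (eq_bigr (fun i => d i q * 0 + - w q)); last first.
  by move=> i _; rewrite /G /d eqxx /=; ring.
by rewrite big_split /= sum_delta sum_cst; ring.
Qed.

Let quad1 j m : \sum_q G q j m * w q = - (2 * w j * w m - d j m * W2).
Proof.
rewrite (eq_bigr (fun q => d q m * (- (w j * w q)) + (d q j * (- (w m * w q)) + d j m * w q ^+ 2))); last first.
  by move=> q _; rewrite /G; ring.
by rewrite !big_split /= !sum_delta -mulr_sumr -/W2; ring.
Qed.

Let quad2 j m : \sum_i \sum_q G i j q * G q i m = n.+2%:R * w j * w m - 2 * d j m * W2.
Proof.
have inner i : \sum_q G i j q * G q i m =
  w j * w m + d i j * (w i * w m) + d i m * (w i * w j) - d j m * w i ^+ 2 - d i j * (d i m * W2).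
  have idem q : d q i * d q i - d q i = 0.
    by rewrite /d; case: eqP => _; rewrite ?mulr1 ?mulr0 subrr.
  rewrite (eq_bigr (fun q =>
       d q i * (w j * d q m * w i + w j * w m - w j * d i m * w q + d i j * w q * w m)
     + (d q m * (d i j * w q * w i)
     + (d q j * (- (w i * d q m * w i) - w i * d q i * w m + w i * d i m * w q)
     + - (d i j * d i m) * w q ^+ 2)))); last first.
    (* Idempotence of a delta is beyond [ring]: the two sides differ by w_j w_m (d_qi^2 - d_qi),
       which [idem] annihilates. *)
    move=> q _; rewrite /G [d i q]dC [d j q]dC; apply/eqP; rewrite -subr_eq0; apply/eqP.
    by rewrite -[RHS](mul0r (w j * w m)) -(idem q); ring.
  by rewrite !big_split /= !sum_delta -mulr_sumr -/W2 (dC j i); ring.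
rewrite (eq_bigr _ (fun i _ => inner i)) !big_split /= !sumrN sum_cst.
rewrite !sum_delta -mulr_sumr -/W2 (dC j m) -[n.+2]addn2 natrD; ring.
Qed.

(** The conformal change of the Ricci tensor over a flat background. The summands are rearranged by
    hand so that every contraction with a delta has the form handled by [sum_delta]. *)
Let ricciE m j : ricci g x m j = (n%:R - 2) / v x * h m j +
  d m j * (lap / v x - (n%:R - 1) * W2).
Proof.
rewrite /ricci mxE /riemann big_split /= sumrB.
rewrite (eq_bigr (fun i => d i m * (- (h i j / v x) + w i * w j) +
    (d i j * (- (h i m / v x) + w i * w m) +
    (d j m * (h i i / v x) + - d j m * w i ^+ 2)))); last first.
  by move=> i _; rewrite pchr /dG; ring.
rewrite !big_split /= !sum_delta -!mulr_sumr -mulr_suml -/lap -/W2.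
rewrite (eq_bigr (fun i => d i m * 0 + (- (h j m / v x) + w j * w m))); last first.
  by move=> i _; rewrite pchr /dG /d eqxx /=; ring.
rewrite big_split /= sum_delta sum_cst.
under eq_bigr => i _ do under eq_bigr => q _ do rewrite !chrE.
under eq_bigr => i _ do rewrite sumrB.
rewrite sumrB quad2 exchange_big /=.
under eq_bigr => q _ do rewrite -mulr_suml Gtr.
rewrite (eq_bigr (fun q => - n%:R * (G q j m * w q))); last by move=> q _; ring.
rewrite -mulr_sumr quad1 (hC j m) (dC j m) -[n.+2]addn2 natrD.
by field.
Qed.

(** As u^(2k/(n+2k)) = 1/v, this is v times the matrix on the left of the equation, which therefore
    prescribes sigma_k^(1/k) of the metric. *)
Lemma gschouten_conformal : gschouten g x = v x *: h - ((\sum_i p i x ^+ 2) / 2)%:M.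
Proof.
have n2 : n%:R - 2 != 0 :> R by rewrite subr_eq0 (eqr_nat R n 2) gtn_eqF.
have n1 : n%:R - 1 != 0 :> R by rewrite subr_eq0 (eqr_nat R n 1) gtn_eqF // ltnW.
have W2E : W2 = (\sum_i p i x ^+ 2) / v x ^+ 2.
  by rewrite /W2 mulr_suml; apply: eq_bigr => i _; rewrite expr_div_n.
have RE : scalar_curvature g x =
    v x ^+ 2 * (2 * (n%:R - 1) * lap / v x - n%:R * (n%:R - 1) * W2).
  rewrite /scalar_curvature invg mul_scalar_mx mxtraceZ; congr (_ * _).
  rewrite /mxtrace (eq_bigr (fun i => (n%:R - 2) / v x * h i i + (lap / v x - (n%:R - 1) * W2))).
    by rewrite big_split /= -mulr_sumr -/lap sum_cst; ring.
  by move=> i _; rewrite ricciE /d eqxx mul1r.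
rewrite /gschouten invg mul_scalar_mx /schouten RE W2E.
move: (ricci _ _) ricciE => Rc RcE.
apply/matrixP => i j; rewrite !mxE RcE -/(d i j) W2E -mulr_natr -/(d i j) -[in RHS]mulr_natr -/(d i j).
by field; rewrite vn0 n1 n2.
Qed.

End Conformal.

(** * Smoothness of radial functions *)

Section CdiffTheory.
Context {R : realType} {n : nat}.
Implicit Types (f g : 'rV[R]_n -> R) (x y : 'rV[R]_n) (i j : 'I_n).

Let diff f := forall x, differentiable (f : 'rV[R]_n -> R^o) x.

Lemma Cdiff_continuous m f : Cdiff m f -> continuous (f : 'rV[R]_n -> R^o).
Proof.
case: m => [//|m] [df _] x; exact: differentiable_continuous.
Qed.

Lemma CdiffW m f : Cdiff m.+1 f -> Cdiff m f.
Proof.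
elim: m f => [|m ih] f [df pf]; first exact: (@Cdiff_continuous 1).
by split=> // i; apply: ih.
Qed.

Lemma CdiffS m f (p : 'I_n -> 'rV[R]_n -> R) : diff f ->
  (forall i x, pder i f x (p i x)) -> (forall i, Cdiff m (p i)) -> Cdiff m.+1 f.
Proof.
move=> df fp pm; split=> // i; rewrite (_ : partial i f = p i) //.
by apply/funext => x; exact: pderE.
Qed.

Lemma Cdiff_cst m (a : R) : Cdiff m (fun _ : 'rV[R]_n => a).
Proof.
elim: m a => [|m ih] a; first exact: (@cst_continuous _ _ a).
apply: (@CdiffS _ _ (fun _ _ => 0)); last by move=> _; exact: ih.
  by move=> x; exact: differentiable_cst.
by move=> i x; exact: pder_cst.
Qed.

Lemma Cdiff_coord m i : Cdiff m (fun x : 'rV[R]_n => x 0 i).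
Proof.
have d : diff (fun x => x 0 i) by move=> x; exact: differentiable_coord.
case: m => [|m]; first by move=> x; exact: differentiable_continuous.
apply: (@CdiffS _ _ (fun j _ => (j == i)%:R)) => //.
  by move=> j x; exact: pder_coord.
by move=> j; exact: Cdiff_cst.
Qed.

Lemma CdiffD m f g : Cdiff m f -> Cdiff m g -> Cdiff m (fun x => f x + g x).
Proof.
elim: m f g => [|m ih] f g fm gm.
  by move=> x; exact: (continuousD (fm x) (gm x)).
have [[df pf] [dg pg]] := (fm, gm).
apply: (@CdiffS _ _ (fun i x => partial i f x + partial i g x)) => [x|i x|i].
- exact: (differentiableD (df x) (dg x)).
- by apply: pderD; exact: pder_diff.
- exact: ih (pf i) (pg i).
Qed.

Lemma CdiffM m f g : Cdiff m f -> Cdiff m g -> Cdiff m (fun x => f x * g x).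
Proof.
elim: m f g => [|m ih] f g fm gm.
  by move=> x; exact: (continuousM (fm x) (gm x)).
have [[df pf] [dg pg]] := (fm, gm).
apply: (@CdiffS _ _ (fun i x => partial i f x * g x + f x * partial i g x)) => [x|i x|i].
- exact: (differentiableM (df x) (dg x)).
- by apply: pderM; exact: pder_diff.
- by apply: CdiffD; [exact: ih (pf i) (CdiffW gm)|exact: ih (CdiffW fm) (pg i)].
Qed.

Lemma differentiable_comp1 (F : R -> R) f x d : differentiable (f : 'rV[R]_n -> R^o) x ->
  is_derive (f x) (1 : R) F d -> differentiable ((fun y => F (f y)) : 'rV[R]_n -> R^o) x.
Proof.
move=> fx [dF _]; apply: (@differentiable_comp _ _ _ _ (f : 'rV[R]_n -> R^o) (F : R^o -> R^o)) => //.
exact/derivable1_diffP.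
Qed.

Lemma Cdiff_powR m f (a : R) : (forall x, 0 < f x) -> Cdiff m f ->
  Cdiff m (fun x => f x `^ a).
Proof.
move=> f0; elim: m a => [|m ih] a fm.
  move=> x; apply: (@continuous_comp _ _ _ f (fun s => s `^ a)); first exact: fm.
  by have /(is_derive1_powR a)/der_continuous := f0 x.
have [df pf] := fm.
apply: (@CdiffS _ _ (fun i x => a * f x `^ (a - 1) * partial i f x)) => [x|i x|i].
- exact: (@differentiable_comp1 (fun s => s `^ a) _ _ _ (df x) (is_derive1_powR a (f0 x))).
- exact: (@pder_comp _ _ _ (fun s => s `^ a) _ _ _ _ (pder_diff i (df x))
    (is_derive1_powR a (f0 x))).
- apply: CdiffM; last exact: (pf i).
  by apply: CdiffM; [exact: Cdiff_cst|exact: ih (CdiffW fm)].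
Qed.

Lemma dot_ge0 x : 0 <= dot x x.
Proof. by apply: sumr_ge0 => i _; rewrite -expr2 sqr_ge0. Qed.

Lemma dot_gt0 x : x != 0 -> 0 < dot x x.
Proof.
move=> x0; rewrite lt_neqAle dot_ge0 andbT eq_sym; apply: contra x0.
rewrite psumr_eq0; last by move=> i _; rewrite -expr2 sqr_ge0.
move=> /allP h; apply/eqP/rowP => i; rewrite mxE.
by have := h i (mem_index_enum i); rewrite /= -expr2 sqrf_eq0 => /eqP.
Qed.

Lemma dot0 : dot (0 : 'rV[R]_n) 0 = 0.
Proof. by rewrite /dot big1 // => i _; rewrite mxE mul0r. Qed.

Lemma enorm2 x : enorm x ^+ 2 = dot x x.
Proof. by rewrite sqr_sqrtr // dot_ge0. Qed.

Lemma Cdiff_dot m : Cdiff m (fun x : 'rV[R]_n => dot x x).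
Proof.
rewrite /dot; elim: (index_enum _) => [|i r ih].
  rewrite (_ : (fun x => _) = fun=> 0); first exact: Cdiff_cst.
  by apply/funext => x; rewrite big_nil.
rewrite (_ : (fun x => _) = fun x => x 0 i * x 0 i + \sum_(j <- r) x 0 j * x 0 j).
  by apply: CdiffD => //; apply: CdiffM; exact: Cdiff_coord.
by apply/funext => x; rewrite big_cons.
Qed.

Lemma pder_dot i x : pder i (fun y => dot y y) x (2 * x 0 i).
Proof.
apply/is_derive_line.
pose F (h : R) := dot x x + 2 * x 0 i * h + h * h.
rewrite (_ : (fun h => _) = F).
  apply: (der_eq (derD (derD (der_cst 0 (dot x x)) (derM (der_cst 0 (2 * x 0 i)) (der_id 0)))
    (derM (der_id 0) (der_id 0)))); ring.
apply/funext => h; rewrite /F /dot.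
rewrite (eq_bigr (fun j => x 0 j * x 0 j + ((j == i)%:R * (2 * x 0 j * h) + (j == i)%:R * (h * h)))).
  by rewrite !big_split /= !sum_delta addrA.
move=> j _; rewrite !mxE eqxx /=.
by case: eqP => [->|_] /=; rewrite ?mulr1 ?mulr0; ring.
Qed.

Section Radial.
Variables f f' : R -> R.
Hypotheses (cf : cont0 f) (cf' : cont0 f')
  (ff' : forall t : R, 0 < t -> is_derive t (1 : R) f (f' t)).

(* f is only known on [0, +oo[; f 0 + prim f' extends it across 0. *)
Let ext t := f 0 + prim f' t.

Let extE t : 0 <= t -> f t = ext t.
Proof.
move=> t0; apply: (@eq_der _ f ext f' 0 t) => //.
- by apply: cont0D; [exact: cont0_cst|exact: prim_cont0].
- by move=> s /andP[s0 _]; exact: ff'.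
- move=> s /andP[s0 _]; rewrite -[X in is_derive _ _ _ X]add0r.
  by apply: (der_eq (derD (der_cst s (f 0)) (prim_derp cf' s0))).
- by rewrite /ext prim0 addr0.
Qed.

Let ext_der x : is_derive (dot x x) (1 : R) ext (f' (dot x x)).
Proof.
have x0 := dot_ge0 x.
apply: (der_eq (derD (der_cst _ (f 0)) (prim_der cf' (lt_le_trans _ x0)))).
  by rewrite ltrN10.
by rewrite add0r ger0_norm.
Qed.

Let fE : (fun x : 'rV[R]_n => f (dot x x)) = fun x => ext (dot x x).
Proof. by apply/funext => x; rewrite extE // dot_ge0. Qed.

Lemma pder_radial i x : pder i (fun y => f (dot y y)) x (2 * x 0 i * f' (dot x x)).
Proof.
rewrite fE; apply: (pder_eq (@pder_comp _ _ _ ext _ _ _ _ (pder_dot i x) (ext_der x))).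
by rewrite mulrC.
Qed.

Lemma differentiable_radial x : differentiable ((fun y => f (dot y y)) : 'rV[R]_n -> R^o) x.
Proof.
by rewrite fE; exact: (@differentiable_comp1 ext _ _ _ ((Cdiff_dot 1).1 x) (ext_der x)).
Qed.

End Radial.

(** A partial derivative of f(|x|^2) is 2 x_i f'(|x|^2), again a coordinate times a radial function,
    so the induction closes. *)
Lemma Cdiff_radial m (f : R -> R) : Chalf m f -> Cdiff m (fun x : 'rV[R]_n => f (dot x x)).
Proof.
elim: m f => [|m ih] f [cf fm].
  move=> x; have -> : (fun x : 'rV[R]_n => f (dot x x)) = fun x => f `|dot x x|.
    by apply/funext => y; rewrite ger0_norm // dot_ge0.
  apply: (@continuous_comp _ _ _ (fun x : 'rV[R]_n => dot x x) (fun t => f `|t|)).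
    exact: (Cdiff_dot 0).
  exact: cf.
case: fm => f' ff' f'm; have cf' := Chalf_cont0 f'm.
apply: (CdiffS (differentiable_radial cf cf' ff') (fun i x => pder_radial cf cf' ff' i x)) => i.
apply: CdiffM; last exact: ih.
by apply: CdiffM; [exact: Cdiff_cst|exact: Cdiff_coord].
Qed.

(** With f = V' this gives the Hessian of V(|x|^2). The derivative at [x] is a hypothesis because,
    for the profile of a given solution, it is only known away from the origin. *)
Lemma pder2_radial (f f' : R -> R) i j x :
  pder i (fun y => f (dot y y)) x (2 * x 0 i * f' (dot x x)) ->
  pder i (fun y => 2 * y 0 j * f (dot y y)) x
    (((2 * f (dot x x))%:M + (4 * f' (dot x x)) *: (x^T *m x)) i j).
Proof.
move=> fx; apply: (pder_eq (pderM (pderM (pder_cst i x 2) (pder_coord i j x)) fx)).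
rewrite !mxE big_ord1 !mxE; case: eqP => [->|_] /=; rewrite ?mulr1n ?mulr0n ?mulr1 ?mulr0; ring.
Qed.

End CdiffTheory.

(** * Elementary symmetric functions of a rank-one perturbation *)

Section RankOne.
Context {R : realType}.

Lemma coef_prod_row n (l : 'rV[R]_n) k : (k <= n)%N ->
  (\prod_(i < n) ('X - (l 0 i)%:P))`_(n - k) =
  (-1) ^+ k * \sum_(I : {set 'I_n} | #|I| == k) \prod_(i in I) l 0 i.
Proof.
move=> kn; under eq_bigr => i _ do rewrite addrC -raddfN/=.
rewrite bigA_distr /= coef_sum.
transitivity (\sum_(I in {set 'I_n}) if #|I| == k then \prod_(i < n | i \in I) - l 0 i else 0).
  apply: eq_bigr => I _.
  rewrite big_if/= big_const iter_mulr_1 -rmorph_prod/= coefCM coefXn.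
  have In : (#|I| <= n)%N by have := max_card I; rewrite card_ord.
  have -> : #|predC (fun i => i \in I)| = (n - #|I|)%N.
    by apply/eqP; rewrite -(eqn_add2l #|I|) cardC card_ord subnKC.
  have -> : (n - k == n - #|I|)%N = (#|I| == k).
    by apply/eqP/eqP => [h|->//]; rewrite -(subKn In) -h subKn.
  by case: ifP; rewrite ?mulr1 ?mulr0.
by rewrite -big_mkcond mulr_sumr/=; apply: eq_bigr => I /eqP <-; rewrite prodrN.
Qed.

(** [eigenvals] picks an unspecified ordering of the roots. Elementary symmetric functions are, up
    to sign, coefficients of the characteristic polynomial, so any splitting computes them. *)
Lemma sigma_char_poly n (A : 'M[R]_n) (l : 'rV[R]_n) k : (k <= n)%N ->
  char_poly A = \prod_(i < n) ('X - (l 0 i)%:P) ->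
  sigma k A = \sum_(I : {set 'I_n} | #|I| == k) \prod_(i in I) l 0 i.
Proof.
move=> kn Al; have El : char_poly A = \prod_(i < n) ('X - (eigenvals A 0 i)%:P).
  by have := @xgetPex _ 0 [set l : 'rV[R]_n | char_poly A = \prod_(i < n) ('X - (l 0 i)%:P)]
    (ex_intro _ l Al).
have s0 : (-1) ^+ k != 0 :> R by rewrite signr_eq0.
by apply: (mulfI s0); rewrite /sigma -!coef_prod_row // -El -Al.
Qed.

Lemma char_poly_rank1 n (x : 'rV[R]_n) (a b : R) :
  char_poly (a%:M + b *: (x^T *m x)) * ('X - a%:P) =
  ('X - (a + b * dot x x)%:P) * ('X - a%:P) ^+ n.
Proof.
pose X := map_mx (@polyC R) x; pose q : {poly R} := 'X - a%:P.
have -> : char_poly (a%:M + b *: (x^T *m x)) = \det (q%:M - b%:P *: (X^T *m X)).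
  rewrite /char_poly /char_poly_mx; congr (\det _).
  rewrite map_mxD map_scalar_mx map_mxZ map_mxM map_trmx /= opprD addrA.
  by rewrite /q raddfB.
have XX : X *m X^T = (dot x x)%:P%:M.
  apply/matrixP => i j; rewrite !ord1 !mxE /= mulr1n /dot rmorph_sum /=.
  by apply: eq_bigr => m _; rewrite !mxE -rmorphM.
(* Two factorisations of the bordered matrix [[q, q X], [b X^T, q I]]. *)
transitivity (\det (block_mx q%:M (q *: X) (b%:P *: X^T) q%:M : 'M[{poly R}]_(1 + n))).
  transitivity (\det (block_mx q%:M 0 (b%:P *: X^T) (q%:M - b%:P *: (X^T *m X)) *m
     block_mx 1%:M X 0 1%:M : 'M[{poly R}]_(1 + n))).
    by rewrite det_mulmx det_lblock det_ublock !det1 !mulr1 det_scalar1 mulrC.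
  congr (\det _); rewrite mulmx_block !mulmx1 !mulmx0 ?mul0mx !addr0 ?mul_scalar_mx.
  by rewrite -scalemxAl addrC subrK.
transitivity (\det (block_mx 1%:M X 0 1%:M *m
   block_mx (q - b%:P * (dot x x)%:P)%:M 0 (b%:P *: X^T) q%:M : 'M[{poly R}]_(1 + n))).
  congr (\det _); rewrite mulmx_block !mul1mx ?mul0mx ?mulmx0 ?add0r ?addr0 mul_mx_scalar.
  by rewrite -scalemxAr XX scale_scalar_mx -raddfD subrK.
rewrite det_mulmx det_ublock det_lblock !det1 !mul1r det_scalar1 det_scalar.
by congr (_ * _); rewrite /q -addrA -opprD -polyCM -polyCD.
Qed.

Lemma sigma_rank1 n (x : 'rV[R]_n.+1) (a b : R) k : (k <= n)%N ->
  sigma k.+1 (a%:M + b *: (x^T *m x)) =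
  'C(n, k.+1)%:R * a ^+ k.+1 + 'C(n, k)%:R * (a + b * dot x x) * a ^+ k.
Proof.
(* The eigenvalue in the direction of [x] is stored at index [ord0], and the others all equal [a];
   subsets are then sorted by whether they contain [ord0]. *)
move=> kn; pose l : 'rV[R]_n.+1 := \row_i (if i == ord0 then a + b * dot x x else a).
have chl : char_poly (a%:M + b *: (x^T *m x)) = \prod_(i < n.+1) ('X - (l 0 i)%:P).
  have q0 : 'X - a%:P != 0 by rewrite polyXsubC_eq0.
  apply: (mulIf q0).
  rewrite char_poly_rank1 big_ord_recl mxE eqxx exprSr mulrA; congr (_ * _ * _).
  rewrite (eq_bigr (fun=> 'X - a%:P)); last by move=> i _; rewrite mxE.
  by rewrite prodr_const card_ord.
rewrite (sigma_char_poly _ chl) //.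
have prodl (I : {set 'I_n.+1}) : #|I| = k.+1 -> \prod_(i in I) l 0 i =
    if ord0 \in I then (a + b * dot x x) * a ^+ k else a ^+ k.+1.
  move=> cI; case: ifP => I0.
    rewrite (bigD1 ord0) //= mxE eqxx; congr (_ * _).
    rewrite (eq_bigr (fun=> a)); last by move=> i /andP[_ /negbTE i0]; rewrite mxE i0.
    rewrite (eq_bigl (mem (I :\ ord0))); last by move=> i; rewrite !inE andbC.
    by rewrite prodr_const; have := cardsD1 ord0 I; rewrite I0 cI add1n => -[->].
  rewrite (eq_bigr (fun=> a)); last first.
    by move=> i iI; rewrite mxE; case: eqP => // i0; rewrite -i0 iI in I0.
  by rewrite prodr_const cI.
rewrite (eq_bigr _ (fun I cI => prodl I (eqP cI))) (bigID (fun I : {set 'I_n.+1} => ord0 \in I)) /= addrC.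
have c0 : #|[set I : {set 'I_n.+1} | (#|I| == k.+1) && (ord0 \notin I)]%SET| = 'C(n, k.+1).
  rewrite -[n in RHS](_ : #|~: [set @ord0 n]| = n); last by rewrite cardsC1 card_ord.
  rewrite -cards_draws; apply: eq_card => I; rewrite !inE andbC; congr (_ && _); apply/idP/fintype.subsetP => [I0 i iI|h].
    by rewrite !inE; apply: contraNneq I0 => <-.
  by apply/negP => /h; rewrite !inE eqxx.
(* Pascal's rule: the subsets containing [ord0] are what [c0] leaves of all subsets of size
   [k.+1]. *)
have c1 : #|[set I : {set 'I_n.+1} | (#|I| == k.+1) && (ord0 \in I)]%SET| = 'C(n, k).
  apply/eqP; rewrite -(eqn_add2r 'C(n, k.+1)) [X in _ == X]addnC -binS -c0.
  rewrite -[n.+1 in X in _ == X]card_ord -card_draws.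
  apply/eqP; rewrite -[RHS](cardsID [set I : {set 'I_n.+1} | ord0 \in I]%SET).
  congr (_ + _)%N; apply: eq_card => I; rewrite !inE //.
  by rewrite andbC.
congr (_ + _).
  rewrite (eq_bigr (fun=> a ^+ k.+1)); last by move=> I /andP[_ /negbTE ->].
  by rewrite sumr_const -c0 mulr_natl; congr (_ *+ _); apply: eq_card => I; rewrite !inE.
rewrite (eq_bigr (fun=> (a + b * dot x x) * a ^+ k)); last by move=> I /andP[_ ->].
by rewrite sumr_const -c1 -mulrA mulr_natl; congr (_ *+ _); apply: eq_card => I; rewrite !inE.
Qed.

End RankOne.

(** * Radial metrics *)

Section Pointwise.
Context {R : realType}.
Variables (n p : nat) (theta rho : R).
Hypotheses (n3 : (3 <= n.+1)%N) (n2p : (2 * p.+1 <= n.+1)%N).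
Local Notation k := (p.+1).
Let a : R := (2 * k)%:R / (n.+1 + 2 * k)%:R.
Variable u : 'rV[R]_n.+1 -> R.
Hypotheses (su : smooth u) (u0 : forall x, 0 < u x).
Definition vfun (y : 'rV[R]_n.+1) : R := u y `^ (- a).
Local Notation v := vfun.
Local Notation c := (2 * theta + rho).

Lemma vfun_gt0 y : 0 < v y. Proof. by rewrite powR_gt0. Qed.
Let vn0 y : v y != 0. Proof. by rewrite gt_eqF // vfun_gt0. Qed.

Lemma smooth_vfun : smooth v.
Proof. by move=> m; exact: Cdiff_powR. Qed.

Lemma pder_vfun i y : pder i v y (partial i v y).
Proof. by apply: pder_diff; exact: (smooth_vfun 1).1. Qed.

Lemma pder2_vfun i j y : pder i (partial j v) y (hess v y i j).
Proof. by rewrite mxE; apply: pder_diff; exact: ((smooth_vfun 2).2 j).1. Qed.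

Lemma partial_vfun i y : partial i v y = - a * (u y `^ (- a - 1)) * partial i u y.
Proof.
apply: pderE; apply: (@pder_comp _ _ _ (fun s => s `^ (- a))).
  by apply: pder_diff; exact: (su 1).1.
exact: is_derive1_powR.
Qed.

Lemma powR_metric y : u y `^ ((4 * k)%:R / (n.+1 + 2 * k)%:R) = v y ^- 2.
Proof.
rewrite /vfun powRN exprVn invrK -powR_mulrn ?powR_ge0 // -powRrM.
congr (_ `^ _); rewrite /a mulrAC -natrM; congr (_%:R / _).
by rewrite mulnAC.
Qed.

Lemma yamabe_metricE : yamabe_metric k u = fun y => (v y ^- 2)%:M.
Proof. by apply/funext => y; rewrite /yamabe_metric powR_metric. Qed.

Lemma rhs_vfun y :
  u y `^ (a - 1) * (c * u y + (4 * k)%:R * theta / (n.+1 + 2 * k)%:R * dot y (grad u y)) =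
  (v y)^-1 * (c - 2 * theta * dot y (grad v y) / v y).
Proof.
have un0 : u y != 0 by rewrite gt_eqF.
have gE : dot y (grad v y) = - a * u y `^ (- a - 1) * dot y (grad u y).
  rewrite /dot mulr_sumr; apply: eq_bigr => i _; rewrite !mxE partial_vfun; ring.
have e1 : u y `^ (a - 1) = (v y)^-1 / u y.
  by rewrite powRB ?un0 ?implybT // powRr1 ?ltW // /vfun powRN invrK.
have e2 : u y `^ (- a - 1) = v y / u y.
  by rewrite powRB ?un0 ?implybT // powRr1 ?ltW.
have e3 : (4 * k)%:R * theta / (n.+1 + 2 * k)%:R = 2 * a * theta.
  by rewrite /a -[4%N]/(2 * 2)%N -mulnA natrM; ring.
by rewrite gE e1 e2 e3; field; rewrite un0 vn0.
Qed.

Section At.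
Variables (x : 'rV[R]_n.+1) (V W Z : R).
Local Notation t := (dot x x).
Hypotheses (vx : v x = V) (px : forall i, partial i v x = 2 * x 0 i * W)
  (hx : hess v x = (2 * W)%:M + (4 * Z) *: (x^T *m x)).
Let lam := 2 * W * (V - t * W).

Let V0 : 0 < V. Proof. by rewrite -vx vfun_gt0. Qed.
Let Vn0 : V != 0. Proof. by rewrite gt_eqF. Qed.

Let grad2 : \sum_i (partial i v x) ^+ 2 = 4 * t * W ^+ 2.
Proof.
rewrite /dot mulr_sumr mulr_suml; apply: eq_bigr => i _; rewrite px; ring.
Qed.

(** Here [V], [W] and [Z] are numbers, the values at |x|^2 of the profile and its two derivatives.
    The same computation thus serves the constructed profile and the one extracted from a given
    solution. *)
Lemma gschouten_at : gschouten (yamabe_metric k u) x = lam%:M + (4 * V * Z) *: (x^T *m x).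
Proof.
rewrite yamabe_metricE (gschouten_conformal n3 vfun_gt0 pder_vfun (fun i j => pder2_vfun i j x)).
  rewrite vx hx grad2 scalerDr scalerA scale_scalar_mx -addrA [X in _ + X]addrC addrA -raddfB /=.
  by congr (_%:M + _ *: _); rewrite /lam; [field|ring].
move=> i j; rewrite hx !mxE !big_ord1 !mxE eq_sym; ring.
Qed.

Lemma sigma_at j : (j < n.+1)%N -> sigma j.+1 (gschouten (yamabe_metric k u) x) =
  'C(n, j.+1)%:R * lam ^+ j.+1 + 'C(n, j)%:R * (lam + 4 * t * V * Z) * lam ^+ j.
Proof.
move=> jn; rewrite gschouten_at sigma_rank1 //.
by congr (_ + _ * (_ + _) * _); ring.
Qed.

Let binE j : 'C(n, j)%:R = j.+1%:R / n.+1%:R * 'C(n.+1, j.+1)%:R :> R.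
Proof.
have nn0 : n.+1%:R != 0 :> R by rewrite pnatr_eq0.
have : n.+1%:R * 'C(n, j)%:R = j.+1%:R * 'C(n.+1, j.+1)%:R :> R.
  by rewrite -!natrM mul_bin_diag.
by move=> e; apply: (mulfI nn0); rewrite e; field; rewrite addrC natr1.
Qed.

Let binS' j : 'C(n, j.+1)%:R + 'C(n, j)%:R = 'C(n.+1, j.+1)%:R :> R.
Proof. by rewrite -natrD binS. Qed.

(** Pascal's rule merges the coefficients of lam^(j+1). Pulling out the common binomial isolates the
    dependence on j in one bracket, which is how admissibility compares different orders. *)
Lemma sigma_atE j : (j < n.+1)%N -> sigma j.+1 (gschouten (yamabe_metric k u) x) =
  'C(n.+1, j.+1)%:R * (lam ^+ j * (lam + j.+1%:R / n.+1%:R * (4 * t * V * Z))).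
Proof.
move=> jn; rewrite sigma_at //.
have -> : 'C(n, j.+1)%:R * lam ^+ j.+1 + 'C(n, j)%:R * (lam + 4 * t * V * Z) * lam ^+ j =
  ('C(n, j.+1)%:R + 'C(n, j)%:R) * lam ^+ j.+1 + 'C(n, j)%:R * (4 * t * V * Z) * lam ^+ j.
  by rewrite exprS; ring.
by rewrite binS' binE exprS; ring.
Qed.

Let kn : (p < n.+1)%N.
Proof. by apply: leq_trans n2p; rewrite leq_pmull. Qed.

Let W_at : hess v x - (u x `^ a / 2 * enorm (grad v x) ^+ 2)%:M =
  (V^-1 * lam)%:M + (4 * Z) *: (x^T *m x).
Proof.
have -> : u x `^ a = V^-1 by rewrite -vx /vfun powRN invrK.
have -> : enorm (grad v x) ^+ 2 = 4 * t * W ^+ 2.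
  by rewrite enorm2 -grad2; apply: eq_bigr => i _; rewrite mxE expr2.
rewrite hx -addrA [X in _ + X]addrC addrA -raddfB /=.
by congr (_%:M + _); rewrite /lam; field.
Qed.

(** The two matrices differ by the factor V and sigma_k is homogeneous of degree k. Positivity makes
    the powers multiplicative. *)
Lemma sigma_root_at : 0 < sigma k (gschouten (yamabe_metric k u) x) ->
  sigma_root k (hess v x - (u x `^ a / 2 * enorm (grad v x) ^+ 2)%:M) =
  V^-1 * sigma_root k (gschouten (yamabe_metric k u) x).
Proof.
move=> s0; rewrite /sigma_root.
have -> : sigma k (hess v x - (u x `^ a / 2 * enorm (grad v x) ^+ 2)%:M) =
  V^-1 ^+ k * sigma k (gschouten (yamabe_metric k u) x).
  rewrite W_at sigma_rank1 // sigma_at //.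
  by rewrite !exprMn !exprVn [V ^+ k]exprS; field; rewrite expf_neq0 Vn0.
have iV : 0 <= V^-1 by rewrite invr_ge0 ltW.
rewrite powRM ?exprn_ge0 ?(ltW s0) // -powR_mulrn // -powRrM divff ?pnatr_eq0 //.
by rewrite powRr1.
Qed.

Lemma equation_at : 0 < sigma k (gschouten (yamabe_metric k u) x) ->
  (sigma_root k (hess v x - (u x `^ a / 2 * enorm (grad v x) ^+ 2)%:M) =
   u x `^ (a - 1) * (c * u x + (4 * k)%:R * theta / (n.+1 + 2 * k)%:R * dot x (grad u x)))
  <-> sigma_root k (gschouten (yamabe_metric k u) x) = c - 4 * theta * (t * W / V).
Proof.
move=> s0; rewrite sigma_root_at // rhs_vfun vx.
have -> : dot x (grad v x) = 2 * t * W.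
  by rewrite /dot mulr_sumr mulr_suml; apply: eq_bigr => i _; rewrite mxE px; ring.
have -> : 2 * theta * (2 * t * W) / V = 4 * theta * (t * W / V) by ring.
have iV : V^-1 != 0 by rewrite invr_eq0.
by split=> [/(mulfI iV)|->].
Qed.

End At.
End Pointwise.

Section RadialDerivative.
Context {R : realType} {n : nat}.

Lemma enorm_gt0 (x : 'rV[R]_n) : x != 0 -> 0 < enorm x.
Proof. by move=> x0; rewrite sqrtr_gt0 dot_gt0. Qed.

Lemma dot_line (x : 'rV[R]_n) (h : R) : x != 0 ->
  dot (h *: ((enorm x)^-1 *: x) + x) (h *: ((enorm x)^-1 *: x) + x) = (enorm x + h) ^+ 2.
Proof.
move=> x0; have r0 := enorm_gt0 x0.
transitivity ((h / enorm x + 1) ^+ 2 * dot x x).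
  by rewrite /dot mulr_sumr; apply: eq_bigr => i _; rewrite !mxE; ring.
by rewrite -enorm2; field; rewrite gt_eqF.
Qed.

Lemma radial_derivative_radial (f : R -> R) (d : R) (x : 'rV[R]_n) : x != 0 ->
  is_derive (dot x x) (1 : R) f d ->
  radial_derivative (fun y => f (dot y y)) x = 2 * enorm x * d.
Proof.
move=> x0 fd; have r0 := enorm_gt0 x0; rewrite /radial_derivative.
suff H : is_derive x ((enorm x)^-1 *: x) ((fun y => f (dot y y)) : 'rV[R]_n -> R^o)
    (2 * enorm x * d) by case: H.
apply/is_derive_line.
rewrite (_ : (fun h => _) = fun h => f ((enorm x + h) ^+ 2)); last first.
  by apply/funext => h; rewrite dot_line.
have D2 : is_derive (0 : R) (1 : R) (fun h => (enorm x + h) ^+ 2) (2 * enorm x).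
  apply: (der_eq (derX 2 (derD (der_cst 0 (enorm x)) (der_id 0)))).
  by rewrite /= addr0 add0r mulr1.
have fd' : is_derive ((enorm x + 0) ^+ 2) (1 : R) f d by rewrite addr0 enorm2.
apply: (der_eq (@der_comp _ f (fun h => (enorm x + h) ^+ 2) 0 _ _ D2 fd')).
by rewrite mulrC.
Qed.

End RadialDerivative.

(** * From a profile to a soliton *)

Section Sufficiency.
Context {R : realType}.
Variables (n p : nat) (theta rho alpha : R).
Hypotheses (n3 : (3 <= n.+1)%N) (n2p : (2 * p.+1 <= n.+1)%N).
Hypotheses (alpha0 : 0 < alpha) (theta0 : 0 < theta) (c0 : 0 < 2 * theta + rho).
Local Notation k := (p.+1).
Local Notation c := (2 * theta + rho).
Let a : R := (2 * k)%:R / (n.+1 + 2 * k)%:R.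
Let b : R := alpha `^ (- a).
Let B : R := 'C(n.+1, k)%:R.
Let mu : R := B^-1 `^ (k%:R^-1).
(** At t = 0 the equation reads lam = mu c with lam = 2 V(0) V'(0), which forces this slope. *)
Let w0 : R := mu * (c / 2) / b.
Let t1 : R := c / 2 / (4 * theta) * b / w0.

Let kn : (k <= n.+1)%N.
Proof. by apply: leq_trans n2p; rewrite leq_pmull. Qed.
Let a0 : 0 < a. Proof. by rewrite divr_gt0 // ltr0n. Qed.
Let b0 : 0 < b. Proof. exact: powR_gt0. Qed.
Let B0 : 0 < B. Proof. by rewrite ltr0n bin_gt0. Qed.
Let mu0 : 0 < mu. Proof. by rewrite powR_gt0 // invr_gt0. Qed.
Let muk : mu ^+ k = B^-1.
Proof.
rewrite -powR_mulrn ?powR_ge0 // -powRrM mulVf ?pnatr_eq0 // powRr1 //.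
by rewrite invr_ge0 ltW.
Qed.
Let c20 : 0 < c / 2. Proof. exact: divr_gt0. Qed.
Let w00 : 0 < w0. Proof. by apply: divr_gt0 => //; exact: mulr_gt0. Qed.
Let w0E : b * w0 = mu * (c / 2). Proof. by rewrite /w0; field; rewrite gt_eqF. Qed.
Let t10 : 0 < t1.
Proof. by apply: divr_gt0 => //; apply: mulr_gt0 => //; apply: divr_gt0 => //; exact: mulr_gt0. Qed.
Let t1E : 4 * theta * (t1 * w0 / b) = c / 2.
Proof. by rewrite /t1; field; rewrite !gt_eqF. Qed.

Section Solution.
Variables V W Z : R -> R.
Hypotheses (sV : forall m, Chalf m V) (cW : cont0 W) (cZ : cont0 Z) (V0 : V 0 = b) (W0 : W 0 = w0).
Hypotheses (VW_gt0 : forall t, 0 <= t -> 0 < V t /\ 0 < W t)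
  (S_gt0 : forall t, 0 <= t -> 0 < prof_S V W t)
  (F_gt0 : forall t, 0 <= t -> 0 < prof_F theta c V W t)
  (DVW : forall t : R, 0 < t -> is_derive t (1 : R) V (W t) /\ is_derive t (1 : R) W (Z t))
  (ode : forall t, 0 < t -> profile_ode n.+1 p theta c mu V W Z t).
Implicit Types x y : 'rV[R]_n.+1.

Let V_gt0 t : 0 <= t -> 0 < V t. Proof. by case/VW_gt0. Qed.
Let W_gt0 t : 0 <= t -> 0 < W t. Proof. by case/VW_gt0. Qed.
Let cV : cont0 V. Proof. exact: Chalf_cont0 (sV 0). Qed.
Let DV (t : R) : 0 < t -> is_derive t (1 : R) V (W t). Proof. by case/DVW. Qed.
Let DW (t : R) : 0 < t -> is_derive t (1 : R) W (Z t). Proof. by case/DVW. Qed.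
Let q x := dot x x.

Definition usol x : R := V (q x) `^ (- a^-1).
Local Notation u := usol.

Lemma smooth_usol : smooth u.
Proof.
move=> m; apply: Cdiff_powR => [x|]; last exact: Cdiff_radial.
by apply: V_gt0; exact: dot_ge0.
Qed.

Lemma usol_gt0 x : 0 < u x.
Proof. by rewrite powR_gt0 // V_gt0 // dot_ge0. Qed.

Lemma radial_usol : radial u.
Proof. by move=> x y xy; rewrite /usol /q -!enorm2 xy. Qed.

Lemma usol0 : u 0 = alpha.
Proof.
rewrite /usol /q dot0 V0 /b -powRrM mulrNN mulfV ?gt_eqF // powRr1 //.
exact: ltW.
Qed.

Let vE : vfun p u = fun x => V (q x).
Proof.
apply/funext => x; rewrite /vfun -/a /usol -powRrM mulrNN mulVf ?gt_eqF // powRr1 //.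
by rewrite ltW // V_gt0 // dot_ge0.
Qed.

Let px x i : partial i (vfun p u) x = 2 * x 0 i * W (q x).
Proof. by rewrite vE; apply: pderE; exact: pder_radial. Qed.

Let hx x : hess (vfun p u) x = (2 * W (q x))%:M + (4 * Z (q x)) *: (x^T *m x).
Proof.
apply/matrixP => i j; rewrite mxE; apply: pderE.
rewrite (_ : partial j _ = fun y => 2 * y 0 j * W (q y)); last first.
  by apply/funext => y; exact: px.
by apply: pder2_radial; exact: pder_radial.
Qed.

Let ode' t : 0 <= t -> prof_lam V W t ^+ p * (prof_lam V W t + k%:R / n.+1%:R * (4 * t * V t * Z t))
   = (mu * prof_F theta c V W t) ^+ k.
Proof.
move=> t0; have [<-|tn0] := eqVneq 0 t; last by apply: ode; rewrite lt_neqAle tn0.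
rewrite mulr0 !mul0r mulr0 addr0 -exprSr; congr (_ ^+ _).
rewrite /prof_lam /prof_F /prof_S /prof_P V0 W0 !mul0r !subr0 mulr0 subr0.
by rewrite -mulrA [w0 * b]mulrC w0E; field.
Qed.

Let lam_gt0 t : 0 <= t -> 0 < prof_lam V W t.
Proof. by move=> t0; rewrite !mulr_gt0 ?W_gt0 ?S_gt0. Qed.

Let sigma_k x : sigma k (gschouten (yamabe_metric k u) x) = prof_F theta c V W (q x) ^+ k.
Proof.
have x0 := dot_ge0 x.
have vx : vfun p u x = V (q x) by rewrite vE.
rewrite (sigma_atE n3 smooth_usol usol_gt0 vx (px x) (hx x)); last exact: kn.
have := ode' x0; rewrite -/(q x) /prof_lam /prof_S => ->.
by rewrite exprMn muk mulrA divff ?mul1r // gt_eqF.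
Qed.

Let root_k x : sigma_root k (gschouten (yamabe_metric k u) x) = prof_F theta c V W (q x).
Proof.
have F0 := ltW (F_gt0 (dot_ge0 x)).
by rewrite /sigma_root sigma_k -powR_mulrn // -powRrM divff ?pnatr_eq0 // powRr1.
Qed.

Lemma usol_equation : kyamabe_equation k theta rho u.
Proof.
move=> x; have vx : vfun p u x = V (q x) by rewrite vE.
apply/(equation_at theta rho n3 n2p smooth_usol usol_gt0 vx (px x) (hx x)).
  by rewrite sigma_k exprn_gt0 // F_gt0 // dot_ge0.
by rewrite root_k.
Qed.

Lemma usol_admissible : admissible k u.
Proof.
move=> x [//|j] /= jk; have x0 := dot_ge0 x.
have vx : vfun p u x = V (q x) by rewrite vE.
have jn : (j < n.+1)%N by exact: leq_trans jk kn.
rewrite (sigma_atE n3 smooth_usol usol_gt0 vx (px x) (hx x)) //.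
have l0 := lam_gt0 x0; have F0 := F_gt0 x0.
apply: mulr_gt0; first by rewrite ltr0n bin_gt0.
apply: mulr_gt0; first exact: exprn_gt0.
have h : 0 < prof_lam V W (q x) + k%:R / n.+1%:R * (4 * q x * V (q x) * Z (q x)).
  by rewrite -(pmulr_rgt0 _ (exprn_gt0 p l0)) ode' // exprn_gt0 // mulr_gt0.
(* Multiplied by k / (j + 1), the bracket of order j + 1 is a nonnegative multiple of lam plus the
   bracket of order k, which the equation makes positive. *)
rewrite -/(prof_S V W (q x)) -/(prof_lam V W (q x)) -/(q x) -(pmulr_rgt0 _ (_ : 0 < k%:R / j.+1%:R :> R)) ?divr_gt0 ?ltr0n //.
have -> : k%:R / j.+1%:R * (prof_lam V W (q x) + j.+1%:R / n.+1%:R * (4 * q x * V (q x) * Z (q x)))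
  = (k%:R / j.+1%:R - 1) * prof_lam V W (q x)
  + (prof_lam V W (q x) + k%:R / n.+1%:R * (4 * q x * V (q x) * Z (q x))).
  by field; rewrite !(addrC 1) !natr1 !pnatr_eq0.
apply: ltr_wpDl => //; apply: mulr_ge0; last exact: ltW.
by rewrite subr_ge0 ler_pdivlMr ?ltr0n // mul1r ler_nat.
Qed.

(** For a potential phi(|x|^2) one has r phi_r = 2 t phi'(t), so the prescribed radial derivative
    means phi' = theta / V^2. *)
Let dphi t := theta * ((V t)^-1 ^+ 2).
Let ddphi t := - 2 * theta * W t * (V t)^-1 ^+ 3.
Let phi := prim dphi.

Let Cdphi m : Chalf m dphi.
Proof. by apply: ChalfM; [exact: Chalf_cst|apply: ChalfX; exact: ChalfV]. Qed.

Let cdphi : cont0 dphi. Proof. exact: Chalf_cont0 (Cdphi 0). Qed.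

Let cddphi : cont0 ddphi.
Proof.
apply: cont0M; first by apply: cont0M => //; exact: cont0_cst.
by apply/cont0X/cont0V => // t t0; rewrite gt_eqF // V_gt0.
Qed.

Let Ddphi (t : R) : 0 < t -> is_derive t (1 : R) dphi (ddphi t).
Proof.
move=> t0; have v0 := V_gt0 (ltW t0).
have vn0 : V t != 0 by rewrite gt_eqF.
apply: (der_eq (derM (der_cst t theta) (derX 2 (derV vn0 (DV t0))))).
by rewrite /ddphi /=; field.
Qed.

Lemma usol_nontrivial : nontrivial k theta rho u.
Proof.
have Dphi (t : R) : 0 < t -> is_derive t (1 : R) phi (dphi t) by exact: prim_derp.
have cphi := prim_cont0 cdphi.
have pphi i x : partial i (fun y => phi (q y)) x = 2 * x 0 i * dphi (q x).
  by apply: pderE; exact: pder_radial.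
exists (fun x => phi (q x)); last first.
  move=> [d phid]; pose e : 'rV[R]_n.+1 := delta_mx 0 0.
  have e0 : 0 < dot e e.
    apply: dot_gt0; apply/eqP => /rowP /(_ 0); rewrite !mxE !eqxx /= => /eqP.
    by rewrite oner_eq0.
  have : phi 0 < phi (dot e e).
    have [s [s0 se]] := cont0_low cdphi (ltW e0) (fun t t0 => mulr_gt0 theta0 (exprn_gt0 2 (etrans (invr_gt0 (V t)) (V_gt0 t0)))).
    have := @le_der _ (fun t => s * t) phi (fun=> s) dphi 0 (dot e e).
    move=> H; apply: (@lt_le_trans _ _ (s * dot e e)).
      by rewrite /phi prim0 mulr_gt0.
    apply: H => //.
    - by apply: cont0M; [exact: cont0_cst|exact: cont0_id].
    - exact: ltW.
    - by move=> t _; apply: (der_eq (derM (der_cst t s) (der_id t))); rewrite mul0r add0r mulr1.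
    - by move=> t /andP[t0 _]; exact: Dphi.
    - by move=> t /andP[t0 te]; apply: se; rewrite (ltW t0) ltW.
    - by rewrite mulr0 /phi prim0.
  by have := phid e; have := phid 0; rewrite /q dot0 => -> ->; rewrite ltxx.
split.
- by move=> m; apply: Cdiff_radial; apply: ChalfW; exact: Chalf_prim.
- by move=> x y xy; rewrite /q -!enorm2 xy.
(* In the covariant Hessian the terms in x_i x_j cancel, since 4 phi'' + 8 phi' V' / V = 0 for phi'
   = theta / V^2; the diagonal leaves 2 theta (1 - 2 P) / V^2 = (F - rho) / V^2. *)
- move=> x; have t0 := dot_ge0 x; have v0 := V_gt0 t0.
  rewrite root_k (yamabe_metricE p usol) vE.
  apply/matrixP => i j; rewrite !mxE.
  rewrite (_ : partial j _ = fun y => 2 * y 0 j * dphi (q y)); last first.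
    by apply/funext => y; exact: pphi.
  have -> : partial i (fun y => 2 * y 0 j * dphi (q y)) x =
      ((2 * dphi (q x))%:M + (4 * ddphi (q x)) *: (x^T *m x)) i j.
    by apply: pderE; apply: pder2_radial; exact: pder_radial.
  have cE l : christoffel (fun y => (V (q y) ^- 2)%:M) l i j x =
     - ((V (q x))^-1 * ((l == j)%:R * (2 * x 0 i * W (q x)) +
        (l == i)%:R * (2 * x 0 j * W (q x)) - (i == j)%:R * (2 * x 0 l * W (q x)))).
    rewrite (@christoffel_conformal _ _ (fun y => V (q y)) (fun i y => 2 * y 0 i * W (q y))) //.
      by move=> y; apply: V_gt0; exact: dot_ge0.
    by move=> m y; exact: pder_radial.
  rewrite (eq_bigr (fun l => (l == j)%:R * (- (V (q x))^-1 * (2 * x 0 i * W (q x)) * (2 * x 0 l * dphi (q x)))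
    + ((l == i)%:R * (- (V (q x))^-1 * (2 * x 0 j * W (q x)) * (2 * x 0 l * dphi (q x)))
    + (4 * (i == j)%:R * W (q x) * dphi (q x) / V (q x)) * (x 0 l * x 0 l)))); last first.
    by move=> l _; rewrite cE pphi; ring.
  rewrite !big_split /= !sum_delta -mulr_sumr -/(dot x x) -/(q x).
  rewrite !mxE big_ord1 !mxE -[_ *+ (i == j)]mulr_natr -[in RHS](mulr_natr (2 * _)).
  rewrite /dphi /ddphi /prof_F /prof_P; field.
  by rewrite gt_eqF.
move=> x; rewrite (powR_metric p) vE.
have [->|x0] := eqVneq x 0.
  by rewrite /enorm dot0 sqrtr0 expr0n /= mul0r mulr0 mul0r.
have t0 := dot_gt0 x0.
rewrite (radial_derivative_radial x0 (Dphi _ t0)) /dphi -/(q x) exprVn.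
by ring.
Qed.

End Solution.

Theorem sufficiency : exists u : 'rV[R]_n.+1 -> R,
     [/\ smooth u, (forall x, 0 < u x), radial u & u 0 = alpha] /\
     [/\ kyamabe_equation k theta rho u, admissible k u
       & nontrivial k theta rho u].
Proof.
have [V [W [Z [[sV cW cZ V0 W0] [VW S0 F0 DVW ode]]]]] :=
  profile_exists n2p theta0 c0 mu0 b0 w00 w0E t10 t1E.
exists (usol V); split; split.
- exact: smooth_usol sV VW.
- exact: usol_gt0 VW.
- exact: radial_usol.
- exact: usol0 V0.
- exact: usol_equation sV cW cZ V0 W0 VW F0 DVW ode.
- exact: usol_admissible sV cW cZ V0 W0 VW S0 F0 DVW ode.
- exact: usol_nontrivial sV cW cZ V0 W0 VW F0 DVW ode.
Qed.

End Sufficiency.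

(** * Nonexistence for negative theta *)

Section Decay.
Context {R : realType}.

(* Such an f loses at least e / 2 on every dyadic interval. *)
Lemma pos_slow_decay (f df : R -> R) (t0 e : R) : 0 < t0 -> 0 < e ->
  (forall t : R, t0 <= t -> is_derive t (1 : R) f (df t)) ->
  (forall t, t0 <= t -> df t <= - (e / t)) ->
  ~ (forall t, t0 <= t -> 0 <= f t).
Proof.
move=> t00 e0 Df dfe f0.
have step t : t0 <= t -> f (2 * t) <= f t - e / 2.
  move=> tt; have tp := lt_le_trans t00 tt; have tn : t != 0 by rewrite gt_eqF.
  have -> : f t - e / 2 = f t + - (e / (2 * t)) * (2 * t - t) by field.
  apply: (@le_derc _ f (fun s => f t + - (e / (2 * t)) * (s - t)) df (fun=> - (e / (2 * t))) t).
  - by rewrite ler_peMl ?ler1n // ltW.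
  - by move=> s /andP[ts _]; apply: Df; exact: le_trans ts.
  - move=> s _; apply: (der_eq (derD (der_cst s (f t)) (derM (der_cst s (- (e / (2 * t))))
      (derD (der_id s) (der_cst s (- t)))))); ring.
  - move=> s /andP[ts st]; apply: (le_trans (dfe s (le_trans tt ts))).
    rewrite lerN2 ler_wpM2l ?(ltW e0) // lef_pV2 ?posrE ?mulr_gt0 //.
    exact: lt_le_trans ts.
  - by rewrite subrr mulr0 addr0.
have iter m : f (2 ^+ m * t0) <= f t0 - m%:R * (e / 2).
  elim: m => [|m ih]; first by rewrite mul1r mul0r subr0.
  have tm : t0 <= 2 ^+ m * t0 by rewrite ler_peMl ?(ltW t00) // exprn_ege1 // ler1n.
  rewrite exprS -mulrA; apply: (le_trans (step _ tm)).
  by rewrite -[m.+1%:R]natr1 mulrDl mul1r opprD addrA lerD2r.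
pose m := (Num.truncn (f t0 / (e / 2))).+1.
have := iter m; have e2 : 0 < e / 2 by rewrite divr_gt0.
have : f t0 / (e / 2) < m%:R by rewrite /m; exact: truncnS_gt.
rewrite ltr_pdivrMr // => h1 h2.
have tm : t0 <= 2 ^+ m * t0 by rewrite ler_peMl ?(ltW t00) // exprn_ege1 // ler1n.
by have := f0 _ tm; lra.
Qed.

End Decay.

Section Nonexistence.
Context {R : realType}.
Variables (n p : nat) (theta c mu : R) (V W Z : R -> R).
Hypotheses (n3 : (3 <= n)%N) (n2p : (2 * p.+1 <= n)%N) (theta0 : theta < 0) (mu0 : 0 < mu).
Hypotheses (cV : cont0 V) (cW : cont0 W) (V_gt0 : forall t, 0 <= t -> 0 < V t).
Local Notation S := (prof_S V W).
Local Notation P := (prof_P V W).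
Local Notation lam := (prof_lam V W).
Local Notation F := (prof_F theta c V W).
Local Notation D := (prof_D p theta c mu V W).
Local Notation G := (prof_G n p theta c mu V W).
Local Notation H := (prof_H V W Z).
Hypotheses (DV : forall t : R, 0 < t -> is_derive t (1 : R) V (W t))
  (DW : forall t : R, 0 < t -> is_derive t (1 : R) W (Z t))
  (ode : forall t, 0 < t -> profile_ode n p theta c mu V W Z t)
  (F_gt0 : forall t, 0 <= t -> 0 < F t) (lam0 : 0 < lam 0)
  (lam_gt0 : p = 0%N \/ forall t, 0 <= t -> 0 < lam t).

Let n0 : (0 < n)%N. Proof. exact: leq_trans n3. Qed.

Let lamp t : 0 <= t -> 0 < lam t ^+ p.
Proof. by move=> t0; case: lam_gt0 => [->|l]; [rewrite expr0|rewrite exprn_gt0 // l]. Qed.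

Let nk : 0 <= n%:R / (2 * p.+1%:R) - 1 :> R.
Proof. by rewrite subr_ge0 ler_pdivlMr ?mulr_gt0 ?ltr0n // mul1r -natrM ler_nat. Qed.

Let w t := hpow n t * (V t)^-1 ^+ n.
Let wgt t : 0 < t -> 0 < w t.
Proof. by move=> t0; rewrite mulr_gt0 ?hpow_gt0 // exprn_gt0 // invr_gt0 V_gt0 // ltW. Qed.

Let GE t : G t = w t * D t. Proof. by rewrite /prof_G /w; ring. Qed.

Let q t := p.+1%:R * mu * (mu * F t) ^+ p * (2 * - theta / V t ^+ 2).
Let qgt t : 0 <= t -> 0 < q t.
Proof.
move=> t0; have v0 := V_gt0 t0; have f0 := F_gt0 t0.
by rewrite /q !mulr_gt0 ?ltr0n ?exprn_gt0 ?invr_gt0 ?exprn_gt0 ?mulr_gt0 ?oppr_gt0.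
Qed.

Let dG (t : R) : 0 < t -> is_derive t (1 : R) G (- (w t * q t * H t)).
Proof.
move=> t0; apply: (der_eq (der_prof_G n0 V_gt0 t0 (DV t0) (DW t0) (ode t0))).
by rewrite /w /q; ring.
Qed.

Let HE t : 0 < t -> H t = ((mu * F t) ^+ p.+1 - (n%:R / (2 * p.+1%:R) - 1) * D t) / lam t ^+ p.
Proof.
move=> t0; rewrite -(prof_H_D n0 (ode t0)) mulfK // gt_eqF //.
exact/lamp/ltW.
Qed.

(** For theta < 0 the sign of H is not known beforehand, as H contains D. By [HE], G' is [gam] G
    minus a positive term; with L a bound of [gam], the factor exp(- L t) absorbs [gam] G and G
    cannot become positive. *)
Let D_le0 t : 0 < t -> D t <= 0.
Proof.
move=> t0.
pose gam s := q s * ((n%:R / (2 * p.+1%:R) - 1) * (lam s ^+ p)^-1).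
have cgam : cont0 gam.
  apply: cont0M.
    apply: cont0M.
      apply: cont0M; first exact: cont0_cst.
      by apply: cont0X; apply: cont0M; [exact: cont0_cst|exact: cont0_prof_F].
    apply: cont0M; first exact: cont0_cst.
    apply: cont0V; first exact: cont0X.
    by move=> s s0; rewrite expf_neq0 // gt_eqF // V_gt0.
  apply: cont0M; first exact: cont0_cst.
  apply: cont0V; first by apply: cont0X; exact: cont0_prof_lam.
  by move=> s s0; rewrite gt_eqF // lamp.
have [L L0 LP] := cont0_bounded t cgam.
suff : 0 <= - G t * expR (- L * t).
  rewrite pmulr_lge0 ?expR_gt0 // oppr_ge0 GE pmulr_rle0 //.
  exact: wgt.
apply: (@ge0_of_der _ (fun s => - G s * expR (- L * s))
  (fun s => - - (w s * q s * H s) * expR (- L * s) + - G s * (expR (- L * s) * - L)) t).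
- by apply: cont0M; [apply: cont0N; exact: cont0_prof_G|exact: cont0_expM].
- by rewrite prof_G0 // oppr0 mul0r.
- by move=> s /andP[s0 _]; apply: derM; [apply: derN; exact: dG|exact: der_expM].
- move=> s /andP[s0 st]; have s0' := ltW s0; rewrite pmulr_llt0 ?expR_gt0 // oppr_lt0 => Gs.
  have -> : - - (w s * q s * H s) * expR (- L * s) + - G s * (expR (- L * s) * - L) =
     (w s * q s * H s + L * G s) * expR (- L * s) by ring.
  apply: mulr_ge0; last exact: expR_ge0.
  have -> : w s * q s * H s = w s * q s * (mu * F s) ^+ p.+1 / lam s ^+ p - gam s * G s.
    by rewrite HE // GE /gam; field; rewrite gt_eqF ?lamp // addrC natr1 pnatr_eq0.
  have : 0 <= w s * q s * (mu * F s) ^+ p.+1 / lam s ^+ p.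
    have f0 := mulr_gt0 mu0 (F_gt0 s0').
    by rewrite ltW // divr_gt0 ?lamp // mulr_gt0 ?exprn_gt0 // mulr_gt0 ?wgt ?qgt.
  have : gam s * G s <= L * G s.
    rewrite ler_wpM2r ?(ltW Gs) //; apply: le_trans (ler_norm _) (LP s _).
    by rewrite s0' ltW.
  by lra.
- by rewrite lexx ltW.
Qed.

Let H_gt0 t : 0 < t -> 0 < H t.
Proof.
move=> t0; have t0' := ltW t0; rewrite HE // divr_gt0 ?lamp //.
have f0 : 0 < (mu * F t) ^+ p.+1 by rewrite exprn_gt0 // mulr_gt0 // F_gt0.
apply: (lt_le_trans f0); rewrite lerDl oppr_ge0.
by rewrite mulr_ge0_le0 // D_le0.
Qed.

Let D_lt0 t : 0 < t -> D t < 0.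
Proof.
move=> t0; suff : G t < 0 by rewrite GE pmulr_rlt0 // wgt.
have cG : {within `[0, t], continuous G} by apply: cont0_within => //; exact: cont0_prof_G.
have dG' (s : R) : s \in `]0, t[ -> is_derive s (1 : R) G (- (w s * q s * H s)).
  by rewrite in_itv => /andP[s0 _]; exact: dG.
have [s] := MVT t0 dG' cG; rewrite in_itv => /andP[s0 _].
rewrite prof_G0 // !subr0 => ->; rewrite mulNr oppr_lt0 mulr_gt0 //.
by rewrite mulr_gt0 ?H_gt0 // mulr_gt0 ?wgt // qgt // ltW.
Qed.

Let ZE t : 0 < t -> t * Z t = n%:R / p.+1%:R * (- D t) / (4 * V t * lam t ^+ p).
Proof.
move=> t0; have t0' := ltW t0; rewrite mulrN -(prof_Z_D n0 (ode t0)).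
have l0 : lam t ^+ p != 0 by rewrite gt_eqF // lamp.
by field; rewrite l0 gt_eqF // V_gt0.
Qed.

Let Z_gt0 t : 0 < t -> 0 < Z t.
Proof.
move=> t0; have t0' := ltW t0; rewrite -(pmulr_rgt0 _ t0) ZE //.
apply: divr_gt0; last by rewrite !mulr_gt0 ?V_gt0 ?lamp.
by rewrite mulr_gt0 ?divr_gt0 ?ltr0n // oppr_gt0 D_lt0.
Qed.

Let W_ge t : 0 <= t -> W 0 <= W t.
Proof.
move=> t0; apply: (@le_der _ (fun=> W 0) W (fun=> 0) Z 0 t) => //.
- exact: cont0_cst.
- by move=> s /andP[s0 _]; exact: DW.
- by move=> s /andP[s0 _]; exact/ltW/Z_gt0.
Qed.

Let W0 : 0 < W 0.
Proof.
have := lam0; rewrite /prof_lam /prof_S mul0r subr0 -mulrA pmulr_rgt0 //.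
by rewrite pmulr_lgt0 // V_gt0.
Qed.

Let W_gt0 t : 0 <= t -> 0 < W t.
Proof. by move=> t0; exact: lt_le_trans (W_ge t0). Qed.

Let dS (t : R) : 0 < t -> is_derive t (1 : R) S (- (t * Z t)).
Proof. by move=> t0; apply: der_prof_S; [exact: DV|exact: DW]. Qed.

Let S_anti s t : 0 <= s -> s <= t -> S t <= S s.
Proof.
move=> s0 st; apply: (@le_der _ S (fun=> S s) (fun r => - (r * Z r)) (fun=> 0) s t) => //.
- exact: cont0_prof_S.
- exact: cont0_cst.
- by move=> r /andP[sr _]; apply: dS; exact: le_lt_trans sr.
- move=> r /andP[sr _]; have r0 := le_lt_trans s0 sr.
  by rewrite oppr_le0 mulr_ge0 ?(ltW r0) // ltW // Z_gt0.
Qed.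

Let F_mono s t : 0 <= s -> s <= t -> F s <= F t.
Proof.
move=> s0 st; have cF := @cont0_prof_F _ theta c _ _ cV cW V_gt0.
have H0 := @le_der _ (fun=> F s) F (fun=> 0) (fun r => - (2 * theta / V r ^+ 2 * H r)) s t
  (@cont0_cst _ _) cF s0 st.
apply: H0 (lexx _).
- move=> r /andP[sr _]; have r0 := le_lt_trans s0 sr.
  exact: (der_prof_F theta c V_gt0 r0 (DV r0) (DW r0)).
- move=> r /andP[sr _]; have r0 := le_lt_trans s0 sr.
  have -> : - (2 * theta / V r ^+ 2 * H r) = 2 * - theta / V r ^+ 2 * H r by ring.
  apply: mulr_ge0; last exact/ltW/H_gt0.
  apply: divr_ge0; last by rewrite exprn_ge0 // ltW // V_gt0 // ltW.
  by rewrite mulr_ge0 // oppr_ge0 ltW.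
Qed.

(* Past t2 the profile satisfies P > 1/2, so that lam decreases. *)
Let S_pos_absurd : ~ (forall t, 0 <= t -> 0 < S t).
Proof.
(* Since W >= W(0) and S <= V(0), from [t2] on t W >= V(0) >= S, that is V <= 2 t W. *)
move=> S_gt0; pose t2 := V 0 / W 0 + 1.
have v00 := V_gt0 (lexx 0).
have t20 : 0 < t2 by rewrite addr_gt0 ?divr_gt0.
have pos t : t2 <= t -> 0 < t by exact: lt_le_trans.
have lpos t : 0 <= t -> 0 < lam t by move=> t0; rewrite !mulr_gt0 ?W_gt0 ?S_gt0.
have half t : t2 <= t -> V t - 2 * t * W t <= 0.
  move=> tt; have t0 := ltW (pos t tt).
  have h1 := S_anti (lexx 0) t0; rewrite {2}/prof_S mul0r subr0 in h1.
  have h2 : V 0 <= t * W t.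
    apply: (@le_trans _ _ (t * W 0)); last by rewrite ler_wpM2l // W_ge.
    by rewrite -ler_pdivrMr //; apply: le_trans tt; rewrite lerDl.
  by move: h1; rewrite /prof_S; lra.
have lam_anti t : t2 <= t -> lam t <= lam t2.
  move=> tt; apply: (@le_derc _ lam (fun=> lam t2)
     (fun t => 2 * Z t * (V t - 2 * t * W t)) (fun=> 0) t2 t) => //.
  - by move=> s /andP[/pos s0 _]; exact: der_prof_lam (DV s0) (DW s0).
  - move=> s /andP[st2 _]; rewrite mulr_ge0_le0 ?half // mulr_ge0 // ltW // Z_gt0 //.
    exact: pos.
have D_anti t : t2 <= t -> D t <= D t2.
  move=> tt; have t0 := pos t tt.
  have f2 := F_gt0 (ltW t20); have ft := F_gt0 (ltW t0).
  apply: lerB.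
    by rewrite lerXn2r ?nnegrE ?lam_anti // ltW // lpos // ltW.
  rewrite lerXn2r ?nnegrE ?mulr_ge0 ?(ltW mu0) ?(ltW f2) ?(ltW ft) //.
  by rewrite ler_wpM2l ?(ltW mu0) // F_mono // ltW.
pose M := V t2 / t2.
have V_le t : t2 <= t -> V t <= M * t.
  move=> tt; have t0 := pos t tt; rewrite -ler_pdivrMr //.
  apply: (@le_derc _ (fun s => V s / s) (fun=> M)
     (fun s => W s * s^-1 + V s * (- 1 / s ^+ 2)) (fun=> 0) t2 t) => //.
  - move=> s /andP[/pos s0 _]; apply: derM; first exact: DV.
    by apply: derV (der_id s); rewrite gt_eqF.
  - move=> s /andP[/pos s0 _].
    have -> : W s * s^-1 + V s * (- 1 / s ^+ 2) = - (S s / s ^+ 2).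
      by rewrite /prof_S; field; rewrite gt_eqF.
    by rewrite oppr_le0 divr_ge0 ?exprn_ge0 ?(ltW s0) // ltW // S_gt0 // ltW.
have M0 : 0 < M by rewrite divr_gt0 // V_gt0 // ltW.
(* In t Z = (n/k) (- D) / (4 V lam^p), D and lam are at most their values at [t2], and V <= M t
   because V/t has derivative - S / t^2. Hence S' = - t Z <= - e / t. *)
pose e := n%:R / p.+1%:R * (- D t2) / (4 * M * lam t2 ^+ p).
have e0 : 0 < e.
  apply: divr_gt0; last first.
    by apply: mulr_gt0 (lamp (ltW t20)); exact: mulr_gt0.
  by rewrite mulr_gt0 ?divr_gt0 ?ltr0n // oppr_gt0 D_lt0.
apply: (pos_slow_decay t20 e0 (f := S) (df := fun t => - (t * Z t))).
- by move=> t /pos t0; exact: dS.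
- move=> t tt; have t0 := pos t tt; rewrite lerN2 ZE //.
  have -> : e / t = n%:R / p.+1%:R * (- D t2) / (4 * (M * t) * lam t2 ^+ p).
    have l2n : lam t2 ^+ p != 0 by rewrite gt_eqF // lamp // ltW.
    rewrite /e; field.
    by rewrite l2n (gt_eqF t0) (gt_eqF M0) /= addrC natr1 pnatr_eq0.
  have v0 := V_gt0 (ltW t0); have l2 := lamp (ltW t20); have lt := lamp (ltW t0).
  have p1 : 0 < 4 * (M * t) * lam t2 ^+ p.
    by apply: mulr_gt0 l2; apply: mulr_gt0 => //; exact: mulr_gt0.
  have p2 : 0 < 4 * V t * lam t ^+ p by apply: mulr_gt0 lt; exact: mulr_gt0.
  apply: ler_pM.
  - by rewrite mulr_ge0 ?divr_ge0 // oppr_ge0 D_le0.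
  - by rewrite invr_ge0 ltW.
  - by rewrite ler_wpM2l ?divr_ge0 // lerN2 D_anti.
  - rewrite lef_pV2 ?posrE //; apply: ler_pM; [|exact: ltW| |].
    + by rewrite mulr_ge0 // ltW.
    + by rewrite ler_wpM2l // V_le.
    + by rewrite lerXn2r ?nnegrE ?lam_anti // ltW // lpos // ltW.
- by move=> t /pos/ltW t0; exact/ltW/S_gt0.
Qed.

(** If lam > 0 then S > 0, which was excluded. For k = 1 the sign of lam is unknown, but once S <= 0
    strict convexity makes S < 0, that is P > 1; then t P' >= (n/2 - 1) P (P - 1), a Riccati
    inequality whose blow-up shows in the decay of 1 / (1 + P). *)
Theorem no_profile : False.
Proof.
apply: S_pos_absurd => t3 t30; case: lam_gt0 => [p0|/(_ _ t30)]; last first.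
  by rewrite /prof_lam pmulr_rgt0 // mulr_gt0 // W_gt0.
rewrite ltNge; apply/negP => S3.
pose t4 := t3 + 1; have t40 : 0 < t4 by rewrite ltr_wpDl.
have pos t : t4 <= t -> 0 < t by exact: lt_le_trans.
have S4 : S t4 < 0.
  have cS : {within `[t3, t4], continuous S} by apply: cont0_within => //; exact: cont0_prof_S.
  have t34 : t3 < t4 by rewrite ltrDl.
  have dS' (s : R) : s \in `]t3, t4[ -> is_derive s (1 : R) S (- (s * Z s)).
    by rewrite in_itv => /andP[s0 _]; apply: dS; exact: le_lt_trans s0.
  have [s] := MVT t34 dS' cS; rewrite in_itv => /andP[s0 _] e.
  have s0' := le_lt_trans t30 s0.
  have : S t4 - S t3 < 0.
    by rewrite e mulNr oppr_lt0 mulr_gt0 ?subr_gt0 // mulr_gt0 // Z_gt0.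
  by move: S3; lra.
have P_ge0 t : 0 <= t -> 0 <= P t.
  by move=> t0; rewrite /prof_P divr_ge0 ?mulr_ge0 ?(ltW (W_gt0 t0)) ?(ltW (V_gt0 t0)).
have dP (t : R) : 0 < t -> is_derive t (1 : R) P (H t / 2 / V t ^+ 2).
  by move=> t0; exact: (der_prof_P V_gt0 t0 (DV t0) (DW t0)).
have P_mono t : t4 <= t -> P t4 <= P t.
  move=> tt; apply: (@le_derc _ (fun=> P t4) P (fun=> 0) (fun t => H t / 2 / V t ^+ 2) t4 t) => //.
  - by move=> s /andP[/pos s0 _]; exact: dP.
  - move=> s /andP[/pos s0 _]; rewrite !divr_ge0 ?exprn_ge0 ?(ltW (H_gt0 s0)) //.
    by rewrite ltW // V_gt0 // ltW.
have P4 : 1 < P t4.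
  rewrite /prof_P ltr_pdivlMr ?V_gt0 ?(ltW t40) // mul1r.
  by move: S4; rewrite /prof_S; lra.
(* Chosen so that P - 1 >= eta (P + 1) whenever P >= P(t4). Together with P >= (1 + P) / 2 this
   bounds P (P - 1) below by (eta / 2) (1 + P)^2. *)
pose eta := (P t4 - 1) / (P t4 + 1).
pose m : R := n%:R / 2 - 1.
have m0 : 0 < m by rewrite subr_gt0 ltr_pdivlMr // mul1r ltr_nat.
have eta0 : 0 < eta by apply: divr_gt0; lra.
have e0 : 0 < m * (eta / 2) by apply: mulr_gt0 => //; exact: divr_gt0.
apply: (pos_slow_decay t40 e0 (f := fun t => (1 + P t)^-1)
   (df := fun t => - (0 + H t / 2 / V t ^+ 2) / (1 + P t) ^+ 2)).
- move=> t /pos t0; apply: derV; first by rewrite gt_eqF // ltr_wpDr // P_ge0 // ltW.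
  by apply: (derD (der_cst t 1)); exact: dP.
- move=> t tt; have t0 := pos t tt; have v0 := V_gt0 (ltW t0).
  have P1 : 1 < P t := lt_le_trans P4 (P_mono t tt).
  have Hl : - (n%:R - 2) * W t * S t <= H t.
    have DE : D t = lam t - mu * F t by rewrite /prof_D p0 !expr1.
    have := HE t0; rewrite DE p0 expr0 divr1 !expr1 mulr1 => ->.
    have f0 : 0 < mu * F t by rewrite mulr_gt0 // F_gt0 // ltW.
    have -> : mu * F t - (n%:R / 2 - 1) * (lam t - mu * F t) =
       - (n%:R - 2) * W t * S t + n%:R / 2 * (mu * F t) by rewrite /prof_lam; field.
    by rewrite lerDl mulr_ge0 ?divr_ge0 // ltW.
  have key : m / t * (P t * (P t - 1)) <= H t / 2 / V t ^+ 2.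
    have -> : m / t * (P t * (P t - 1)) = - (n%:R - 2) * W t * S t / 2 / V t ^+ 2.
      by rewrite /m /prof_P /prof_S; field; rewrite !gt_eqF.
    by rewrite ler_wpM2r ?invr_ge0 ?exprn_ge0 ?(ltW v0) // ler_wpM2r ?invr_ge0.
  rewrite add0r mulNr lerN2 ler_pdivlMr ?exprn_gt0 //; last by lra.
  apply: le_trans key.
  have -> : m * (eta / 2) / t * (1 + P t) ^+ 2 = m / t * (((1 + P t) / 2) * (eta * (P t + 1))).
    by field; rewrite gt_eqF.
  apply: ler_wpM2l; first by rewrite divr_ge0 // ltW.
  apply: ler_pM.
  - by rewrite divr_ge0 //; lra.
  - by rewrite mulr_ge0 ?(ltW eta0) //; lra.
  - by rewrite ler_pdivrMr //; lra.
  - have Pm := P_mono t tt; rewrite /eta mulrAC ler_pdivrMr; last by lra.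
    by nra.
- by move=> t /pos/ltW t0; rewrite invr_ge0 addr_ge0 // P_ge0.
Qed.

End Nonexistence.

(** * The profile of a given radial solution *)

Section Rays.
Context {R : realType} {n : nat}.

Lemma der_ray (f : 'rV[R]_n -> R) (x : 'rV[R]_n) (s d : R) :
  is_derive (s *: x) x (f : 'rV[R]_n -> R^o) d ->
  is_derive s (1 : R) (fun r => f (r *: x)) d.
Proof.
move=> /is_derive_line fd.
have D1 : is_derive s (1 : R) (fun r => r - s) 1.
  by apply: (der_eq (derD (der_id s) (der_cst s (- s)))); rewrite addr0.
have fd' : is_derive (s - s) (1 : R) (fun h : R => f (h *: x + s *: x)) d by rewrite subrr.
have := @der_comp _ (fun h : R => f (h *: x + s *: x)) (fun r => r - s) s _ _ D1 fd'.
rewrite mulr1; congr (is_derive _ _ _ _).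
by apply/funext => r; rewrite -scalerDl subrK.
Qed.

Lemma enormZ (s : R) (x : 'rV[R]_n) : 0 <= s -> enorm (s *: x) = s * enorm x.
Proof.
move=> s0; rewrite /enorm; have -> : dot (s *: x) (s *: x) = s ^+ 2 * dot x x.
  by rewrite /dot mulr_sumr; apply: eq_bigr => i _; rewrite !mxE; ring.
by rewrite sqrtrM ?sqr_ge0 // sqrtr_sqr ger0_norm.
Qed.

Lemma radial_derivative0_cst (f : 'rV[R]_n -> R) : smooth f ->
  (forall x, x != 0 -> radial_derivative f x = 0) -> forall x, f x = f 0.
Proof.
move=> sf f0 x; have [->//|x0] := eqVneq x 0.
have df := (sf 1%N).1; have r0 := enorm_gt0 x0.
have cf : cont0 (fun s : R => f (s *: x)).
  apply: continuous_cont0 => s; apply: (@continuous_comp _ _ _ (fun s : R => s *: x) f).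
    exact: scalel_continuous.
  exact: (Cdiff_continuous (sf 0%N)).
have D (s : R) : 0 < s -> is_derive s (1 : R) (fun r => f (r *: x)) 0.
  move=> s0; apply: der_ray; have sx0 : s *: x != 0 by rewrite scaler_eq0 gt_eqF.
  have := f0 _ sx0; rewrite /radial_derivative enormZ ?ltW // scalerA invfM -mulrA mulrC -mulrA.
  rewrite mulfV ?gt_eqF // mulr1 deriveE; last exact: df.
  rewrite linearZ => /eqP; rewrite scaler_eq0 invr_eq0 gt_eqF //= => /eqP h.
  apply: DeriveDef; first exact: diff_derivable.
  by rewrite deriveE.
have := @eq_der _ (fun s : R => f (s *: x)) (fun=> f 0) (fun=> 0) 0 1 cf (@cont0_cst _ _) (lexx _) ler01.
rewrite scale1r scale0r; apply => // t /andP[t0 _]; exact: D.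
Qed.

End Rays.

Section Necessity.
Context {R : realType}.
Variables (n p : nat) (theta rho : R).
Hypotheses (n3 : (3 <= n.+1)%N) (n2p : (2 * p.+1 <= n.+1)%N).
Local Notation k := (p.+1).
Local Notation c := (2 * theta + rho).
Variable u : 'rV[R]_n.+1 -> R.
Hypotheses (su : smooth u) (u0 : forall x, 0 < u x) (ru : radial u).
Hypotheses (equ : kyamabe_equation k theta rho u) (adm : admissible k u).
Local Notation v := (vfun p u).
Let e : 'rV[R]_n.+1 := delta_mx 0 0.
Let B : R := 'C(n.+1, k)%:R.
Let mu : R := B^-1 `^ (k%:R^-1).

Let kn : (k <= n.+1)%N.
Proof. by apply: leq_trans n2p; rewrite leq_pmull. Qed.
Let B0 : 0 < B. Proof. by rewrite ltr0n bin_gt0. Qed.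
Let mu0 : 0 < mu. Proof. by rewrite powR_gt0 // invr_gt0. Qed.
Let muk : mu ^+ k = B^-1.
Proof.
rewrite -powR_mulrn ?powR_ge0 // -powRrM mulVf ?pnatr_eq0 // powRr1 //.
by rewrite invr_ge0 ltW.
Qed.

Let dot_e (s : R) : dot (s *: e) (s *: e) = s ^+ 2.
Proof.
rewrite /dot (bigD1 0) //= big1 => [|i i0]; rewrite !mxE ?eqxx /= ?(negbTE i0) ?mulr0 ?mulr1 ?addr0 //.
Qed.

Let g (s : R) := v (s *: e).
Let g1 (s : R) := partial 0 v (s *: e).
Let g2 (s : R) := hess v (s *: e) 0 0.

Let Dg (s : R) : is_derive s (1 : R) g (g1 s).
Proof. by apply: der_ray; exact: pder_vfun. Qed.

Let Dg1 (s : R) : is_derive s (1 : R) g1 (g2 s).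
Proof. by apply: der_ray; exact: pder2_vfun. Qed.

Let g1_0 : g1 0 = 0.
Proof.
have D2 : is_derive (0 : R) (1 : R) (fun s => g (- s)) (g1 0 * - 1).
  have D1 : is_derive (0 : R) (1 : R) (fun s => - s) (- 1) by apply: derN; exact: der_id.
  by apply: (@der_comp _ g (fun s => - s) 0 _ _ D1); rewrite oppr0; exact: Dg.
have E : (fun s => g (- s)) = g.
  apply/funext => s; rewrite /g /vfun; congr (_ `^ _); apply: ru.
  by rewrite /enorm !dot_e sqrrN.
rewrite E in D2; have := der_unique D2 (Dg 0); lra.
Qed.

(** From V(s^2) = g(s) one gets 2 V'(s^2) = g'(s) / s. As g is even, g'(0) = 0 and the quotient
    extends to 0 by g''(0). *)
Let G1 s := if s == 0 then g2 0 else g1 s / s.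

Let cG1 : continuous G1.
Proof.
move=> s; have [->|s0] := eqVneq s 0.
  (* [G1] is the Caratheodory slope of [g1] at 0, so its continuity there is the differentiability
     of [g1]. *)
  have /is_derive1_caratheodory [h [hE hc h0]] := Dg1 0.
  suff -> : G1 = h by exact: hc.
  apply/funext => z; rewrite /G1; case: eqP => [->//|/eqP z0].
  by have := hE z; rewrite g1_0 !subr0 => ->; rewrite mulfK.
have D1 := derM (Dg1 s) (@derV _ (fun z => z) s _ s0 (der_id s)).
apply: (@der_continuous _ _ _ (g2 s * s^-1 + g1 s * (- 1 / s ^+ 2))).
apply: (der_near _ D1); near=> z.
have z0 : z != 0 by near: z; apply: (@open_neq _ 0).
by rewrite /G1 (negbTE z0).
Unshelve. all: by end_near. Qed.

Let V (t : R) := g (Num.sqrt t).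
Let W (t : R) := 2^-1 * G1 (Num.sqrt t).
Let Z (t : R) := 2^-1 * ((g2 (Num.sqrt t) * (Num.sqrt t)^-1
   + g1 (Num.sqrt t) * (- 1 / Num.sqrt t ^+ 2)) * (2 * Num.sqrt t)^-1).

Let cV : cont0 V.
Proof.
apply: continuous_cont0 => t; apply: (@continuous_comp _ _ _ (@Num.sqrt R) g).
  exact: sqrt_continuous.
exact: der_continuous (Dg _).
Qed.

Let cW : cont0 W.
Proof.
apply: cont0M; first exact: cont0_cst.
apply: continuous_cont0 => t; apply: (@continuous_comp _ _ _ (@Num.sqrt R) G1).
  exact: sqrt_continuous.
exact: cG1.
Qed.

Let V_gt0 t : 0 <= t -> 0 < V t. Proof. by move=> _; exact: vfun_gt0. Qed.

Let DV (t : R) : 0 < t -> is_derive t (1 : R) V (W t).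
Proof.
move=> t0; have s0 : Num.sqrt t != 0 by rewrite gt_eqF // sqrtr_gt0.
apply: (der_eq (der_comp (is_derive1_sqrt t0) (Dg (Num.sqrt t)))).
by rewrite /W /G1 (negbTE s0); field.
Qed.

Let DW (t : R) : 0 < t -> is_derive t (1 : R) W (Z t).
Proof.
move=> t0; have s0 : Num.sqrt t != 0 by rewrite gt_eqF // sqrtr_gt0.
have D1 := derM (Dg1 (Num.sqrt t)) (@derV _ (fun z => z) (Num.sqrt t) _ s0 (der_id _)).
have D2 := @der_comp _ (fun s => g1 s * s^-1) _ _ _ _ (is_derive1_sqrt t0) D1.
have D3 := derM (der_cst t 2^-1) D2.
apply: (@der_eq_pos _ _ W t _ t0 _ (der_eq D3 _)).
  move=> s s_gt0; have s0' : Num.sqrt s != 0 by rewrite gt_eqF // sqrtr_gt0.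
  by rewrite /W /G1 (negbTE s0').
by rewrite mul0r add0r /Z.
Qed.

Let vE : v = fun x => V (dot x x).
Proof.
apply/funext => x; rewrite /V /g /vfun; congr (_ `^ _); apply: ru.
by rewrite -/(enorm x) /enorm dot_e sqrtr_sqr ger0_norm // sqrtr_ge0.
Qed.

Let px x i : partial i v x = 2 * x 0 i * W (dot x x).
Proof. by rewrite vE; apply: pderE; exact: pder_radial. Qed.

Let hx x : hess v x = (2 * W (dot x x))%:M + (4 * Z (dot x x)) *: (x^T *m x).
Proof.
apply/matrixP => i j; rewrite mxE; apply: pderE.
rewrite (_ : partial j _ = fun y => 2 * y 0 j * W (dot y y)); last first.
  by apply/funext => y; exact: px.
have [->|x0] := eqVneq x 0; last first.
  apply: pder2_radial; apply: (pder_eq (@pder_comp _ _ _ W _ _ _ _ (pder_dot i x) (DW (dot_gt0 x0)))).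
  by rewrite mulrC.
(* At the origin [Z 0] is a default value, multiplied by x^T x = 0. The remaining derivative of 2
   x_j W(|x|^2) follows from continuity of [W], again through a Caratheodory slope. *)
apply/is_derive_line; rewrite dot0 mulmx0 scaler0 addr0 !mxE.
apply/is_derive1_caratheodory; exists (fun z => 2 * (i == j)%:R * W (z ^+ 2)); split.
- move=> z; rewrite !addr0 scale0r [(0 : 'rV[R]_n.+1) 0 j]mxE mulr0 mul0r !subr0.
  have -> : dot (z *: delta_mx 0 i) (z *: delta_mx 0 i) = z ^+ 2 :> R.
    rewrite /dot (bigD1 i) //= big1 => [|l l0]; rewrite !mxE ?eqxx /= ?(negbTE l0) ?mulr0 ?mulr1 ?addr0 //.
  by rewrite !mxE eqxx /= eq_sym; ring.
- apply: continuousM; first exact: cst_continuous.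
  rewrite (_ : (fun z => _) = (fun t => W `|t|) \o (fun z : R => z ^+ 2)); last first.
    by apply/funext => z /=; rewrite ger0_norm // sqr_ge0.
  apply: continuous_comp; last exact: cW.
  exact: exprn_continuous.
- by rewrite expr0n /= -mulr_natr; ring.
Qed.

Let at_t t : 0 <= t -> exists x : 'rV[R]_n.+1, dot x x = t.
Proof. by move=> t0; exists (Num.sqrt t *: e); rewrite dot_e sqr_sqrtr. Qed.

Let sigma_t t j : 0 <= t -> (j < k)%N ->
  0 < prof_lam V W t ^+ j * (prof_lam V W t + j.+1%:R / n.+1%:R * (4 * t * V t * Z t)).
Proof.
move=> t0 jk; have [x xt] := at_t t0.
have := adm x (j := j.+1); rewrite /= jk => /(_ isT).
have vx : v x = V (dot x x) by rewrite vE.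
rewrite (sigma_atE n3 su u0 vx (px x) (hx x)); last exact: leq_trans jk kn.
by rewrite pmulr_rgt0 ?ltr0n ?bin_gt0 ?(leq_trans jk kn) // xt.
Qed.

(** F is positive because the equation identifies it with the k-th root of the positive sigma_k;
    raising to the power k then loses nothing. *)
Let F_t t : 0 <= t -> 0 < prof_F theta c V W t /\
  prof_lam V W t ^+ p * (prof_lam V W t + k%:R / n.+1%:R * (4 * t * V t * Z t)) = (mu * prof_F theta c V W t) ^+ k.
Proof.
move=> t0; have [x xt] := at_t t0.
have vx : v x = V (dot x x) by rewrite vE.
have s0 : 0 < sigma k (gschouten (yamabe_metric k u) x) by apply: adm; rewrite /= leqnn.
have /(equation_at theta rho n3 n2p su u0 vx (px x) (hx x) s0) := equ x.
rewrite -/(prof_P V W (dot x x)) xt -/(prof_F theta c V W t) => FE.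
have F0 : 0 < prof_F theta c V W t by rewrite -FE powR_gt0.
split=> //; have FK : prof_F theta c V W t ^+ k = sigma k (gschouten (yamabe_metric k u) x).
  rewrite -FE /sigma_root -powR_mulrn ?powR_ge0 // -powRrM mulVf ?pnatr_eq0 //.
  by rewrite powRr1 // ltW.
rewrite [(mu * _) ^+ _]exprMn muk FK (sigma_atE n3 su u0 vx (px x) (hx x)); last exact: kn.
rewrite xt -/(prof_S V W t) -/(prof_lam V W t); apply/esym/mulKf.
by rewrite gt_eqF.
Qed.

Lemma necessity_c : 0 < c.
Proof. by have [] := F_t (lexx 0); rewrite /prof_F /prof_P !mul0r mulr0 subr0. Qed.

Let lam0 : 0 < prof_lam V W 0.
Proof. by have := @sigma_t 0 0%N (lexx _) isT; rewrite expr0 mul1r mulr0 !mul0r mulr0 addr0. Qed.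

(** For k >= 2 the factor lam^p in sigma_k > 0 forbids zeros of lam, so lam keeps its sign at 0. For
    k = 1 this factor is 1 and says nothing, hence the alternative. *)
Let lam_gt0 : p = 0%N \/ forall t, 0 <= t -> 0 < prof_lam V W t.
Proof.
case: (posnP p) => [|p0]; [by left|right].
have cl : cont0 (prof_lam V W) by exact: cont0_prof_lam.
have ln0 t : 0 <= t -> prof_lam V W t != 0.
  move=> t0; have := sigma_t t0 (ltnSn p); apply: contraTneq => ->.
  by rewrite expr0n eqn0Ngt p0 mul0r ltxx.
apply: cont0_open_induction => // T T0 lt; rewrite lt_neqAle eq_sym (ln0 _ (ltW T0)) /=.
rewrite leNgt; apply/negP => lT.
have nl : 0 < - prof_lam V W T by rewrite oppr_gt0.
have [d d0 dP] := cont0_pos_near (cont0N cl) (ltW T0) nl.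
pose s := Num.max (T / 2) (T - d / 2).
have sT : 0 <= s < T.
  rewrite le_max divr_ge0 ?(ltW T0) //= gt_max gtrBl divr_gt0 // andbT.
  by rewrite ltr_pdivrMr // ltr_pMr ?ltr1n.
have /andP[s0 sT'] := sT.
have : 0 < - prof_lam V W s.
  apply: dP => //; rewrite distrC ger0_norm ?subr_ge0 ?(ltW sT') //.
  have sd : T - d / 2 <= s by rewrite le_max lexx orbT.
  rewrite ltrBlDl -ltrBlDr (lt_le_trans _ sd) // ltrD2l ltrN2.
  by rewrite ltr_pdivrMr // ltr_pMr ?ltr1n.
by rewrite oppr_gt0 ltNge ltW // lt.
Qed.

Lemma necessity_theta : nontrivial k theta rho u -> 0 < theta.
Proof.
move=> [phi [sphi rphi _ dphi] ncst]; rewrite ltNge; apply/negP.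
rewrite le_eqVlt => /orP[/eqP theta0|theta0]; last first.
  apply: (no_profile n3 n2p theta0 mu0 cV cW V_gt0 DV DW _ _ lam0 lam_gt0).
    by move=> t t0; exact: (F_t (ltW t0)).2.
  by move=> t t0; exact: (F_t t0).1.
apply: ncst; exists (phi 0) => x; apply: radial_derivative0_cst => // y y0.
have := dphi y; rewrite theta0 mulr0 !mul0r => /eqP; rewrite mulf_eq0.
by rewrite gt_eqF ?enorm_gt0 //= => /eqP.
Qed.

End Necessity.

Unset Implicit Arguments.
Set Strict Implicit.

Theorem theorem1p2 (R : realType) (n k : nat) (theta rho : R)
    (hn : (3 <= n)%N) (hk : (1 <= k)%N) (hnk : (2 * k <= n)%N)
    (alpha : R) (halpha : 0 < alpha) :
  (exists u : 'rV[R]_n -> R,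
     [/\ smooth u, (forall x, 0 < u x), radial u & u 0 = alpha] /\
     [/\ kyamabe_equation k theta rho u, admissible k u
       & nontrivial k theta rho u])
  <-> (0 < theta /\ 0 < 2 * theta + rho).
Proof.
case: n k hn hk hnk => [//|n] [//|p] n3 _ n2p; split.
  move=> [u [[su u0 ru _] [eq adm nt]]]; split.
    exact: (necessity_theta n3 n2p su u0 ru eq adm nt).
  exact: (necessity_c n3 n2p su u0 ru eq adm).
by move=> [theta0 c0]; exact: sufficiency.
Qed.
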